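(* Let $\mathcal{G}^{E_7}$ be the simple complex Lie algebra of type $E_7$, let $V$ be its 56-dimensional irreducible module of highest weight $\lambda_7$ with basis $x_1,\dots,x_{56}$, and let $\mathcal{A}=\mathbb{C}[x_1,\dots,x_{56}]$ be the polynomial algebra (symmetric tensor algebra) over $V$, with all of these objects as specified in the context. There exist singular vectors in $\mathcal{A}$: the linear singular vector $x_1$ of weight $\lambda_7$, a homogeneous quadratic singular vector $\zeta_1$ of weight $\lambda_1$, a homogeneous cubic singular vector $\vartheta$ of weight $\lambda_7$, a homogeneous quartic singular vector $\varsigma$ of weight $\lambda_6$, and a homogeneous quartic singular vector $\eta$ of weight $0$ (Cartan's quartic $E_7$-invariant), for which the following hold. (1) Any singular vector in $\mathcal{A}$ is a polynomial in $x_1,\zeta_1,\vartheta,\varsigma,\eta$. (2) For nonnegative integers $n_1,\dots,n_5$, let $L(n_1,n_2,n_3,n_4,n_5)$ be the irreducible $\mathcal{G}^{E_7}$-submodule of $\mathcal{A}$ generated by $\zeta_1^{n_1}\varsigma^{n_2}x_1^{n_3}\vartheta^{n_4}\eta^{n_5}$, which has highest weight $n_1\lambda_1+n_2\lambda_6+(n_3+n_4)\lambda_7$. Then $$\mathcal{A}=\bigoplus_{n_1,n_2,n_3,n_4,n_5=0}^{\infty}L(n_1,n_2,n_3,n_4,n_5).$$ (3) In particular, as formal power series in $q$, $$(1-q)^{55}\sum_{n_1,n_2,n_3,n_4=0}^{\infty}\bigl(\dim V(n_1\lambda_1+n_2\lambda_6+(n_3+n_4)\lambda_7)\bigr)\,q^{2n_1+4n_2+n_3+3n_4}=1+q+q^2+q^3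 .$$ (4) Let $\mathcal{D}$ be the invariant differential operator dual to $\eta$, i.e. the constant-coefficient differential operator on $\mathcal{A}$ obtained from the polynomial $\eta$ by replacing each $x_i$ by $\partial_{x_i}$. Then $$\sum_{n_1,n_2,n_3=0}^{\infty}\bigl(L(n_1,n_2,n_3,0,0)+L(n_1,n_2,n_3,1,0)\bigr)\subset\{f\in\mathcal{A}\mid \mathcal{D}(f)=0\}.$$
   Context: Root lattice construction of $E_8$. Let $\alpha_1,\dots,\alpha_8$ be the simple roots of $E_8$, and let $Q_{E_8}=\sum_{i=1}^8\mathbb{Z}\alpha_i$ carry the symmetric $\mathbb{Z}$-bilinear form with $(\alpha_i,\alpha_i)=2$, $(\alpha_i,\alpha_j)=-1$ if $\{i,j\}$ is one of $\{1,3\},\{3,4\},\{2,4\},\{4,5\},\{5,6\},\{6,7\},\{7,8\}$, and $(\alpha_i,\alpha_j)=0$ for all other $i\neq j$. Let $\Phi_{E_8}=\{\alpha\in Q_{E_8}\mid(\alpha,\alpha)=2\}$ be the root system. Define $$F\Bigl(\sum_{i=1}^8k_i\alpha_i,\sum_{j=1}^8l_j\alpha_j\Bigr)=(-1)^{\sum_{i=1}^8k_il_i+\sum_{8\ge i>j\ge1}k_il_j(\alpha_i,\alpha_j)},\qquad k_i,l_j\in\mathbb{Z}.$$ Let $H_{E_8}=\sum_{i=1}^8\mathbb{C}\alpha_i$, with the form extended $\mathbb{C}$-bilinearly. The simple Lie algebra of type $E_8$ is $\mathcal{G}^{E_8}=H_{E_8}\oplus\bigoplus_{\alpha\in\Phi_{E_8}}\mathbb{C}E_\alpha$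 with bracket: $[H_{E_8},H_{E_8}]=0$; $[h,E_\alpha]=(h,\alpha)E_\alpha$ for $h\in H_{E_8}$; $[E_\alpha,E_{-\alpha}]=-\alpha$; and, for $\beta\neq-\alpha$, $[E_\alpha,E_\beta]=F(\alpha,\beta)E_{\alpha+\beta}$ if $\alpha+\beta\in\Phi_{E_8}$ and $[E_\alpha,E_\beta]=0$ if $\alpha+\beta\notin\Phi_{E_8}$. The Lie algebra $E_7$. Let $Q_{E_7}=\sum_{i=1}^7\mathbb{Z}\alpha_i$, $\Phi_{E_7}=\Phi_{E_8}\cap Q_{E_7}$, $H_{E_7}=\sum_{i=1}^7\mathbb{C}\alpha_i$, and $\mathcal{G}^{E_7}=H_{E_7}\oplus\bigoplus_{\alpha\in\Phi_{E_7}}\mathbb{C}E_\alpha\subset\mathcal{G}^{E_8}$, which is the simple Lie algebra of type $E_7$. Let $\Phi_{E_7}^+$ be the positive roots with respect to the simple roots $\alpha_1,\dots,\alpha_7$. The fundamental weights $\lambda_1,\dots,\lambda_7\in H_{E_7}$ are determined by $(\lambda_i,\alpha_j)=\delta_{i,j}$; a vector $v$ in a module has weight $\lambda$ if $h\cdot v=(h,\lambda)v$ for all $h\in H_{E_7}$. For a dominant integral weight $\lambda$, $V(\lambda)$ denotes the finite-dimensional irreducible $\mathcal{G}^{E_7}$-module with highest weight $\lambda$. The basic module. Let $V=\sum_\beta\mathbb{C}E_\beta$, where $\beta$ runs over the 56 positive roots of $E_8$ whose coefficient at $\alpha_8$ is $1$ (equivalently, the roots in $\Phi_{E_8}^+\setminus\Phi_{E_7}^+$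 other than the highest root of $E_8$). Under the adjoint action in $\mathcal{G}^{E_8}$, $V$ is the 56-dimensional irreducible $\mathcal{G}^{E_7}$-module of highest weight $\lambda_7$. The basis $x_1,\dots,x_{56}$ of $V$ is an enumeration of these root vectors $E_\beta$ with $x_1=E_\beta$ for $\beta=2\alpha_1+3\alpha_2+4\alpha_3+6\alpha_4+5\alpha_5+4\alpha_6+3\alpha_7+\alpha_8$ (the highest-weight vector). The polynomial algebra. $\mathcal{A}=\mathbb{C}[x_1,\dots,x_{56}]$ is the symmetric algebra of $V$, and $\mathcal{G}^{E_7}$ acts on it by derivations extending its action on $V$ (that is, by the linear vector fields $\sum_{i,j}a_{ij}x_i\partial_{x_j}$ corresponding to the matrices of the action on $V$). A singular vector in $\mathcal{A}$ is a weight vector annihilated by all positive root vectors $E_\alpha$, $\alpha\in\Phi_{E_7}^+$. *)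

(* Defs.v *)
From HB Require Import structures.
From mathcomp Require Export all_boot all_order all_algebra.
From mathcomp Require Export freeg mpoly.
From mathcomp Require Export complex.
From mathcomp Require reals.
From Stdlib Require ClassicalEpsilon.
Export reals.Real.Exports.

Set Implicit Arguments.
Unset Strict Implicit.
Unset Printing Implicit Defensive.

Import GRing.Theory Num.Theory.
Local Open Scope ring_scope.

(* Row vectors of length 8 are coordinate vectors in the simple roots of E_8
   (Bourbaki labelling): column i : 'I_8 is the coefficient at alpha_(i+1). *)

Definition E8edges : seq (nat * nat) :=
  [:: (1, 3); (3, 4); (2, 4); (4, 5); (5, 6); (6, 7); (7, 8)]%N.

Definition E8gram (i j : 'I_8) : int :=
  if i == j then 2
  else if ((i.+1, j.+1) \in E8edges) || ((j.+1, i.+1) \in E8edges) then -1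
  else 0.

(* Used both for R = int (the lattice Q) and for R a field (the space H). *)
Definition form (R : comNzRingType) (u v : 'rV[R]_8) : R :=
  \sum_(i < 8) \sum_(j < 8) u 0 i * v 0 j * (E8gram i j)%:~R.

Definition E8root := {a : 'rV[int]_8 | form a a == 2}.

Definition toH (R : comNzRingType) (a : 'rV[int]_8) : 'rV[R]_8 :=
  map_mx intr a.

Definition positive (a : E8root) : bool := [forall i, 0 <= val a 0 i].

Definition inQ7 (a : E8root) : bool := val a 0 ord_max == 0.

Section LieAlgebra.
Variable K : fieldType.

Definition Fsign (a b : 'rV[int]_8) : K :=
  (-1) ^ (\sum_(i < 8) a 0 i * b 0 i
          + \sum_(i < 8) \sum_(j < 8 | (j < i)%N) a 0 i * b 0 j * E8gram i j).

(* H_{E_8} (+) (+)_alpha K E_alpha; the second component is the free K-module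
   on the set of roots. *)
Definition E8alg : Type := ('rV[K]_8 * {freeg E8root / K})%type.
HB.instance Definition _ := GRing.Lmodule.on E8alg.

Definition Hel (h : 'rV[K]_8) : E8alg := (h, 0).
Definition Eel (a : E8root) : E8alg := (0, << a >>).

Definition bracketE (a b : E8root) : E8alg :=
  if val b == - val a then Hel (- toH K (val a))
  else if insub (val a + val b) is Some c then Fsign (val a) (val b) *: Eel c
  else 0.

Definition bracketHE (h : 'rV[K]_8) (b : E8root) : E8alg :=
  form h (toH K (val b)) *: Eel b.

Definition bracket (x y : E8alg) : E8alg :=
  fglift (bracketHE x.1) y.2 - fglift (bracketHE y.1) x.2
  + fglift (fun a => fglift (bracketE a) y.2) x.2.

Definition inH7 (h : 'rV[K]_8) : bool := h 0 ord_max == 0.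

Definition inE7 (x : E8alg) : bool := inH7 x.1 && all inQ7 (dom x.2).

Definition is_fundamental_weight (i : nat) (l : 'rV[K]_8) : Prop :=
  inH7 l /\
  forall j : 'I_8, (j < 7)%N -> form l (delta_mx 0 j) = (j.+1 == i)%:R.

(* A representation of the E_7 subalgebra is encoded by a map on all of E8alg
   of which only the restriction to inE7 is relevant. *)
Section Modules.
Variables (M : lmodType K) (rho : E8alg -> M -> M).

Definition is_E7module : Prop :=
  [/\ forall x, inE7 x ->
        forall c u v, rho x (c *: u + v) = c *: rho x u + rho x v,
      forall x y, inE7 x -> inE7 y ->
        forall c v, rho (c *: x + y) v = c *: rho x v + rho y v
    & forall x y, inE7 x -> inE7 y ->
        forall v, rho (bracket x y) v = rho x (rho y v) - rho y (rho x v)].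

Definition submodule (W : M -> Prop) : Prop :=
  [/\ W 0, forall c u v, W u -> W v -> W (c *: u + v)
    & forall x v, inE7 x -> W v -> W (rho x v)].

Definition generated (v w : M) : Prop :=
  forall W : M -> Prop, submodule W -> W v -> W w.

Definition irreducible (W : M -> Prop) : Prop :=
  [/\ submodule W, exists2 v, W v & v != 0
    & forall W' : M -> Prop, submodule W' -> (forall v, W' v -> W v) ->
        (forall v, W' v -> v = 0) \/ (forall v, W v -> W' v)].

Definition has_weight (l : 'rV[K]_8) (v : M) : Prop :=
  forall h, inH7 h -> rho (Hel h) v = form h l *: v.

Definition singular_of_weight (l : 'rV[K]_8) (v : M) : Prop :=
  [/\ v != 0, has_weight l v
    & forall a, inQ7 a -> positive a -> rho (Eel a) v = 0].

Definition singular (v : M) : Prop :=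
  exists2 l, inH7 l & singular_of_weight l v.

Definition is_invariant (v : M) : Prop := forall x, inE7 x -> rho x v = 0.

End Modules.

Definition is_dimV (l : 'rV[K]_8) (d : nat) : Prop :=
  exists (M : vectType K) (rho : E8alg -> M -> M),
    [/\ is_E7module rho, irreducible rho (fun _ => True),
        exists v, singular_of_weight rho l v & \dim {:M} = d].

(* dim V(l); meaningful for l dominant integral, where the module of is_dimV
   exists and is unique up to isomorphism. *)
Definition dimV (l : 'rV[K]_8) : nat :=
  ClassicalEpsilon.epsilon (inhabits 0%N) (is_dimV l).

Definition sum_subspaces (M : lmodType K) (I : eqType) (W : I -> M -> Prop)
    (v : M) : Prop :=
  exists (s : seq I) (g : I -> M),
    [/\ uniq s, forall i, i \in s -> W i (g i) & v = \sum_(i <- s) g i].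

Definition direct_decomposition (M : lmodType K) (I : eqType)
    (W : I -> M -> Prop) : Prop :=
  (forall v, sum_subspaces W v) /\
  (forall (s : seq I) (g : I -> M), uniq s ->
     (forall i, i \in s -> W i (g i)) -> \sum_(i <- s) g i = 0 ->
     forall i, i \in s -> g i = 0).

Definition add_subspaces (M : lmodType K) (U W : M -> Prop) (v : M) : Prop :=
  exists u w, [/\ U u, W w & v = u + w].

(* The variable 'X_i of {mpoly K[56]} stands for the root vector E_(beta i). *)
Definition highest_weight_root : 'rV[int]_8 :=
  \row_(i < 8) nth 0 [:: 2; 3; 4; 6; 5; 4; 3; 1] i.

Definition is_basis_enum (beta : 'I_56 -> E8root) : Prop :=
  [/\ injective beta,
      forall a, (exists i, beta i = a) <->
                positive a /\ val a 0 ord_max = 1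
    & val (beta ord0) = highest_weight_root].

Definition adV (beta : 'I_56 -> E8root) (x : E8alg) : 'M[K]_56 :=
  \matrix_(i, j) coeff (beta i) (bracket x (Eel (beta j))).2.

Definition actA (beta : 'I_56 -> E8root) (x : E8alg) (f : {mpoly K[56]}) :
    {mpoly K[56]} :=
  \sum_(i < 56) \sum_(j < 56) adV beta x i j *: ('X_i * mderiv j f).

Definition diff_op (n : nat) (p f : {mpoly K[n]}) : {mpoly K[n]} :=
  \sum_(m <- msupp p) p@_m *: mderivm m f.

End LieAlgebra.

(* Formal power series in q are represented by their coefficient sequences. *)
Definition fps_mul (s t : nat -> int) (N : nat) : int :=
  \sum_(i < N.+1) s i * t (N - i)%N.

(* Coefficient sequence of sum_n d(n) q^(2 n1 + 4 n2 + n3 + 3 n4); the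
   exponents n_k contributing to q^N are all at most N. *)
Definition graded_series (d : nat -> nat -> nat -> nat -> nat) (N : nat) : int :=
  \sum_(n1 < N.+1) \sum_(n2 < N.+1) \sum_(n3 < N.+1)
    \sum_(n4 < N.+1 | (2 * n1 + 4 * n2 + n3 + 3 * n4 == N)%N)
      (d n1 n2 n3 n4)%:Z.

(* Main.v *)
From HB Require Import structures.
Require Import Defs.
From mathcomp Require Import ring lra zify.
From Stdlib Require Classical_Prop.

Set Implicit Arguments.
Unset Strict Implicit.
Unset Printing Implicit Defensive.

Import Order.TTheory GRing.Theory Num.Theory.
Local Open Scope ring_scope.

(** Call covariant a polynomial annihilated by the positive root vectors. The
    proof determines the algebra of covariants by normal forms of points, and
    deduces the module structure of the polynomial algebra from a Hermitian form.

    The generators come from the quadratic moment map mu from the 56-dimensional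
    module to E_7. The component of mu along the highest root is zeta1, the
    component of weight lambda_6 of its symmetric square is sigma, its invariant
    norm is eta, and theta is the derivative of eta along the lowest weight
    vector. That these are covariants is checked on explicit lists of terms.

    A root vector acts on the 56-dimensional module with square zero,
    so a covariant is constant along the lines p + t E_a p ([linfield_flow]).
    Where x1, zeta1 and sigma do not vanish, such moves bring a point to one
    supported on five fixed weights, whose coordinates are rational functions of
    the values of the generators ([reach_nf], [upkilled_rational]). Hence the
    product of a covariant with a power of x1 zeta1 sigma is a polynomial in the
    generators. Each of the three factors can then be cancelled, because the
    other four generators still take arbitrary nonzero values on its zero set
    ([gens_divide]). This gives [upkilled_gens]; the same normal forms show that
    the generators are algebraically independent ([gens_indep]).

    For the Hermitian form in which monomials are orthogonal with
    squared norm the product of the factorials of the exponents, the adjoint of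
    E_a is - E_(-a), and the adjoint of multiplication by a polynomial with real
    coefficients is the differential operator dual to it. A module generated by a singular vector is spanned by that
    vector and the words in the negative root vectors applied to it, and these
    words are orthogonal to all covariants. Hence such a module contains no other
    covariant up to scalars and is irreducible ([generated_irreducible]), a
    relation between such modules can be raised to one between monomials in the
    generators ([Lm_direct]), and the orthogonal complement of their sum, having
    no nonzero covariant, is zero ([homog_S]).

    An irreducible module is determined by its highest weight, by the
    classical argument with the module generated by (v1, v2) in a product
    ([dim_le]). So the dimensions of the components of degree N add up to that of
    the polynomials of degree N. The components with a positive exponent of eta
    correspond to those of degree N - 4, which turns (1 - q)^(-56) into
    (1 - q^4) (1 - q)^(-56) for the others ([graded_series_dim]).

    The operator D dual to eta sends a product of zeta1, sigma, x1 and at most one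
    theta to a covariant orthogonal to all monomials in the generators: by
    adjunction their product is that of the given monomial with a multiple of eta,
    which differs from it in degree or weight ([D_mon]). *)

(** * The root lattice *)

Local Notation o k := (inord k : 'I_8).

Lemma sum8E (V : zmodType) (F : 'I_8 -> V) :
  \sum_i F i = F (o 0) + F (o 1) + F (o 2) + F (o 3) + F (o 4) + F (o 5)
               + F (o 6) + F (o 7).
Proof.
rewrite (eq_bigr (fun i : 'I_8 => F (inord i))) => [|i _]; last by rewrite inord_val.
by rewrite !big_ord_recl big_ord0 addr0 !addrA.
Qed.

Definition gram (i j : nat) : int :=
  if i == j then 2
  else if ((i.+1, j.+1) \in E8edges) || ((j.+1, i.+1) \in E8edges) then -1
  else 0.

Lemma E8gramE i j : (i < 8)%N -> (j < 8)%N -> E8gram (o i) (o j) = gram i j.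
Proof. by move=> hi hj; rewrite /E8gram /gram -val_eqE /= !inordK. Qed.

Lemma E8gramC i j : E8gram i j = E8gram j i.
Proof. by rewrite /E8gram eq_sym orbC. Qed.

Section Form.
Variable R : comNzRingType.
Implicit Types u v w : 'rV[R]_8.

Lemma formC u v : form u v = form v u.
Proof.
rewrite /form exchange_big; apply: eq_bigr => i _; apply: eq_bigr => j _.
by rewrite E8gramC (mulrC (u 0 j)).
Qed.

Lemma formPl c u v w : form (c *: u + v) w = c * form u w + form v w.
Proof.
rewrite /form mulr_sumr -big_split; apply: eq_bigr => i _ /=.
rewrite mulr_sumr -big_split; apply: eq_bigr => j _ /=.
by rewrite !mxE !mulrDl !mulrA.
Qed.

Lemma form0l w : form 0 w = 0.
Proof. by have := formPl (-1) 0 0 w; rewrite scaler0 addr0 mulN1r addNr. Qed.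

Lemma formDl u v w : form (u + v) w = form u w + form v w.
Proof. by rewrite -[u]scale1r formPl mul1r scale1r. Qed.

Lemma formZl c u w : form (c *: u) w = c * form u w.
Proof. by rewrite -[c *: u]addr0 formPl form0l addr0. Qed.

Lemma formNl u w : form (- u) w = - form u w.
Proof. by rewrite -scaleN1r formZl mulN1r. Qed.

Lemma formDr u v w : form w (u + v) = form w u + form w v.
Proof. by rewrite formC formDl !(formC w). Qed.

Lemma formNr u w : form w (- u) = - form w u.
Proof. by rewrite formC formNl (formC w). Qed.

Lemma form0r u : form u 0 = 0.
Proof. by rewrite formC form0l. Qed.

Lemma formZr c u w : form w (c *: u) = c * form w u.
Proof. by rewrite formC formZl (formC w). Qed.

Lemma formMnr u w n : form w (u *+ n) = form w u *+ n.
Proof. by rewrite -scaler_nat formZr mulr_natl. Qed.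

Lemma form_sumr (I : Type) (s : seq I) (P : pred I) (F : I -> 'rV[R]_8) u :
  form u (\sum_(i <- s | P i) F i) = \sum_(i <- s | P i) form u (F i).
Proof. by apply: (big_morph (form u)) => [x y|]; rewrite ?formDr ?form0r. Qed.

Lemma formE u v : form u v =
  (u 0 (o 0) * v 0 (o 0) + u 0 (o 1) * v 0 (o 1) + u 0 (o 2) * v 0 (o 2)
   + u 0 (o 3) * v 0 (o 3) + u 0 (o 4) * v 0 (o 4) + u 0 (o 5) * v 0 (o 5)
   + u 0 (o 6) * v 0 (o 6) + u 0 (o 7) * v 0 (o 7)) *+ 2
  - (u 0 (o 0) * v 0 (o 2) + u 0 (o 2) * v 0 (o 0)
     + u 0 (o 2) * v 0 (o 3) + u 0 (o 3) * v 0 (o 2)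
     + u 0 (o 1) * v 0 (o 3) + u 0 (o 3) * v 0 (o 1)
     + u 0 (o 3) * v 0 (o 4) + u 0 (o 4) * v 0 (o 3)
     + u 0 (o 4) * v 0 (o 5) + u 0 (o 5) * v 0 (o 4)
     + u 0 (o 5) * v 0 (o 6) + u 0 (o 6) * v 0 (o 5)
     + u 0 (o 6) * v 0 (o 7) + u 0 (o 7) * v 0 (o 6)).
Proof.
rewrite /form sum8E !sum8E !E8gramE // /gram /=.
rewrite ?mulr0z ?mulr0 ?addr0 ?add0r ?rmorphN ?rmorph1 /=.
ring.
Qed.

Lemma form_toH (a b : 'rV[int]_8) : form (toH R a) (toH R b) = (form a b)%:~R.
Proof.
rewrite /form rmorph_sum /=; apply: eq_bigr => i _.
by rewrite rmorph_sum /=; apply: eq_bigr => j _; rewrite !mxE !rmorphM /= intz.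
Qed.

Lemma toHD (a b : 'rV[int]_8) : toH R (a + b) = toH R a + toH R b.
Proof. exact: map_mxD. Qed.

End Form.

Section RootLattice.
Implicit Types a b c : 'rV[int]_8.

Lemma form_even a : exists k, form a a = k *+ 2.
Proof.
rewrite formE; set x0 := a 0 (o 0); set x1 := a 0 (o 1); set x2 := a 0 (o 2).
set x3 := a 0 (o 3); set x4 := a 0 (o 4); set x5 := a 0 (o 5).
set x6 := a 0 (o 6); set x7 := a 0 (o 7).
exists (x0 * x0 + x1 * x1 + x2 * x2 + x3 * x3 + x4 * x4 + x5 * x5 + x6 * x6
  + x7 * x7 - (x0 * x2 + x2 * x3 + x1 * x3 + x3 * x4 + x4 * x5 + x5 * x6 + x6 * x7)).
ring.
Qed.

Lemma rowP8 (R : Type) (u v : 'rV[R]_8) :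
  (forall k, (k < 8)%N -> u 0 (o k) = v 0 (o k)) -> u = v.
Proof.
by move=> h; apply/rowP => i; rewrite -(inord_val i); apply: h; apply: ltn_ord.
Qed.

(** Completing squares along the diagram, from the ends of the two short legs
    to the end of the long one. *)
Lemma form_gt0 a : a != 0 -> 0 < form a a.
Proof.
move=> an0; rewrite ltNge; apply/negP => hle; case/negP: an0.
have: form a a *+ 60 =
   (a 0 (o 0) *+ 2 - a 0 (o 2)) ^+ 2 *+ 30
 + (a 0 (o 1) *+ 2 - a 0 (o 3)) ^+ 2 *+ 30
 + (a 0 (o 2) *+ 3 - a 0 (o 3) *+ 2) ^+ 2 *+ 10
 + (a 0 (o 3) *+ 5 - a 0 (o 4) *+ 6) ^+ 2 *+ 2
 + (a 0 (o 4) *+ 4 - a 0 (o 5) *+ 5) ^+ 2 *+ 3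
 + (a 0 (o 5) *+ 3 - a 0 (o 6) *+ 4) ^+ 2 *+ 5
 + (a 0 (o 6) *+ 2 - a 0 (o 7) *+ 3) ^+ 2 *+ 10
 + a 0 (o 7) ^+ 2 *+ 30.
  by rewrite formE; ring.
set y0 := _ - _; set y1 := _ - a 0 (o 3); set y2 := _ - a 0 (o 3) *+ 2.
set y3 := _ - a 0 (o 4) *+ 6; set y4 := _ - a 0 (o 5) *+ 5.
set y5 := _ - a 0 (o 6) *+ 4; set y6 := _ - a 0 (o 7) *+ 3.
move=> e.
have sq0 (y : int) : y ^+ 2 = 0 -> y = 0 by move/eqP; rewrite sqrf_eq0 => /eqP.
have: [/\ y0 = 0, y1 = 0, y2 = 0 & y3 = 0] /\ [/\ y4 = 0, y5 = 0, y6 = 0 & a 0 (o 7) = 0].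
  move: e (sqr_ge0 y0) (sqr_ge0 y1) (sqr_ge0 y2) (sqr_ge0 y3) (sqr_ge0 y4)
    (sqr_ge0 y5) (sqr_ge0 y6) (sqr_ge0 (a 0 (o 7))).
  have h0 := sq0 y0; have h1 := sq0 y1; have h2 := sq0 y2; have h3 := sq0 y3.
  have h4 := sq0 y4; have h5 := sq0 y5; have h6 := sq0 y6; have h7 := sq0 (a 0 (o 7)).
  move: h0 h1 h2 h3 h4 h5 h6 h7 hle.
  move: (y0 ^+ 2) (y1 ^+ 2) (y2 ^+ 2) (y3 ^+ 2) (y4 ^+ 2) (y5 ^+ 2) (y6 ^+ 2)
    (a 0 (o 7) ^+ 2) (form a a) => q0 q1 q2 q3 q4 q5 q6 q7 s.
  move=> h0 h1 h2 h3 h4 h5 h6 h7 hs e p0 p1 p2 p3 p4 p5 p6 p7.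
  have : [/\ q0 = 0, q1 = 0, q2 = 0 & q3 = 0] /\ [/\ q4 = 0, q5 = 0, q6 = 0 & q7 = 0].
    by clear -hs e p0 p1 p2 p3 p4 p5 p6 p7; split; split; lia.
  by case=> [[/h0 ? /h1 ? /h2 ? /h3 ?] [/h4 ? /h5 ? /h6 ? /h7 ?]].
rewrite /y0 /y1 /y2 /y3 /y4 /y5 /y6 => -[[z0 z1 z2 z3] [z4 z5 z6 z7]].
clear e y0 y1 y2 y3 y4 y5 y6 sq0 hle.
have x6 : a 0 (o 6) = 0 by lia.
have x5 : a 0 (o 5) = 0 by lia.
have x4 : a 0 (o 4) = 0 by lia.
have x3 : a 0 (o 3) = 0 by lia.
have x2 : a 0 (o 2) = 0 by lia.
have x1 : a 0 (o 1) = 0 by lia.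
have x0 : a 0 (o 0) = 0 by lia.
by apply/eqP/rowP8 => k hk; rewrite mxE; case: k hk => [|[|[|[|[|[|[|[|k]]]]]]]].
Qed.

Lemma form_ge2 a : a != 0 -> 2 <= form a a.
Proof. by move=> /form_gt0; case: (form_even a) => k ->; lia. Qed.

Lemma form_sq a b : form (a + b) (a + b) = form a a + form a b *+ 2 + form b b.
Proof. by rewrite formDl !formDr (formC b a); ring. Qed.

Lemma form_sqB a b : form (a - b) (a - b) = form a a - form a b *+ 2 + form b b.
Proof. by rewrite form_sq formNr formNl formNr; ring. Qed.

Lemma root_form (a : E8root) : form (val a) (val a) = 2.
Proof. exact: (eqP (valP a)). Qed.

Lemma form_le1 a b : form a a = 2 -> form b b = 2 -> a != b -> form a b <= 1.
Proof.
move=> ha hb; rewrite -subr_eq0 => /form_ge2; rewrite form_sqB ha hb; lia.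
Qed.

Lemma form_geN1 a b : form a a = 2 -> form b b = 2 -> a != - b -> -1 <= form a b.
Proof.
move=> ha hb; rewrite -addr_eq0 => /form_ge2; rewrite form_sq ha hb; lia.
Qed.

(** The exponent of -1 in [Fsign]. *)
Definition Fexp a b : int :=
  \sum_(i < 8) a 0 i * b 0 i
  + \sum_(i < 8) \sum_(j < 8 | (j < i)%N) a 0 i * b 0 j * E8gram i j.

Lemma FexpDl a b c : Fexp (a + b) c = Fexp a c + Fexp b c.
Proof.
rewrite /Fexp addrACA; congr (_ + _); rewrite -big_split; apply: eq_bigr => i _ /=.
  by rewrite mxE mulrDl.
by rewrite -big_split; apply: eq_bigr => j _ /=; rewrite mxE !mulrDl.
Qed.

Lemma FexpDr a b c : Fexp c (a + b) = Fexp c a + Fexp c b.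
Proof.
rewrite /Fexp addrACA; congr (_ + _); rewrite -big_split; apply: eq_bigr => i _ /=.
  by rewrite mxE mulrDr.
by rewrite -big_split; apply: eq_bigr => j _ /=; rewrite mxE mulrDr mulrDl.
Qed.

Lemma FexpNl a c : Fexp (- a) c = - Fexp a c.
Proof.
have h0 : Fexp 0 c = 0 by have := FexpDl 0 0 c; rewrite addr0; lia.
by have := FexpDl a (- a) c; rewrite subrr h0; lia.
Qed.

Lemma FexpNr a c : Fexp c (- a) = - Fexp c a.
Proof.
have h0 : Fexp c 0 = 0 by have := FexpDr 0 0 c; rewrite addr0; lia.
by have := FexpDr a (- a) c; rewrite subrr h0; lia.
Qed.

Lemma FexpE a b : Fexp a b =
  a 0 (o 0) * b 0 (o 0) + a 0 (o 1) * b 0 (o 1) + a 0 (o 2) * b 0 (o 2)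
   + a 0 (o 3) * b 0 (o 3) + a 0 (o 4) * b 0 (o 4) + a 0 (o 5) * b 0 (o 5)
   + a 0 (o 6) * b 0 (o 6) + a 0 (o 7) * b 0 (o 7)
  - (a 0 (o 2) * b 0 (o 0) + a 0 (o 3) * b 0 (o 2) + a 0 (o 3) * b 0 (o 1)
     + a 0 (o 4) * b 0 (o 3) + a 0 (o 5) * b 0 (o 4) + a 0 (o 6) * b 0 (o 5)
     + a 0 (o 7) * b 0 (o 6)).
Proof.
rewrite /Fexp sum8E; congr (_ + _).
under eq_bigr do rewrite big_mkcond.
rewrite sum8E !sum8E !E8gramE // /gram /= !inordK //=.
ring.
Qed.

(** Hence exchanging the arguments of [Fsign] costs the sign (-1)^(a, b). *)
Lemma Fexp_sym a b : Fexp a b + Fexp b a = form a b.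
Proof. by rewrite !FexpE formE; ring. Qed.

Section Sign.
Variable K : fieldType.

Lemma FsignE a b : Fsign K a b = (-1) ^ Fexp a b.
Proof. by []. Qed.

Lemma unitN1 : (-1 : K) \is a GRing.unit.
Proof. by rewrite unitrN1. Qed.

Lemma FsignDl a b c : Fsign K (a + b) c = Fsign K a c * Fsign K b c.
Proof. by rewrite !FsignE FexpDl exprzDr ?unitN1. Qed.

Lemma FsignDr a b c : Fsign K c (a + b) = Fsign K c a * Fsign K c b.
Proof. by rewrite !FsignE FexpDr exprzDr ?unitN1. Qed.

Lemma signz_sqr (z : int) : (-1 : K) ^ z * (-1) ^ z = 1.
Proof. by rewrite -exprzMl ?unitN1 // mulrNN mulr1 exp1rz. Qed.

Lemma signzN (z : int) : (-1 : K) ^ (- z) = (-1) ^ z.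
Proof. by rewrite -exprz_inv invrN1. Qed.

Lemma FsignNl a c : Fsign K (- a) c = Fsign K a c.
Proof. by rewrite !FsignE FexpNl signzN. Qed.

Lemma FsignNr a c : Fsign K c (- a) = Fsign K c a.
Proof. by rewrite !FsignE FexpNr signzN. Qed.

Lemma Fsign_sqr a c : Fsign K a c * Fsign K a c = 1.
Proof. exact: signz_sqr. Qed.

Lemma Fsign_diag a : form a a = 2 -> Fsign K a a = -1.
Proof.
move=> ha; have := Fexp_sym a a; rewrite ha FsignE => e.
by have -> : Fexp a a = 1 by lia.
Qed.

Lemma Fsign_sym a b : Fsign K a b * Fsign K b a = (-1) ^ form a b.
Proof. by rewrite !FsignE -exprzDr ?unitN1 // Fexp_sym. Qed.

Lemma Fsign_neq0 a b : Fsign K a b != 0.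
Proof. by rewrite FsignE expfz_neq0 // oppr_eq0 oner_eq0. Qed.

End Sign.

(** The positive and negative parts of a are vectors p and n with disjoint
    supports, so (p, n) <= 0, and if both were nonzero then (p - n, p - n) >= 4. *)
Lemma root_pos_or_neg a : form a a = 2 ->
  (forall i, 0 <= a 0 i) \/ (forall i, a 0 i <= 0).
Proof.
move=> ha; pose p : 'rV[int]_8 := \row_i Num.max (a 0 i) 0.
pose n : 'rV[int]_8 := \row_i Num.max (- a 0 i) 0.
have e : a = p - n by apply/rowP => i; rewrite !mxE; lia.
have hpn : form p n <= 0.
  rewrite /form; apply: sumr_le0 => i _; apply: sumr_le0 => j _; rewrite !mxE /E8gram.
  case: (eqVneq i j) => [->|_]; first by case: (ltrP (a 0 j) 0) => ?; nia.
  have h1 : 0 <= Num.max (a 0 i) 0 by lia.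
  have h2 : 0 <= Num.max (- a 0 j) 0 by lia.
  by case: ifP => _; rewrite ?mulr0 // intz mulrN1 oppr_le0 mulr_ge0.
case: (eqVneq p 0) => [p0|/form_ge2 hp].
  right => i; have := congr1 (fun v : 'rV_8 => v 0 i) p0; rewrite !mxE; lia.
case: (eqVneq n 0) => [n0|/form_ge2 hn].
  left => i; have := congr1 (fun v : 'rV_8 => v 0 i) n0; rewrite !mxE; lia.
by move: ha; rewrite {1 2}e form_sqB; lia.
Qed.

End RootLattice.

(** * The Lie algebra and its 56-dimensional module *)

Lemma fgliftE (R : nzRingType) (T : choiceType) (M : lmodType R) (f : T -> M)
    (D : {freeg T / R}) :
  fglift f D = \sum_(z <- dom D) coeff z D *: f z.
Proof.
by rewrite -{1}[D]Freeg_dom fglift_Freeg /prelift big_map.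
Qed.

Lemma fglift_sup (R : nzRingType) (T : choiceType) (M : lmodType R) (f : T -> M)
    (D : {freeg T / R}) (s : seq T) :
  uniq s -> {subset dom D <= s} ->
  fglift f D = \sum_(z <- s) coeff z D *: f z.
Proof.
move=> us sub; rewrite fgliftE [RHS](bigID (mem (dom D))) /= [X in _ + X]big1 => [|z].
  rewrite [RHS]addr0 -[RHS]big_filter; apply: perm_big; apply: uniq_perm => [|| z].
  - exact: uniq_dom.
  - exact: filter_uniq.
  - by rewrite mem_filter; case: (boolP (z \in dom D)) => //= /sub ->.
by move=> hz; rewrite coeff_outdom // scale0r.
Qed.

Lemma fgliftP (R : nzRingType) (T : choiceType) (M : lmodType R) (f : T -> M)
    k (D D' : {freeg T / R}) :
  fglift f (k *: D + D') = k *: fglift f D + fglift f D'.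
Proof.
pose s := undup (dom (k *: D + D') ++ (dom D ++ dom D')).
have us : uniq s by exact: undup_uniq.
have sub t : {subset t <= dom (k *: D + D') ++ (dom D ++ dom D')} -> {subset t <= s}.
  by move=> h z /h; rewrite mem_undup.
rewrite (fglift_sup f us (D := _ + _)) ?(fglift_sup f us (D := D))
  ?(fglift_sup f us (D := D')).
- rewrite scaler_sumr -big_split; apply: eq_bigr => z _ /=.
  by rewrite coeffD coeffZ scalerDl scalerA.
- by apply: sub => z; rewrite !mem_cat => ->; rewrite !orbT.
- by apply: sub => z; rewrite !mem_cat => ->; rewrite !orbT.
- by apply: sub => z; rewrite !mem_cat => ->.
Qed.

Lemma sum_shuffle (V : zmodType) (a b c d e f : V) :
  a + b - (c + d) + (e + f) = (a - c + e) + (b - d + f).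
Proof. by rewrite opprD (addrACA a b) (addrACA (a - c)). Qed.

Section Algebra.
Variable K : fieldType.
Implicit Types (h : 'rV[K]_8) (x y z : E8alg K) (r s t : E8root).

Lemma bracketPl k x y z : bracket (k *: x + y) z = k *: bracket x z + bracket y z.
Proof.
rewrite /bracket /= !fgliftP; set A := fglift _ z.2; set B := fglift (bracketHE x.1) _.
set C := fglift (bracketHE y.1) _.
have -> : A = k *: B + C.
  rewrite /A /B /C !fgliftE scaler_sumr -big_split; apply: eq_bigr => b _ /=.
  by rewrite /bracketHE formPl scalerDl scalerDr !scalerA mulrA (mulrC (coeff _ _) k).
by rewrite !scalerDr scalerN sum_shuffle.
Qed.

Lemma bracketPr k x y z : bracket z (k *: x + y) = k *: bracket z x + bracket z y.
Proof.
rewrite /bracket /= fgliftP; set A := fglift (bracketHE (_ + _)) _.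
set B := fglift (bracketHE x.1) _; set C := fglift (bracketHE y.1) _.
have -> : A = k *: B + C.
  rewrite /A /B /C !fgliftE scaler_sumr -big_split; apply: eq_bigr => b _ /=.
  by rewrite /bracketHE formPl scalerDl scalerDr !scalerA mulrA (mulrC (coeff _ _) k).
have -> : fglift (fun r : E8root => fglift (bracketE K r) (k *: x.2 + y.2)) z.2 =
    k *: fglift (fun r : E8root => fglift (bracketE K r) x.2) z.2
    + fglift (fun r : E8root => fglift (bracketE K r) y.2) z.2.
  rewrite !(fgliftE _ z.2) scaler_sumr -big_split; apply: eq_bigr => b _ /=.
  by rewrite fgliftP scalerDr !scalerA mulrC.
by rewrite !scalerDr scalerN sum_shuffle.
Qed.

Lemma bracket0l z : bracket 0 z = 0 :> E8alg K.
Proof. by have := bracketPl (-1) 0 0 z; rewrite scaler0 addr0 scaleN1r addNr. Qed.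

Lemma bracket0r z : bracket z 0 = 0 :> E8alg K.
Proof. by have := bracketPr (-1) 0 0 z; rewrite scaler0 addr0 scaleN1r addNr. Qed.

Lemma fglift0f (f : E8root -> E8alg K) : fglift f 0 = 0.
Proof. by rewrite fgliftE dom0 big_nil. Qed.

Lemma fgliftH0 (D : {freeg E8root / K}) : fglift (bracketHE (0 : 'rV[K]_8)) D = 0.
Proof.
by rewrite fgliftE big1 // => a _; rewrite /bracketHE form0l scale0r scaler0.
Qed.

Lemma fgliftU1 (f : E8root -> E8alg K) r : fglift f << r >> = f r.
Proof. by rewrite liftU scale1r. Qed.

Lemma bracket_HH h h' : bracket (Hel h) (Hel h') = 0.
Proof. by rewrite /bracket /= !fglift0f subrr addr0. Qed.

Lemma bracket_HE h s : bracket (Hel h) (Eel K s) = form h (toH K (val s)) *: Eel K s.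
Proof. by rewrite /bracket /= !fglift0f fgliftU1 subr0 addr0. Qed.

Lemma bracket_EH h s : bracket (Eel K s) (Hel h) = - form h (toH K (val s)) *: Eel K s.
Proof.
rewrite /bracket /= !fgliftU1 !fglift0f sub0r addr0.
by rewrite scaleNr.
Qed.

Lemma bracket_EE r s : bracket (Eel K r) (Eel K s) = bracketE K r s.
Proof. by rewrite /bracket /= !fgliftH0 subrr add0r !fgliftU1. Qed.

Lemma E8alg_decomp x :
  x = Hel x.1 + \sum_(a <- dom x.2) coeff a x.2 *: Eel K a.
Proof.
case: x => h D /=; rewrite /Hel.
have -> : \sum_(a <- dom D) coeff a D *: Eel K a = (0, D).
  rewrite -[in RHS](freeg_sumE D).
  elim: (dom D) => [|a s IH]; first by rewrite !big_nil.
  rewrite !big_cons IH; congr (_, _); rewrite /= ?scaler0 ?addr0 //.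
  by congr (_ + _); apply/eqP/freeg_eqP => b; rewrite coeffZ !coeffU mul1r.
by congr (_, _); rewrite /= ?addr0 ?add0r.
Qed.

Lemma inE7_H h : inH7 h -> inE7 (Hel h).
Proof. by move=> hh; rewrite /inE7 /= hh dom0. Qed.

Lemma inE7_E r : inQ7 r -> inE7 (Eel K r).
Proof. by move=> hr; rewrite /inE7 /= domU1 /= hr /inH7 mxE eqxx. Qed.

Lemma inE7_0 : inE7 (0 : E8alg K).
Proof. by rewrite /inE7 /= dom0 /inH7 mxE eqxx. Qed.

Lemma inE7_P k x y : inE7 x -> inE7 y -> inE7 (k *: x + y).
Proof.
case/andP=> hx /allP hx' /andP[hy /allP hy']; apply/andP; split.
  by rewrite /inH7 !mxE (eqP hx) (eqP hy) mulr0 addr0.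
apply/allP => r /= /domD_subset; rewrite mem_cat => /orP[/domZ_subset/hx' //|/hy' //].
Qed.

Lemma E7_ind (P : E8alg K -> Prop) :
  P 0 -> (forall k x y, inE7 x -> inE7 y -> P x -> P y -> P (k *: x + y)) ->
  (forall h, inH7 h -> P (Hel h)) -> (forall r, inQ7 r -> P (Eel K r)) ->
  forall x, inE7 x -> P x.
Proof.
move=> P0 PP PH PE x /andP[hx /allP ax]; rewrite (E8alg_decomp x) addrC.
suff [_ ? ] : inE7 (\sum_(a <- dom x.2) coeff a x.2 *: Eel K a) /\
   P (\sum_(a <- dom x.2) coeff a x.2 *: Eel K a).
  rewrite -[X in P (X + _)]scale1r; apply: PP => //; rewrite ?inE7_H //; last exact: PH.
  move: ax; elim: (dom x.2) => [|a s IH] ax; first by rewrite big_nil inE7_0.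
  rewrite big_cons; apply: inE7_P; first by apply/inE7_E/ax; rewrite inE eqxx.
  by apply: IH => b hb; apply: ax; rewrite inE hb orbT.
move: ax; elim: (dom x.2) => [|a s IH] ax; first by rewrite big_nil; split=> //; exact: inE7_0.
have [|h1 h2] := IH; first by move=> b hb; apply: ax; rewrite inE hb orbT.
have ha : inQ7 a by apply: ax; rewrite inE eqxx.
rewrite big_cons; split; first by apply: inE7_P => //; apply: inE7_E.
by apply: PP => //; [apply: inE7_E | apply: PE].
Qed.

End Algebra.

Section Rep.
Variables (K : fieldType) (beta : 'I_56 -> E8root).
Hypothesis hbeta : is_basis_enum beta.
Implicit Types (h : 'rV[K]_8) (x y z : E8alg K) (r s t : E8root).

Lemma beta_inj : injective beta. Proof. by case: hbeta. Qed.

Lemma beta_vinj i j : (val (beta i) == val (beta j)) = (i == j).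
Proof. by rewrite (inj_eq val_inj) (inj_eq beta_inj). Qed.

Lemma beta_last i : val (beta i) 0 ord_max = 1.
Proof. by case: hbeta => _ H _; have [] := (H (beta i)).1 (ex_intro _ i erefl). Qed.

Lemma beta_form i : form (val (beta i)) (val (beta i)) = 2.
Proof. exact: root_form. Qed.

Lemma beta_ex a : form a a = 2 -> a 0 ord_max = 1 -> exists i, val (beta i) = a.
Proof.
move=> ha h1; case: hbeta => _ H _.
have ha' : form a a == 2 by apply/eqP.
have [|i hi] := (H (exist _ a ha')).2; last by exists i; rewrite hi.
split=> //=; apply/forallP => i /=.
by case: (root_pos_or_neg ha) => // /(_ ord_max); rewrite h1.
Qed.

Lemma adV_P k x y : adV beta (k *: x + y) = k *: adV beta x + adV beta y.
Proof.
by apply/matrixP => i j; rewrite !mxE bracketPl /= coeffD coeffZ.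
Qed.

Lemma adV_0 : adV beta (0 : E8alg K) = 0.
Proof. by apply/matrixP => i j; rewrite !mxE bracket0l /= coeff0. Qed.

Lemma adV_H h i j :
  adV beta (Hel h) i j = if i == j then form h (toH K (val (beta j))) else 0.
Proof.
rewrite mxE bracket_HE /= coeffZ coeffU mul1r (inj_eq beta_inj) eq_sym.
by case: ifP => _; rewrite ?mulr1 ?mulr0.
Qed.

Lemma adV_E r i j : adV beta (Eel K r) i j =
  if val (beta i) == val r + val (beta j) then Fsign K (val r) (val (beta j)) else 0.
Proof.
rewrite mxE bracket_EE /bracketE; case: (altP eqP) => [e|ne].
  rewrite e subrr /= coeff0; case: eqP => // e'.
  by have := beta_form i; rewrite [val (beta i)]e' form0l.
case: insubP => [c hc ec | hc].
  rewrite /= coeffZ coeffU mul1r -ec -(inj_eq val_inj) eq_sym.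
  by case: ifP => _; rewrite ?mulr1 ?mulr0.
by rewrite /= coeff0; case: eqP => // e; case/negP: hc; rewrite -e beta_form.
Qed.

Lemma form_root_beta r i : inQ7 r ->
  -1 <= form (val r) (val (beta i)) <= 1.
Proof.
move=> /eqP hr; apply/andP; split.
  apply: form_geN1; rewrite ?root_form //; apply/eqP => e.
  by move/(congr1 (fun v : 'rV_8 => v 0 ord_max)): e; rewrite mxE hr beta_last.
apply: form_le1; rewrite ?root_form //; apply/eqP => e.
by move/(congr1 (fun v : 'rV_8 => v 0 ord_max)): e; rewrite hr beta_last.
Qed.

(** At most one intermediate weight, the sum of s and beta j, contributes to the
    product of the two matrices. *)
Lemma adV_EE r s i j : inQ7 r -> inQ7 s ->
  (adV beta (Eel K r) *m adV beta (Eel K s)) i j =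
  if (val (beta i) == val r + val s + val (beta j))
     && (form (val s) (val (beta j)) == -1)
  then Fsign K (val r) (val s) * Fsign K (val r) (val (beta j))
       * Fsign K (val s) (val (beta j)) else 0.
Proof.
move=> hr hs; rewrite mxE; case: (eqVneq (form (val s) (val (beta j))) (-1)) => e.
  have [k hk] : exists k, val (beta k) = val s + val (beta j).
    apply: beta_ex; first by rewrite form_sq !root_form e.
    by rewrite mxE beta_last (eqP hs).
  rewrite (bigD1 k) //= big1 => [|l nl].
    by rewrite addr0 !adV_E hk eqxx andbT addrA FsignDr; case: ifP; rewrite ?mul0r.
  by rewrite !adV_E -hk beta_vinj (negbTE nl) mulr0.
rewrite andbF big1 // => k _; rewrite !adV_E.
case: (eqVneq (val (beta k)) (val s + val (beta j))) => ek; last by rewrite mulr0.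
by have := beta_form k; rewrite ek form_sq !root_form; move: e; lia.
Qed.

(** The product of a weight with a root is -1, 0 or 1, so b, b + a, b + 2a are
    never three weights. *)
Lemma adV_E_sq r : inQ7 r -> adV beta (Eel K r) *m adV beta (Eel K r) = 0.
Proof.
move=> hr; apply/matrixP => i j; rewrite adV_EE // mxE; case: ifP => // /andP[/eqP e /eqP f].
have := beta_form i; rewrite e form_sq form_sq formDl !root_form f.
by have := form_root_beta j hr; lia.
Qed.

Lemma form_pair_sum r s i j : inQ7 r -> inQ7 s ->
  val (beta i) = val r + val s + val (beta j) ->
  form (val r) (val s) + form (val r) (val (beta j)) + form (val s) (val (beta j)) = -2.
Proof.
move=> hr hs e; have := beta_form i.
by rewrite e form_sq form_sq formDl !root_form; lia.
Qed.

(** Entry by entry, for s other than - r: when the weights i and j differ by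
    r + s, exactly one of the two orders of r and s passes through a weight if
    (r, s) = -1, and otherwise (r, s) = 0, both orders do, and they cancel. *)
Lemma adV_bracket_EE r s : inQ7 r -> inQ7 s ->
  adV beta (bracket (Eel K r) (Eel K s)) =
  adV beta (Eel K r) *m adV beta (Eel K s) - adV beta (Eel K s) *m adV beta (Eel K r).
Proof.
move=> hr hs; apply/matrixP => i j; rewrite bracket_EE.
rewrite [RHS]mxE [X in _ + X]mxE !adV_EE // [val s + val r]addrC /bracketE.
have hp := form_root_beta j hr; have hq := form_root_beta j hs.
have F2 (u v : 'rV[int]_8) : Fsign K u v = Fsign K v u * (-1) ^ form u v.
  by rewrite -Fsign_sym mulrCA Fsign_sqr mulr1.
case: (altP (val s =P _)) => [e|ne].
  rewrite adV_H e subrr add0r beta_vinj; case: eqP => [_|]; last by rewrite subrr.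
  rewrite !FsignNl !FsignNr Fsign_diag ?root_form // -!mulrA !Fsign_sqr mulr1.
  rewrite formNl form_toH !formNl.
  have : form (val r) (val (beta j)) \in [:: -1; 0; 1] by rewrite !inE; lia.
  rewrite !inE => /or3P[] /eqP -> /=.
  - by rewrite sub0r rmorphN rmorph1.
  - by rewrite subrr mulr0z oppr0.
  - by rewrite subr0 rmorph1.
case: insubP => [c hc ec | hc].
  rewrite -[_ *: _]addr0 adV_P adV_0 addr0 mxE adV_E ec.
  case: eqP => [e|]; last by rewrite mulr0 subrr.
  have := form_pair_sum hr hs e.
  have := root_form c; rewrite ec form_sq !root_form => f2 f3.
  rewrite FsignDl (F2 (val s) (val r)) (formC (val s) (val r)).
  have -> : form (val r) (val s) = -1 by lia.
  rewrite /= (_ : (-1 : K) ^ (-1)%Z = -1); last by rewrite exprN1 invrN1.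
  case: (eqVneq (form (val s) (val (beta j))) (-1)) => [q1|q1].
    have -> : (form (val r) (val (beta j)) == -1) = false by lia.
    by rewrite subr0 mulrA.
  have -> : (form (val r) (val (beta j)) == -1) = true by lia.
  by ring.
rewrite adV_0 mxE; case: eqP => [e|]; last by rewrite subrr.
have f3 := form_pair_sum hr hs e.
have f1 : -1 <= form (val r) (val s).
  apply: form_geN1; rewrite ?root_form //; apply/eqP => e'.
  by case/eqP: ne; rewrite e' opprK.
have f2 : form (val r) (val s) <> -1.
  by move=> f2; case/negP: hc; rewrite form_sq !root_form f2.
have -> : (form (val r) (val (beta j)) == -1) = true by lia.
have -> : (form (val s) (val (beta j)) == -1) = true by lia.
rewrite /= (F2 (val s) (val r)) (formC (val s) (val r)).
have -> : form (val r) (val s) = 0 by lia.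
by rewrite expr0z; ring.
Qed.

Lemma adV_Hdiag h :
  adV beta (Hel h) = diag_mx (\row_i form h (toH K (val (beta i)))).
Proof.
apply/matrixP => i j; rewrite adV_H [RHS]mxE mxE.
by case: eqP => [->|]; rewrite ?mulr1n ?mulr0n.
Qed.

Lemma adV_bracket_HE h s :
  adV beta (bracket (Hel h) (Eel K s)) =
  adV beta (Hel h) *m adV beta (Eel K s) - adV beta (Eel K s) *m adV beta (Hel h).
Proof.
rewrite bracket_HE -[_ *: _]addr0 adV_P adV_0 addr0 adV_Hdiag mul_diag_mx mul_mx_diag.
move: (adV beta (Eel K s)) (adV_E s) => A hA.
apply/matrixP => i j; rewrite !mxE hA.
case: eqP => [e|]; last by rewrite !(mulr0, mul0r) subrr.
by rewrite e toHD formDr; ring.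
Qed.

Lemma adV_bracket x y : inE7 x -> inE7 y ->
  adV beta (bracket x y) = adV beta x *m adV beta y - adV beta y *m adV beta x.
Proof.
move=> hx hy; move: x hx; apply: E7_ind.
- by rewrite bracket0l adV_0 mul0mx mulmx0 subrr.
- move=> k x x' _ _ IH IH'; rewrite bracketPl !adV_P IH IH' mulmxDl mulmxDr.
  by rewrite -!scalemxAl -!scalemxAr scalerBr opprD addrACA.
- move=> h hh; move: y hy; apply: E7_ind.
  + by rewrite bracket0r adV_0 mul0mx mulmx0 subrr.
  + move=> k x x' _ _ IH IH'; rewrite bracketPr !adV_P IH IH' mulmxDl mulmxDr.
    by rewrite -!scalemxAl -!scalemxAr scalerBr opprD addrACA.
  + move=> h' _; rewrite bracket_HH adV_0 !adV_Hdiag !mulmx_diag.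
    by apply/matrixP => i j; rewrite !mxE mulrC subrr.
  + by move=> s _; exact: adV_bracket_HE.
- move=> r hr; move: y hy; apply: E7_ind.
  + by rewrite bracket0r adV_0 mul0mx mulmx0 subrr.
  + move=> k x x' _ _ IH IH'; rewrite bracketPr !adV_P IH IH' mulmxDl mulmxDr.
    by rewrite -!scalemxAl -!scalemxAr scalerBr opprD addrACA.
  + move=> h _; rewrite bracket_EH scaleNr -bracket_HE -scaleN1r.
    by rewrite -[_ *: _]addr0 adV_P adV_0 addr0 adV_bracket_HE scaleN1r opprB.
  + by move=> s hs; exact: adV_bracket_EE.
Qed.

End Rep.

(** * Polynomials and derivations *)

Section PolyGen.
Variables (K : fieldType) (n : nat).
Implicit Types f g : {mpoly K[n]}.

Lemma mpoly_alg_ind (P : {mpoly K[n]} -> Prop) :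
  P 1 -> (forall k f g, P f -> P g -> P (k *: f + g)) ->
  (forall f g, P f -> P g -> P (f * g)) -> (forall i, P 'X_i) ->
  forall f, P f.
Proof.
move=> P1 PP PM PX.
have P0 : P 0 by rewrite -[0](subrr (1 : {mpoly K[n]})) addrC -scaleN1r; apply: PP.
elim/mpolyind => // c m p _ _ IH; apply: PP => //.
rewrite mpolyXE_id; apply: big_ind => // i _.
by elim: (m i) => [|k IHk]; rewrite ?expr0 // exprS; apply: PM.
Qed.

Definition derivation (D : {mpoly K[n]} -> {mpoly K[n]}) :=
  (forall k f g, D (k *: f + g) = k *: D f + D g) /\
  (forall f g, D (f * g) = D f * g + f * D g).

Lemma derivation1 D : derivation D -> D 1 = 0.
Proof.
case=> _ DM; have := DM 1 1; rewrite !mulr1 mul1r => /eqP.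
by rewrite -[X in X == _]addr0 (inj_eq (addrI _)) => /eqP.
Qed.

Lemma derivation_ext D1 D2 : derivation D1 -> derivation D2 ->
  (forall i, D1 'X_i = D2 'X_i) -> D1 =1 D2.
Proof.
move=> d1 d2 h; apply: mpoly_alg_ind => //.
- by rewrite !derivation1.
- by case: d1 d2 => [p1 _] [p2 _] k f g ef eg; rewrite p1 p2 ef eg.
- by case: d1 d2 => [_ m1] [_ m2] f g ef eg; rewrite m1 m2 ef eg.
Qed.

Lemma derivation0 D : derivation D -> D 0 = 0.
Proof. by case=> DP _; have := DP (-1) 0 0; rewrite scaler0 addr0 scaleN1r addNr. Qed.

Lemma derivationZ D k f : derivation D -> D (k *: f) = k *: D f.
Proof. by move=> d; rewrite -[_ *: f]addr0 d.1 derivation0 // addr0. Qed.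

Lemma derivationD D f g : derivation D -> D (f + g) = D f + D g.
Proof. by move=> d; rewrite -[f]scale1r d.1 !scale1r. Qed.

Lemma derivation_sum D (I : Type) (s : seq I) (P : pred I) (F : I -> {mpoly K[n]}) :
  derivation D -> D (\sum_(i <- s | P i) F i) = \sum_(i <- s | P i) D (F i).
Proof.
by move=> d; apply: (big_morph D) => [f g|]; rewrite ?derivationD ?derivation0.
Qed.

Lemma commutator_leibniz (R : comNzRingType) (p q Mp Mq Np Nq MNp MNq NMp NMq : R) :
  MNp * q + Np * Mq + (Mp * Nq + p * MNq) - (NMp * q + Mp * Nq + (Np * Mq + p * NMq))
  = (MNp - NMp) * q + p * (MNq - NMq).
Proof. ring. Qed.

(** [actA] is the special case of the matrices [adV]. *)
Definition linfield (M : 'M[K]_n) f : {mpoly K[n]} :=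
  \sum_(i < n) \sum_(j < n) M i j *: ('X_i * mderiv j f).

Lemma linfield_deriv M : derivation (linfield M).
Proof.
split=> [k f g|f g]; rewrite /linfield.
  rewrite scaler_sumr -big_split; apply: eq_bigr => i _ /=.
  rewrite scaler_sumr -big_split; apply: eq_bigr => j _ /=.
  by rewrite mderivD mderivZ mulrDr scalerDr -scalerAr !scalerA mulrC.
rewrite mulr_suml mulr_sumr -big_split; apply: eq_bigr => i _ /=.
rewrite mulr_suml mulr_sumr -big_split; apply: eq_bigr => j _ /=.
rewrite mderivM mulrDr scalerDr; congr (_ + _).
  by rewrite -scalerAl mulrA.
by rewrite -scalerAr mulrCA.
Qed.

Lemma mderivXU i j : mderiv i ('X_j : {mpoly K[n]}) = (i == j)%:R.
Proof.
rewrite mderivX mnm1E eq_sym; case: eqP => [->|_]; last by rewrite scale0r.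
rewrite scale1r (_ : (_ - _)%MM = 0%MM) ?mpolyX0 //.
by apply/mnmP => k; rewrite mnmBE mnm0E subnn.
Qed.

Lemma linfield_X M j : linfield M 'X_j = \sum_i M i j *: 'X_i.
Proof.
rewrite /linfield; apply: eq_bigr => i _; rewrite (bigD1 j) //= big1 => [|k nk].
  by rewrite addr0 mderivXU eqxx mulr1.
by rewrite mderivXU (negbTE nk) mulr0 scaler0.
Qed.

Lemma linfield_P k M N f : linfield (k *: M + N) f = k *: linfield M f + linfield N f.
Proof.
rewrite /linfield scaler_sumr -big_split; apply: eq_bigr => i _ /=.
rewrite scaler_sumr -big_split; apply: eq_bigr => j _ /=.
by rewrite !mxE scalerDl scalerA.
Qed.

(** Both sides are derivations, so the variables suffice. *)
Lemma linfield_comm M N f :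
  linfield (M *m N - N *m M) f = linfield M (linfield N f) - linfield N (linfield M f).
Proof.
have dM := linfield_deriv M; have dN := linfield_deriv N.
have key : derivation (fun f => linfield M (linfield N f) - linfield N (linfield M f)).
  split=> [k p q|p q].
    by rewrite dN.1 dM.1 (dM.1 k) dN.1 scalerBr opprD addrACA.
  rewrite (dN.2 p q) (dM.2 p q) !(derivationD _ _ dM) !(derivationD _ _ dN).
  rewrite (dM.2 (linfield N p)) (dM.2 p) (dN.2 (linfield M p)) (dN.2 p).
  exact: commutator_leibniz.
apply: (derivation_ext (linfield_deriv _) key) => {f} j.
rewrite !linfield_X (derivation_sum _ _ _ dM) (derivation_sum _ _ _ dN).
under [X in _ = X - _]eq_bigr do rewrite (derivationZ _ _ dM) linfield_X scaler_sumr.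
under [X in _ = _ - X]eq_bigr do rewrite (derivationZ _ _ dN) linfield_X scaler_sumr.
rewrite exchange_big [X in _ - X]exchange_big -sumrB; apply: eq_bigr => i _ /=.
rewrite !mxE scalerBl !scaler_suml; congr (_ - _).
  by apply: eq_bigr => k _; rewrite scalerA mulrC.
by apply: eq_bigr => k _; rewrite scalerA mulrC.
Qed.

(** The restriction of f to the line p + t q, as a polynomial in t. *)
Definition along (p q : 'I_n -> K) f : {poly K} :=
  mmap polyC (fun j => (p j)%:P + q j *: 'X) f.

Lemma alongZ p q k f : along p q (k *: f) = k%:P * along p q f.
Proof. exact: mmapZ. Qed.
Lemma alongD p q f g : along p q (f + g) = along p q f + along p q g.
Proof. exact: mmapD. Qed.
Lemma alongM p q f g : along p q (f * g) = along p q f * along p q g.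
Proof. exact: rmorphM. Qed.
Lemma along1 p q : along p q 1 = 1.
Proof. exact: rmorph1. Qed.
Lemma alongX p q i : along p q 'X_i = (p i)%:P + q i *: 'X.
Proof. by rewrite /along mmapX mmap1U. Qed.

Lemma along_sum p q (I : Type) (s : seq I) (P : pred I) (F : I -> {mpoly K[n]}) :
  along p q (\sum_(i <- s | P i) F i) = \sum_(i <- s | P i) along p q (F i).
Proof. exact: raddf_sum. Qed.

Lemma horner_along p q f t : (along p q f).[t] = f.@[fun j => p j + t * q j].
Proof.
elim/mpoly_alg_ind: f => [|k f g IHf IHg|f g IHf IHg|i].
- by rewrite along1 meval1 hornerC.
- by rewrite alongD alongZ !hornerE IHf IHg mevalD mevalZ.
- by rewrite alongM hornerM IHf IHg mevalM.
- by rewrite alongX mevalXU !hornerE mulrC.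
Qed.

Lemma deriv_along p q f :
  (along p q f)^`() = \sum_j (q j)%:P * along p q (mderiv j f).
Proof.
elim/mpoly_alg_ind: f => [|k f g IHf IHg|f g IHf IHg|i].
- by rewrite along1 derivC big1 // => j _; rewrite -mpolyC1 mderivC /along raddf0 mulr0.
- rewrite alongD alongZ derivD derivM derivC mul0r add0r IHf IHg mulr_sumr -big_split.
  apply: eq_bigr => j _ /=; rewrite mderivD mderivZ alongD alongZ mulrDr; congr (_ + _).
  by rewrite mulrCA.
- rewrite alongM derivM IHf IHg mulr_suml mulr_sumr -big_split.
  apply: eq_bigr => j _ /=; rewrite mderivM alongD !alongM mulrDr; congr (_ + _).
    by rewrite mulrA.
  by rewrite mulrCA.
- rewrite alongX derivD derivC derivZ derivX add0r (bigD1 i) //= big1 => [|j nj].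
    by rewrite mderivXU eqxx along1 mulr1 addr0 alg_polyC.
  by rewrite mderivXU (negbTE nj) /along raddf0 mulr0.
Qed.

End PolyGen.

Section PolyChar0.
Variables (K : numFieldType) (n : nat).
Implicit Types f g : {mpoly K[n]}.

Lemma deriv_eq0 (h : {poly K}) : h^`() = 0 -> forall t, h.[t] = h.[0].
Proof.
move=> dh t; have : (size h <= 1)%N.
  apply/leq_sizeP => -[//|i] _; have := congr1 (fun p : {poly K} => p`_i) dh.
  by rewrite coef_deriv coef0 => /eqP; rewrite mulrn_eq0 => /eqP.
by move/size1_polyC=> ->; rewrite !hornerC.
Qed.

(** Since the matrix squares to zero its flow is the affine map p + t pM, and
    a polynomial annihilated by a vector field is constant along its flow. *)
Lemma linfield_flow (M : 'M[K]_n) f : M *m M = 0 -> linfield M f = 0 ->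
  forall (p : 'I_n -> K) t, f.@[fun j => p j + t * \sum_i M i j * p i] = f.@[p].
Proof.
move=> M2 Mf p t; pose q j := \sum_i M i j * p i.
have Mq j : \sum_i M i j * q i = 0.
  rewrite /q; under eq_bigr do rewrite mulr_sumr.
  rewrite exchange_big big1 // => k _ /=.
  have := congr1 (fun A : 'M[K]_n => A k j) M2; rewrite !mxE => e.
  transitivity ((\sum_l M k l * M l j) * p k); last by rewrite e mul0r.
  by rewrite mulr_suml; apply: eq_bigr => i _; ring.
have d0 : (along p q f)^`() = 0.
  rewrite deriv_along; transitivity (along p q (linfield M f)); last first.
    by rewrite Mf /along raddf0.
  rewrite /linfield exchange_big [RHS]along_sum; apply: eq_bigr => j _ /=.
  rewrite [RHS]along_sum.
  under [RHS]eq_bigr do rewrite alongZ alongM alongX mulrA.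
  rewrite -mulr_suml; congr (_ * _).
  have -> : (q j)%:P = (q j)%:P + (\sum_i M i j * q i) *: 'X by rewrite Mq scale0r addr0.
  rewrite /q rmorph_sum scaler_suml -big_split; apply: eq_bigr => i _ /=.
  by rewrite mulrDr -polyCM -scalerAr mul_polyC scalerA [X in X *: 'X]mulrC.
have := deriv_eq0 d0 t; rewrite !horner_along => ->.
by apply: meval_eq => j; rewrite mul0r addr0.
Qed.

Lemma poly_vanish (h : {poly K}) : (forall t, h.[t] = 0) -> h = 0.
Proof.
move=> h0; apply/eqP/negPn/negP => hn.
pose rs : seq K := [seq i%:R | i <- iota 0 (size h)].
have rs_root : all (root h) rs by apply/allP => x _; rewrite /root h0.
have rs_uniq : uniq rs.
  by rewrite map_inj_uniq ?iota_uniq // => i j /eqP; rewrite eqr_nat => /eqP.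
by have := max_poly_roots hn rs_root rs_uniq; rewrite size_map size_iota ltnn.
Qed.

(** All derivatives of f vanish as functions too, and the coefficients are read
    off from their values at 0. *)
Lemma mpoly_vanish f : (forall v, f.@[v] = 0) -> f = 0.
Proof.
move=> f0; have der m : forall v, (mderivm m f).@[v] = 0.
  have step g j : (forall v, g.@[v] = 0) -> forall v, (mderiv j g).@[v] = 0.
    move=> g0 v; pose q k : K := (k == j)%:R.
    have e0 : along v q g = 0 by apply: poly_vanish => t; rewrite horner_along.
    have := congr1 (fun h => h.[0]) (deriv_along v q g); rewrite e0 linear0 hornerC.
    rewrite horner_sum (bigD1 j) //= big1 => [|k nk].
      rewrite addr0 !hornerE horner_along /q eqxx mul1r => ->.
      by apply: meval_eq => k; rewrite mul0r addr0.
    by rewrite /q (negbTE nk) mul0r horner0.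
  rewrite mderivm_foldr; elim: (flatten _) => //= j s IH.
  exact: step.
apply/mpolyP => m; rewrite mcoeff0.
have := der m (fun=> 0); rewrite -[_.@[_]](_ : (mderivm m f)@_0%MM = _); last first.
  rewrite {2}[mderivm m f]mpolyE raddf_sum /=.
  case: (boolP (0%MM \in msupp (mderivm m f))) => h0.
    rewrite (bigD1_seq 0%MM) ?msupp_uniq //= big1 => [|k nk].
      by rewrite mevalZ mpolyX0 meval1 mulr1 addr0.
    rewrite mevalZ mevalX; case: (boolP [exists i, k i != 0%N]).
      case/existsP => i ki; rewrite (bigD1 i) //= expr0n (negbTE ki) mul0r mulr0 //.
    rewrite negb_exists => /forallP kk; case/eqP: nk.
    by apply/mnmP => i; rewrite mnm0E; apply/eqP; have := kk i; rewrite negbK.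
  rewrite (memN_msupp_eq0 h0) big_seq big1 // => k hk.
  rewrite mevalZ mevalX; case: (boolP [exists i, k i != 0%N]).
    by case/existsP => i ki; rewrite (bigD1 i) //= expr0n (negbTE ki) mul0r mulr0.
  rewrite negb_exists => /forallP kk; case/negP: h0.
  have -> // : 0%MM = k.
  by apply/mnmP => i; rewrite mnm0E; apply/esym/eqP; have := kk i; rewrite negbK.
rewrite mcoeff_mderivm addm0 => /eqP; rewrite mulrn_eq0 => /orP[|/eqP //].
rewrite -leqn0 leqNgt => /negP[]; rewrite prodn_gt0 // => i.
by rewrite ffact_gt0.
Qed.

Lemma mpoly_vanish_open (d f : {mpoly K[n]}) : d != 0 ->
  (forall v, d.@[v] != 0 -> f.@[v] = 0) -> f = 0.
Proof.
move=> dn h; have /mpoly_vanish/eqP : forall v, (d * f).@[v] = 0.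
  move=> v; rewrite mevalM; case: (eqVneq (d.@[v]) 0) => [->|/h ->].
    by rewrite mul0r.
  by rewrite mulr0.
by rewrite mulf_eq0 (negbTE dn) => /eqP.
Qed.

End PolyChar0.

(** * The invariant Hermitian form *)

Section Hermitian.
Variables (K : numClosedFieldType) (n : nat).
Implicit Types f g : {mpoly K[n]}.

Definition mfact (m : 'X_{1..n}) : nat := \prod_(i < n) (m i)`!.

Lemma mfact_gt0 m : (0 < mfact m)%N.
Proof. by rewrite prodn_gt0 // => i; exact: fact_gt0. Qed.

Lemma mfactU m i : mfact (U_(i) + m) = ((m i).+1 * mfact m)%N.
Proof.
rewrite /mfact (bigD1 i) //= [in RHS](bigD1 i) //= mnmDE mnm1E eqxx add1n factS.
rewrite mulnA; congr (_ * _)%N; apply: eq_bigr => j nj.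
by rewrite mnmDE mnm1E eq_sym (negbTE nj).
Qed.

(** With these norms, multiplication by a variable is adjoint to the derivation
    along it. *)
Definition herm f g : K :=
  \sum_(m <- msupp f) (mfact m)%:R * f@_m * (g@_m)^*.

Lemma herm_sup (s : seq 'X_{1..n}) f g : uniq s -> {subset msupp f <= s} ->
  herm f g = \sum_(m <- s) (mfact m)%:R * f@_m * (g@_m)^*.
Proof.
move=> us sub; rewrite /herm [RHS](bigID (mem (msupp f))) /= [X in _ + X]big1 => [|z].
  rewrite [RHS]addr0 -[RHS]big_filter; apply: perm_big; apply: uniq_perm => [|| z].
  - exact: msupp_uniq.
  - exact: filter_uniq.
  - by rewrite mem_filter; case: (boolP (z \in msupp f)) => //= /sub ->.
by move=> hz; rewrite (memN_msupp_eq0 hz) mulr0 mul0r.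
Qed.

Lemma hermC f g : herm g f = (herm f g)^*.
Proof.
pose s := undup (msupp f ++ msupp g); have us : uniq s by exact: undup_uniq.
rewrite (herm_sup _ us) => [|m hm]; last by rewrite mem_undup mem_cat hm orbT.
rewrite (herm_sup _ us) => [|m hm]; last by rewrite mem_undup mem_cat hm.
rewrite rmorph_sum /=; apply: eq_bigr => m _; rewrite !rmorphM /= conjCK conjC_nat.
by rewrite -mulrA (mulrC (g@_m)) mulrA.
Qed.

Lemma hermPl k f f' g : herm (k *: f + f') g = k * herm f g + herm f' g.
Proof.
pose s := undup (msupp (k *: f + f') ++ (msupp f ++ msupp f')).
have us : uniq s by exact: undup_uniq.
have sub t : {subset t <= msupp (k *: f + f') ++ (msupp f ++ msupp f')} -> {subset t <= s}.
  by move=> h z /h; rewrite mem_undup.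
rewrite (herm_sup g us (f := _ + _)) ?(herm_sup g us (f := f)) ?(herm_sup g us (f := f')).
- rewrite mulr_sumr -big_split; apply: eq_bigr => z _ /=.
  by rewrite mcoeffD mcoeffZ mulrDr mulrDl; congr (_ + _); rewrite mulrCA !mulrA.
- by apply: sub => z; rewrite !mem_cat => ->; rewrite !orbT.
- by apply: sub => z; rewrite !mem_cat => ->; rewrite !orbT.
- by apply: sub => z; rewrite !mem_cat => ->.
Qed.

Lemma herm0l g : herm 0 g = 0.
Proof. by have := hermPl (-1) 0 0 g; rewrite scaler0 addr0 mulN1r addNr. Qed.

Lemma hermZl k f g : herm (k *: f) g = k * herm f g.
Proof. by rewrite -[_ *: f]addr0 hermPl herm0l addr0. Qed.

Lemma hermDl f f' g : herm (f + f') g = herm f g + herm f' g.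
Proof. by rewrite -[f]scale1r hermPl mul1r scale1r. Qed.

Lemma hermZr k f g : herm f (k *: g) = k^* * herm f g.
Proof. by rewrite hermC hermZl rmorphM /= -hermC. Qed.

Lemma hermDr f f' g : herm g (f + f') = herm g f + herm g f'.
Proof. by rewrite hermC hermDl rmorphD /= -!hermC. Qed.

Lemma herm0r g : herm g 0 = 0.
Proof. by rewrite hermC herm0l conjC0. Qed.

Lemma herm_suml (I : Type) (s : seq I) (P : pred I) (F : I -> {mpoly K[n]}) g :
  herm (\sum_(i <- s | P i) F i) g = \sum_(i <- s | P i) herm (F i) g.
Proof. by apply: (big_morph (herm ^~ g)) => [p q|]; rewrite ?hermDl ?herm0l. Qed.

Lemma herm_sumr (I : Type) (s : seq I) (P : pred I) (F : I -> {mpoly K[n]}) g :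
  herm g (\sum_(i <- s | P i) F i) = \sum_(i <- s | P i) herm g (F i).
Proof. by apply: (big_morph (herm g)) => [p q|]; rewrite ?hermDr ?herm0r. Qed.

Lemma herm_eq0 f : herm f f = 0 -> f = 0.
Proof.
move/eqP; rewrite psumr_eq0 => [/allP h|m _]; last first.
  by rewrite -mulrA mulr_ge0 ?ler0n ?mul_conjC_ge0.
apply: msuppnil0; case E: (msupp f) => [//|m s].
have hm : m \in msupp f by rewrite E inE eqxx.
have := h m hm; rewrite /= -mulrA mulf_eq0 pnatr_eq0 mul_conjC_eq0.
by rewrite -leqn0 leqNgt mfact_gt0 /= mcoeff_eq0 hm.
Qed.

Lemma hermX m g : herm 'X_[m] g = (mfact m)%:R * (g@_m)^*.
Proof. by rewrite /herm msuppX big_seq1 mcoeffX eqxx mulr1. Qed.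

Lemma herm_mulX i f g : herm ('X_i * f) g = herm f (mderiv i g).
Proof.
rewrite [f]mpolyE mulr_sumr !herm_suml; apply: eq_bigr => m _.
rewrite -scalerAr !hermZl -mpolyXD !hermX; congr (_ * _).
rewrite mcoeff_deriv mfactU addmC natrM rmorphMn /=.
by rewrite -[_^* *+ _]mulr_natl mulrCA mulrA.
Qed.

Lemma herm_mderiv i f g : herm (mderiv i f) g = herm f ('X_i * g).
Proof. by rewrite hermC -herm_mulX -hermC. Qed.

Lemma herm_linfield (M : 'M[K]_n) f g :
  herm (linfield M f) g = herm f (linfield (map_mx Num.conj M)^T g).
Proof.
rewrite /linfield [in RHS]exchange_big herm_suml herm_sumr; apply: eq_bigr => i _.
rewrite herm_suml herm_sumr; apply: eq_bigr => j _.
by rewrite hermZl hermZr !mxE conjCK herm_mulX herm_mderiv.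
Qed.

Lemma herm_mderivm m f g : herm (mderivm m f) g = herm f ('X_[m] * g).
Proof.
have [k] := ubnP (mdeg m); elim: k m f => // k IH m f hm.
case: (eqVneq m 0%MM) => [->|nm]; first by rewrite mderivm0m mpolyX0 mul1r.
have [i mi] : exists i, m i != 0%N.
  apply/existsP; apply: contraNT nm; rewrite negb_exists => /forallP h.
  by apply/eqP/mnmP => i; rewrite mnm0E; apply/eqP; have := h i; rewrite negbK.
have e : m = (U_(i) + (m - U_(i)))%MM.
  by rewrite addmC submK // lep1mP.
rewrite e mderivmDm mderivmU1m IH ?herm_mderiv ?mpolyXD ?mulrA //.
by move: hm; rewrite {1}e mdegD mdeg1.
Qed.

Lemma herm_diff_op p f g : (forall m, (p@_m)^* = p@_m) ->
  herm (diff_op p f) g = herm f (p * g).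
Proof.
move=> hp; rewrite /diff_op herm_suml [p in RHS]mpolyE mulr_suml herm_sumr.
by apply: eq_bigr => m _; rewrite hermZl herm_mderivm -scalerAl hermZr hp.
Qed.

Lemma herm_homog d e f g : f \is d.-homog -> g \is e.-homog -> d != e ->
  herm f g = 0.
Proof.
move=> hf hg de; rewrite /herm big_seq big1 // => m hm.
by rewrite (dhomog_nemf_coeff hg) ?conjC0 ?mulr0 // (dhomog_mf hf hm).
Qed.

End Hermitian.

(** * Coordinates for computation *)

(** Lattice vectors are lists of 8 integers, weights of the module are numbered
    by their position in [wl], and polynomials are lists of terms, so that the
    properties of the generators can be decided by evaluation. *)
Definition vec := seq int.
Definition rowv (u : vec) : 'rV[int]_8 := \row_i u`_i.
Definition vadd (u v : vec) : vec := mkseq (fun i => u`_i + v`_i) 8.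
Definition vsub (u v : vec) : vec := mkseq (fun i => u`_i - v`_i) 8.
Definition vdot (u v : vec) : int :=
  foldr (fun i s => u`_i * v`_i + s) 0 (iota 0 8).
(** 0-based, with the larger end first, as the sum in [Fsign] requires. *)
Definition edges : seq (nat * nat) :=
  [:: (2, 0); (3, 2); (3, 1); (4, 3); (5, 4); (6, 5); (7, 6)]%N.
Definition vform (u v : vec) : int :=
  vdot u v *+ 2
  - foldr (fun e s => u`_e.1 * v`_e.2 + u`_e.2 * v`_e.1 + s) 0 edges.
Definition veps (u v : vec) : int :=
  if odd (absz (vdot u v - foldr (fun e s => u`_e.1 * v`_e.2 + s) 0 edges)%R)
  then -1 else 1.

Lemma rowvE u k : (k < 8)%N -> rowv u 0 (o k) = u`_k.
Proof. by move=> hk; rewrite mxE inordK. Qed.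

Lemma vformE u v : form (rowv u) (rowv v) = vform u v.
Proof. by rewrite formE !rowvE // /vform /vdot /=; ring. Qed.

Lemma vepsE (K : fieldType) u v : Fsign K (rowv u) (rowv v) = (veps u v)%:~R.
Proof.
rewrite FsignE FexpE !rowvE // /veps; set z := (X in absz X).
transitivity ((-1 : K) ^ z); first by congr (_ ^ _); rewrite /z /vdot /=; ring.
have sg (n : nat) : (-1 : K) ^+ n = (if odd n then -1 else 1 : int)%:~R.
  by rewrite -signr_odd; case: (odd n); rewrite ?expr1 ?rmorphN ?expr0 rmorph1.
by case: z => n; [exact: sg | rewrite NegzE signzN abszN; exact: sg].
Qed.

Lemma rowvD u v : rowv (vadd u v) = rowv u + rowv v.
Proof. by apply: rowP8 => k hk; rewrite !mxE !inordK // nth_mkseq. Qed.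

Lemma rowv_inj u v : size u = 8%N -> size v = 8%N -> rowv u = rowv v -> u = v.
Proof.
move=> su sv e; apply: (eq_from_nth (x0 := 0)); first by rewrite su sv.
by move=> i; rewrite su => hi; rewrite -(rowvE u hi) e rowvE.
Qed.

Definition simple (i : nat) : vec := mkseq (fun j => (j == i)%:R) 8.
(** The highest weight of the module. *)
Definition topv : vec := [:: 2; 3; 4; 6; 5; 4; 3; 1].

Lemma rowv_simple i : rowv (simple i) = \row_j (j == i :> nat)%:R.
Proof. by apply/rowP => j; rewrite !mxE nth_mkseq. Qed.

Lemma rowv_simple_delta (i : 'I_8) : rowv (simple i) = delta_mx 0 i.
Proof. by apply/rowP => j; rewrite rowv_simple !mxE eqxx. Qed.

(** One step down from the weights in s: subtracting the simple root i from b
    gives a weight when their product is 1. *)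
Definition wstep (s : seq vec) : seq vec :=
  undup (s ++ [seq vsub p.1 (simple p.2) | p <- [seq (b, i) | b <- s, i <- iota 0 7]
                 & vform p.1 (simple p.2) == 1]).
(** The heights of the weights run from 28 down to 1, hence the 27 steps. *)
Definition wl : seq vec := Eval vm_compute in iter 27 wstep [:: topv].
Definition w (k : nat) : vec := nth [::] wl k.

Lemma wl_ok : [&& size wl == 56%N, uniq wl, w 0 == topv &
   all (fun u : vec => [&& size u == 8%N, vform u u == 2 & u`_7 == 1]) wl].
Proof. by vm_compute. Qed.

Lemma wl_size : size wl = 56%N. Proof. by []. Qed.
Lemma wl_uniq : uniq wl. Proof. by case/and4P: wl_ok. Qed.
Lemma w_ok k : (k < 56)%N -> [/\ size (w k) = 8%N, vform (w k) (w k) = 2 & (w k)`_7 = 1].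
Proof.
move=> hk; case/and4P: wl_ok => _ _ _ /allP /(_ (w k)).
by case/(_ (mem_nth _ _))/and3P => // /eqP -> /eqP -> /eqP ->.
Qed.

(** A monomial is the list of its variables, with repetitions. *)
Definition mono := seq nat.
Definition pol := seq (int * mono).

Fixpoint mcmp (m n : mono) : comparison :=
  match m, n with
  | [::], [::] => Eq | [::], _ => Lt | _, [::] => Gt
  | a :: m', b :: n' => match Nat.compare a b with Eq => mcmp m' n' | c => c end
  end.

(** Merges two lists of terms sorted by [mcmp], so that equal monomials meet and
    their coefficients are added. *)
Fixpoint padd (p q : pol) {struct p} : pol :=
  let fix aux (q : pol) {struct q} : pol :=
    match p, q with
    | [::], _ => q
    | _, [::] => p
    | (c, m) :: p', (d, n) :: q' =>
      match mcmp m n with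
      | Eq => if c + d == 0 then padd p' q' else (c + d, m) :: padd p' q'
      | Lt => (c, m) :: padd p' q
      | Gt => (d, n) :: aux q'
      end
    end in aux q.

(** Merge sort; n bounds the depth of the recursion. *)
Fixpoint psum (n : nat) (p : pol) : pol :=
  if n is n'.+1 then
    if p is _ :: _ :: _ then
      let h := (size p)./2 in padd (psum n' (take h p)) (psum n' (drop h p))
    else p
  else p.

Definition pnorm (p : pol) : pol := psum (size p) [seq (t.1, sort leq t.2) | t <- p].
Definition pscale (c : int) (p : pol) : pol := [seq (c * t.1, t.2) | t <- p].
Definition pmul (p q : pol) : pol := [seq (s.1 * t.1, s.2 ++ t.2) | s <- p, t <- q].
Definition pder (j : nat) (p : pol) : pol :=
  [seq (t.1 *+ count_mem j t.2, rem j t.2) | t <- p & j \in t.2].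

(** The image of the variable k under E_a, as a list with at most one term. *)
Definition shear (a : vec) (k : nat) : seq (int * nat) :=
  let u := vadd a (w k) in
  if u \in wl then [:: (veps a (w k), index u wl)] else [::].

(** The derivation that maps the variable k to the terms T k. *)
Fixpoint mact (T : nat -> seq (int * nat)) (m : mono) : pol :=
  if m is k :: m' then
    [seq (t.1, t.2 :: m') | t <- T k] ++ [seq (t.1, k :: t.2) | t <- mact T m']
  else [::].
Definition pact (T : nat -> seq (int * nat)) (p : pol) : pol :=
  flatten [seq pscale t.1 (mact T t.2) | t <- p].

Definition pvalid (p : pol) := all (fun t => all (fun k => k < 56)%N t.2) p.

Section Eval.
Variables (K : numClosedFieldType) (beta : 'I_56 -> E8root).
Hypothesis hbeta : is_basis_enum beta.
Implicit Types (f g : {mpoly K[56]}) (r s : E8root) (p q : pol).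

(** The position in the enumeration beta of the weight number k. *)
Definition sg (k : nat) : 'I_56 :=
  odflt ord0 [pick i | val (beta i) == rowv (w k)].

Lemma sgE k : (k < 56)%N -> val (beta (sg k)) = rowv (w k).
Proof.
move=> hk; rewrite /sg; case: pickP => [i /eqP //|h].
have [_ h2 h1] := w_ok hk.
have [||i hi] := beta_ex hbeta (a := rowv (w k)).
- by rewrite vformE.
- by rewrite mxE.
- by have := h i; rewrite hi eqxx.
Qed.

Lemma sg_inj k l : (k < 56)%N -> (l < 56)%N -> sg k = sg l -> k = l.
Proof.
move=> hk hl e; have := sgE hk; rewrite e sgE // => /rowv_inj h.
have {h} := h (let: And3 h _ _ := w_ok hl in h) (let: And3 h _ _ := w_ok hk in h).
by move/eqP; rewrite (nth_uniq _ _ _ wl_uniq) // => /eqP.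
Qed.

Lemma sg_surj i : exists2 k, (k < 56)%N & sg k = i.
Proof.
have inj : injective (fun k : 'I_56 => sg k).
  by move=> k l /sg_inj e; apply/val_inj/e; exact: ltn_ord.
by exists (invF inj i); rewrite ?ltn_ord // (f_invF inj).
Qed.

Lemma sg0 : sg 0 = ord0.
Proof.
apply: (beta_inj hbeta); apply: val_inj; rewrite sgE //.
case: hbeta => _ _ ->; apply/rowP => i; rewrite !mxE.
by case/and4P: wl_ok => _ _ /eqP e _; rewrite e.
Qed.

(** [mev] and [ev] interpret the computational monomials and polynomials. *)
Definition mev (m : mono) : {mpoly K[56]} := \prod_(k <- m) 'X_(sg k).
Definition ev (p : pol) : {mpoly K[56]} := \sum_(t <- p) (t.1)%:~R *: mev t.2.

Lemma ev_nil : ev [::] = 0. Proof. exact: big_nil. Qed.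
Lemma ev_cons t p : ev (t :: p) = (t.1)%:~R *: mev t.2 + ev p.
Proof. exact: big_cons. Qed.
Lemma ev_cat p q : ev (p ++ q) = ev p + ev q. Proof. exact: big_cat. Qed.
Lemma mev_nil : mev [::] = 1. Proof. exact: big_nil. Qed.
Lemma mev_cons k m : mev (k :: m) = 'X_(sg k) * mev m.
Proof. exact: big_cons. Qed.

Lemma mcmpP m n : mcmp m n = Eq -> m = n.
Proof.
elim: m n => [|a m IH] [|b n] //=.
by case E: (Nat.compare a b) => // /IH ->; move/PeanoNat.Nat.compare_eq_iff: E => ->.
Qed.

Lemma padd_nilr p : padd p [::] = p.
Proof. by case: p => [|[? ?] ?]. Qed.

Lemma ev_padd p q : ev (padd p q) = ev p + ev q.
Proof.
elim: p q => [|[c m] p IHp] q; first by case: q => [|? ?]; rewrite ev_nil add0r.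
elim: q => [|[d n] q IHq]; first by rewrite padd_nilr ev_nil addr0.
rewrite /=; case E: (mcmp m n).
- have <- := mcmpP E; rewrite !ev_cons /= addrACA -scalerDl -rmorphD.
  by case: eqP => [e|_]; rewrite ?ev_cons IHp // e rmorph0 scale0r add0r.
- by rewrite ev_cons IHp !ev_cons addrA.
- by rewrite ev_cons -[X in ev X]/(padd ((c, m) :: p) q) IHq !ev_cons /= addrCA.
Qed.

Lemma ev_psum n p : ev (psum n p) = ev p.
Proof.
elim: n p => [|n IH] p //=; case: p => [|t [|t' p]] //.
by rewrite ev_padd !IH -ev_cat cat_take_drop.
Qed.

Lemma ev_pnorm p : ev (pnorm p) = ev p.
Proof.
rewrite ev_psum /ev big_map; apply: eq_bigr => t _ /=.
by congr (_ *: _); apply: perm_big; rewrite perm_sort.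
Qed.

Lemma ev_pscale c p : ev (pscale c p) = c%:~R *: ev p.
Proof.
rewrite /ev big_map scaler_sumr; apply: eq_bigr => t _ /=.
by rewrite rmorphM scalerA.
Qed.

Section Deriv.
Variables (D : {mpoly K[56]} -> {mpoly K[56]}) (T : nat -> seq (int * nat)).
Hypothesis dD : derivation D.
Hypothesis DT : forall k, (k < 56)%N -> D 'X_(sg k) = \sum_(t <- T k) (t.1)%:~R *: 'X_(sg t.2).

Lemma ev_mact m : all (fun k => k < 56)%N m -> D (mev m) = ev (mact T m).
Proof.
elim: m => [|k m IH] /=; first by rewrite mev_nil derivation1 ?ev_nil.
case/andP=> hk hm; rewrite mev_cons dD.2 DT // IH // ev_cat /ev !big_map; congr (_ + _).
  by rewrite mulr_suml; apply: eq_bigr => t _; rewrite mev_cons scalerAl.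
by rewrite mulr_sumr; apply: eq_bigr => t _; rewrite mev_cons scalerAr.
Qed.

Lemma ev_pact p : pvalid p -> D (ev p) = ev (pact T p).
Proof.
rewrite /ev derivation_sum //; elim: p => [|t p IH] /=; first by rewrite /pact !big_nil.
case/andP=> ht hp; rewrite big_cons IH // derivationZ // ev_mact //.
by rewrite /pact /= big_cat /=; congr (_ + _); rewrite -/(ev _) -/(ev (pscale _ _)) ev_pscale.
Qed.

End Deriv.

Lemma act_deriv x : derivation (actA (K := K) beta x).
Proof. exact: linfield_deriv. Qed.

Lemma act_shear r a k : val r = rowv a -> (k < 56)%N ->
  actA beta (Eel K r) 'X_(sg k) = \sum_(t <- shear a k) (t.1)%:~R *: 'X_(sg t.2).
Proof.
move=> ra hk; rewrite [LHS](linfield_X (adV beta (Eel K r))) /shear.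
case: ifP => h.
  have hl : (index (vadd a (w k)) wl < 56)%N by rewrite -wl_size index_mem.
  have wlE : w (index (vadd a (w k)) wl) = vadd a (w k) by rewrite /w nth_index.
  rewrite big_seq1 /= (bigD1 (sg (index (vadd a (w k)) wl))) //= big1 => [|i ni].
    by rewrite adV_E // !sgE // wlE ra rowvD eqxx addr0 vepsE.
  rewrite adV_E //; case: eqP => [e|]; last by rewrite scale0r.
  case/eqP: ni; apply: (beta_inj hbeta); apply: val_inj.
  by rewrite e !sgE // wlE ra rowvD.
rewrite big_nil big1 // => i _; rewrite adV_E //; case: eqP => [e|]; last by rewrite scale0r.
have [l hl li] := sg_surj i; case/negP: h.
suff -> : vadd a (w k) = w l by exact: mem_nth.
apply: rowv_inj; rewrite ?size_mkseq //; first by case: (w_ok hl).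
by rewrite rowvD -ra -!sgE // -e li.
Qed.

Lemma act_ev_eq0 r a p : val r = rowv a -> pvalid p ->
  pnorm (pact (fun k => nth [::] (mkseq (shear a) 56) k) p) = [::] ->
  actA beta (Eel K r) (ev p) = 0.
Proof.
move=> ra vp e; rewrite (ev_pact (act_deriv _) (T := nth [::] (mkseq (shear a) 56))) //.
  by rewrite -ev_pnorm e ev_nil.
by move=> k hk; rewrite nth_mkseq //; exact: act_shear.
Qed.

End Eval.

(** * The five generators *)

(** The highest root of E_8. *)
Definition Theta : vec := [:: 2; 3; 4; 6; 5; 4; 3; 2].
Definition nul : vec := nseq 8 0.

(** The pairs k < l of weights with sum v: an absent difference gets the index
    56, which the bound rejects. *)
Definition pairs (v : vec) : seq (nat * nat) :=
  [seq p <- [seq (k, index (vsub v (w k)) wl) | k <- iota 0 56] | (p.1 < p.2 < 56)%N].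

(** The component along E_a of the quadratic moment map
    x |-> [x, [x, E_(-Theta)]] / 2 from the 56-dimensional module to E_7. *)
Definition mu (a : vec) : pol :=
  [seq (veps (w p.1) (vsub (w p.2) Theta) * veps (w p.2) (vsub nul Theta), [:: p.1; p.2])
     | p <- pairs (vadd Theta a)].

(** Twice the coefficient of the Cartan component of the moment map along the
    simple root of 0-based index i. *)
Definition muH (i : nat) : pol :=
  [seq (- veps (w p.2) (vsub nul Theta) * ((w p.1)`_i - (w p.2)`_i), [:: p.1; p.2])
     | p <- pairs Theta].

(** The highest root of E_7, which is its first fundamental weight. *)
Definition high : vec := [:: 2; 2; 3; 4; 3; 2; 1; 0].
(** The sixth fundamental weight of E_7. *)
Definition omega6 : vec := [:: 2; 3; 4; 6; 5; 4; 2; 0].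
(** The roots of E_7, as differences of weights with product 1. *)
Definition roots : seq vec := Eval vm_compute in
  undup [seq vsub p.1 p.2 | p <- [seq (b, c) | b <- wl, c <- wl] & vform p.1 p.2 == 1].

(** The component of the moment map along the highest root of E_7. *)
Definition zetaP : pol := Eval vm_compute in mu high.
(** The sum of mu_a mu_b over a + b = omega6, where the signs make it singular. *)
Definition sigmaP : pol := Eval vm_compute in
  pnorm (flatten [seq pscale (veps a (vsub omega6 a)) (pmul (mu a) (mu (vsub omega6 a)))
     | a <- roots & vsub omega6 a \in roots]).
(** Four times the invariant form of E_7 on the moment map: (E_a, E_(-a)) = -1,
    and muH carries a factor 2. *)
Definition etaP : pol := Eval vm_compute in
  pnorm (flatten [seq pscale (-4) (pmul (mu a) (mu (vsub nul a))) | a <- roots]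
     ++ flatten [seq pscale (vform (simple p.1) (simple p.2)) (pmul (muH p.1) (muH p.2))
          | p <- [seq (i, j) | i <- iota 0 8, j <- iota 0 8]]).
(** The derivation in the coordinate 55, of lowest weight, commutes with positive
    root vectors. *)
Definition thetaP : pol := Eval vm_compute in pder 55 etaP.

(** Only the seven simple root vectors are tested, see [upkilled_simple]. *)
Definition highest_check (p : pol) : bool :=
  pvalid p && all (fun i =>
    let T := mkseq (shear (simple i)) 56 in
    nilp (pnorm (pact (fun k => nth [::] T k) p))) (iota 0 7).

Lemma zeta_check : highest_check zetaP. Proof. by vm_compute. Qed.
Lemma sigma_check : highest_check sigmaP. Proof. by vm_compute. Qed.
Lemma theta_check : highest_check thetaP. Proof. by vm_compute. Qed.
Lemma eta_check : highest_check etaP. Proof. by vm_compute. Qed.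

(** * The polynomials annihilated by the positive root vectors *)

Section Divisibility.
Variables (K : numFieldType) (n : nat).

(** Q is congruent modulo 'X_i to the polynomial where 'X_i is replaced by 0,
    which vanishes on a dense set. *)
Lemma mpolyX_dvd (i : 'I_n) (Q : {mpoly K[n]}) :
  (forall v, v i = 0 -> (forall j, j != i -> v j != 0) -> Q.@[v] = 0) ->
  exists Q', Q = 'X_i * Q'.
Proof.
move=> hQ; pose T := [tuple (if j == i then 0 else 'X_j : {mpoly K[n]}) | j < n].
have [Q' e] : exists Q', Q = 'X_i * Q' + (Q \mPo T).
  elim/mpoly_alg_ind: (Q) => [|k f g [f' ef] [g' eg]|f g [f' ef] [g' eg]|j].
  - by exists 0; rewrite rmorph1 mulr0 add0r.
  - exists (k *: f' + g'); rewrite linearP /= {1}ef {1}eg scalerDr addrACA.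
    by rewrite mulrDr scalerAr.
  - exists (f' * g + (f \mPo T) * g'); rewrite rmorphM /= {1}ef {1 2}eg; ring.
  - case: (eqVneq j i) => [->|nj].
      by exists 1; rewrite comp_mpolyXU -tnth_nth tnth_mktuple eqxx mulr1 addr0.
    exists 0; rewrite comp_mpolyXU -tnth_nth tnth_mktuple (negbTE nj).
    by rewrite mulr0 add0r.
exists Q'; rewrite [LHS]e (_ : Q \mPo T = 0) ?addr0 //.
apply: (mpoly_vanish_open (d := \prod_(j | j != i) 'X_j)).
  by apply/prodf_neq0 => j _; rewrite -msize_poly_eq0 msizeX.
move=> v; rewrite comp_mpoly_meval rmorph_prod /= => /prodf_neq0 hv.
apply: hQ => [|j nj]; rewrite tnth_mktuple ?eqxx ?meval0 //.
by rewrite (negbTE nj); exact: hv.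
Qed.

End Divisibility.

Definition upvec (a : vec) : bool :=
  [&& vform a a == 2, a`_7 == 0 & all (fun x => 0 <= x) a] && (size a == 8).

(** The positive root a = w i - w j moves a point p by a multiple of p_i in the
    coordinate j, and this multiple is chosen so as to cancel p_j. The test says
    that this clears the coordinates in T one after the other, without changing
    p_i and without disturbing the coordinates in Z cleared before. *)
Fixpoint clear_check (i : nat) (T Z : seq nat) : bool :=
  if T is j :: T' then
    let a := vsub (w i) (w j) in
    [&& upvec a, (j < 56)%N, nilp (shear a i),
        (if shear a j is [:: (c, l)] then (l == i) && (c != 0) else false),
        all (fun k => (k < 56)%N && all (fun t : int * nat => t.2 \in Z) (shear a k)) Z
      & clear_check i T' (j :: Z)]
  else true.

Section Covariants.
Variables (K : numClosedFieldType) (beta : 'I_56 -> E8root).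
Hypothesis hbeta : is_basis_enum beta.
Implicit Types (f g : {mpoly K[56]}) (r s : E8root) (P : pol).

Local Notation act := (@actA K beta).
Local Notation sg := (sg beta).
Local Notation ev := (ev K beta).

(** The covariants; a singular vector is a nonzero covariant with a weight. *)
Definition upkilled f := forall r, inQ7 r -> positive r -> act (Eel K r) f = 0.

Lemma root_of_vec a : vform a a = 2 -> {r : E8root | val r = rowv a}.
Proof. move=> h; have h' : form (rowv a) (rowv a) == 2 by rewrite vformE h.
by exists (exist (fun a => form a a == 2) _ h'). Qed.

Lemma form_simple r : form (val r) (val r) = \sum_(i < 8) val r 0 i * form (rowv (simple i)) (val r).
Proof.
rewrite {1}[val r]row_sum_delta formC form_sumr; apply: eq_bigr => i _.
by rewrite formZr rowv_simple_delta (formC (val r)).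
Qed.

Lemma actA_bracket x y f : inE7 x -> inE7 y ->
  act (bracket x y) f = act x (act y f) - act y (act x f).
Proof. by move=> hx hy; rewrite -[LHS]/(linfield _ f) (adV_bracket hbeta) // linfield_comm. Qed.

Lemma actA_P k x y f : act (k *: x + y) f = k *: act x f + act y f.
Proof. by rewrite -[LHS]/(linfield _ f) adV_P linfield_P. Qed.

Lemma actA_0 f : act 0 f = 0.
Proof. by have := actA_P (-1) 0 0 f; rewrite scaler0 addr0 scaleN1r addNr. Qed.

Lemma actA_Z k x f : act (k *: x) f = k *: act x f.
Proof. by rewrite -[k *: x]addr0 actA_P actA_0 addr0. Qed.

(** A positive root that is not simple is a positive root plus a simple one,
    and its root vector is, up to sign, the bracket of theirs. The sum of the
    coordinates decreases. *)
Lemma upkilled_simple f :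
  (forall i r, (i < 7)%N -> val r = rowv (simple i) -> act (Eel K r) f = 0) ->
  upkilled f.
Proof.
move=> hs r; have [N] := ubnP (absz (\sum_(i < 8) val r 0 i)%R).
elim: N r => // N IH r hN hr /forallP pr.
have [i /andP[ri0 fi0]] : exists i : 'I_8, (0 < val r 0 i) && (0 < form (rowv (simple i)) (val r)).
  apply/existsP; apply: contraT; rewrite negb_exists => /forallP h.
  have := root_form r; rewrite form_simple => e.
  suff: \sum_(i < 8) val r 0 i * form (rowv (simple i)) (val r) <= 0 by rewrite e.
  apply: sumr_le0 => i _; move: (h i) (pr i); rewrite negb_and -!leNgt.
  case/orP => h1 h2; first by rewrite (_ : val r 0 i = 0) ?mul0r //; lia.
  by rewrite mulr_ge0_le0.
have i7 : (i < 7)%N.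
  rewrite ltn_neqAle -ltnS ltn_ord andbT; apply/eqP => e.
  by move: ri0; rewrite (_ : i = ord_max) ?(eqP hr) //; apply: val_inj.
have vs : vform (simple i) (simple i) = 2.
  by move: i7; case: (nat_of_ord i) => [|[|[|[|[|[|[|?]]]]]]].
have [s es] := root_of_vec vs.
have hs7 : inQ7 s by rewrite /inQ7 es rowv_simple mxE /= (gtn_eqF i7).
have [e|ne] := eqVneq (val r) (val s); first by apply: (hs i) => //; rewrite e.
have f1 : form (val s) (val r) = 1.
  by have := form_le1 (root_form s) (root_form r); rewrite eq_sym ne es => /(_ isT); lia.
have hc : form (val r - val s) (val r - val s) == 2.
  by rewrite form_sqB !root_form formC f1.
pose c : E8root := exist (fun a => form a a == 2) _ hc.
have hc7 : inQ7 c by rewrite /inQ7 /= !mxE (eqP hr) (eqP hs7).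
have pc : positive c.
  apply/forallP => j; rewrite /= !mxE es rowv_simple mxE.
  by case: (eqVneq (j : nat) i) => [/val_inj ->|_]; [rewrite subr_ge0 -gtz0_ge1 | rewrite subr0].
have cN : act (Eel K c) f = 0.
  apply: (IH c _ hc7 pc).
  have h0 : 0 <= \sum_(i < 8) val c 0 i by apply: sumr_ge0 => j _; exact: (forallP pc).
  have e : (\sum_(i < 8) val r 0 i)%R = (\sum_(i < 8) val c 0 i)%R + 1.
    have e1 : \sum_(j < 8) val s 0 j = 1.
      rewrite (bigD1 i) //= big1 => [|j nj]; first by rewrite es rowv_simple mxE eqxx addr0.
      by rewrite es rowv_simple mxE (inj_eq val_inj) (negbTE nj).
    transitivity (\sum_(j < 8) val c 0 j + \sum_(j < 8) val s 0 j); last by rewrite e1.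
    by rewrite -big_split; apply: eq_bigr => j _ /=; rewrite !mxE subrK.
  move: hN h0; rewrite e; move: (\sum_(i < 8) val c 0 i)%R => z; lia.
have br : bracket (Eel K s) (Eel K c) = Fsign K (val s) (val c) *: Eel K r.
  rewrite bracket_EE /bracketE; case: (altP eqP) => [e|_].
    have := root_form r; rewrite -[val r](subrK (val s)) -[_ - _]/(val c) e addNr.
    by rewrite form0l.
  case: insubP => [d hd ed|].
    by congr (_ *: Eel K _); apply: val_inj; rewrite ed /= addrC subrK.
  by rewrite /= [val s + _]addrC subrK root_form.
have := actA_bracket f (inE7_E K hs7) (inE7_E K hc7).
rewrite br cN (hs i) // actA_Z.
have d0 y : act y 0 = 0 by apply: derivation0; exact: act_deriv.
rewrite !d0 subrr => /eqP; rewrite scaler_eq0 (negbTE (Fsign_neq0 _ _ _)) /=.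
by move/eqP.
Qed.

Lemma upkilled_ev P : highest_check P -> upkilled (ev P).
Proof.
case/andP=> vP /allP h; apply: upkilled_simple => i r hi er.
apply: (act_ev_eq0 _ hbeta er vP). by apply/nilP/h; rewrite mem_iota.
Qed.

(** The relation between p and an image q of p under the unipotent group, stated
    through the covariants in order to avoid the group. *)
Definition reachable (p q : 'I_56 -> K) := forall f, upkilled f -> f.@[q] = f.@[p].

Lemma reach_step a (p : 'I_56 -> K) t : upvec a ->
  exists2 q, reachable p q & forall k, (k < 56)%N ->
    q (sg k) = p (sg k) + t * \sum_(s <- shear a k) (s.1)%:~R * p (sg s.2).
Proof.
case/andP => /and3P[/eqP a2 /eqP a7 /allP a0] /eqP sa.
have [r er] := root_of_vec a2.
have hr : inQ7 r by rewrite /inQ7 er mxE a7.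
have pr : positive r.
  apply/forallP => i; rewrite er mxE; apply: a0; apply: mem_nth.
  by rewrite sa; exact: ltn_ord.
exists (fun j => p j + t * \sum_i adV beta (Eel K r) i j * p i) => [f hf|k hk].
  by apply: linfield_flow; [exact: adV_E_sq | exact: hf].
have := congr1 (meval p) (act_shear K hbeta er hk).
rewrite -[actA _ _ _]/(linfield _ _) linfield_X !raddf_sum /=.
under eq_bigr do rewrite mevalZ mevalXU.
by move=> ->; congr (_ + _ * _); apply: eq_bigr => s _; rewrite mevalZ mevalXU.
Qed.

Lemma reach_clear i T Z p : (i < 56)%N -> clear_check i T Z -> p (sg i) != 0 ->
  (forall k, k \in Z -> p (sg k) = 0) ->
  exists2 q, reachable p q & forall k, (k \in Z) || (k \in T) -> q (sg k) = 0.
Proof.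
move=> hi; elim: T Z p => [|j T IH] Z p /=.
  by move=> _ _ pZ; exists p => // k; rewrite orbF; exact: pZ.
case/and5P=> ua hj /nilP si sj /andP[/allP sZ cT] pi pZ.
case E: (shear (vsub (w i) (w j)) j) sj => [//|[c l] [|//]] /andP[/eqP el nc].
pose t := - p (sg j) / (c%:~R * p (sg i)).
have [q rq hq] := reach_step p t ua.
have qi : q (sg i) = p (sg i) by rewrite hq // si big_nil mulr0 addr0.
have [|k|q' rq' hq'] := IH (j :: Z) q cT.
- by rewrite qi.
- rewrite inE => /orP[/eqP ->|kZ].
    rewrite hq // E big_seq1 el /t divfK ?subrr ?addrN //.
    by rewrite mulf_neq0 ?intr_eq0.
  have /andP[hk /allP sk] := sZ k kZ.
  rewrite hq // pZ // big_seq big1 ?mulr0 ?addr0 // => s hs.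
  by rewrite pZ ?mulr0 //; exact: sk.
exists q' => [f hf|k hk]; first by rewrite rq' // rq.
by apply: hq'; move: hk; rewrite !inE; case: (k == j) (k \in Z) (k \in T) => [] [] [].
Qed.

Lemma meval_mev (v : 'I_56 -> K) m : (mev K beta m).@[v] = \prod_(k <- m) v (sg k).
Proof. by rewrite rmorph_prod; apply: eq_bigr => k _; rewrite /= mevalXU. Qed.

Lemma meval_ev_supp P (S : seq nat) (v : 'I_56 -> K) :
  pvalid P -> (forall k, (k < 56)%N -> k \notin S -> v (sg k) = 0) ->
  (ev P).@[v] = \sum_(t <- [seq t <- P | all (mem S) t.2])
     (t.1)%:~R * \prod_(k <- t.2) v (sg k).
Proof.
move=> /allP vP hv; rewrite /ev raddf_sum /= big_filter [RHS]big_mkcond /=.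
rewrite big_seq [RHS]big_seq; apply: eq_bigr => t /vP/allP ht.
rewrite mevalZ meval_mev; case: ifP => // /negbT /allPn[k kt kS].
rewrite (big_rem k) //= hv ?mul0r ?mulr0 //; exact: ht.
Qed.

(** The point whose coordinate at the weight number k is c k. *)
Definition pt (c : nat -> K) (i : 'I_56) : K :=
  c (find (fun k => sg k == i) (iota 0 56)).

Lemma ptE c k : (k < 56)%N -> pt c (sg k) = c k.
Proof.
move=> hk; rewrite /pt; congr c; set b := fun l => _.
have hb : has b (iota 0 56) by apply/hasP; exists k; rewrite ?mem_iota /b.
have := nth_find 0%N hb; have := hb; rewrite has_find size_iota => hf.
by rewrite /b nth_iota // add0n => /eqP /(sg_inj hbeta hf hk).
Qed.

Lemma meval_ev_pt P (S : seq nat) c :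
  pvalid P -> all (fun k => k < 56)%N S -> (forall k, k \notin S -> c k = 0) ->
  (ev P).@[pt c] = \sum_(t <- [seq t <- P | all (mem S) t.2])
     (t.1)%:~R * \prod_(k <- t.2) c k.
Proof.
move=> vP /allP hS hc; rewrite (meval_ev_supp (S := S)) //; last first.
  by move=> k hk kS; rewrite ptE // hc.
rewrite !big_filter; apply: eq_bigr => t /allP ht; congr (_ * _).
by rewrite big_seq [RHS]big_seq; apply: eq_bigr => k /ht /hS hk; rewrite ptE.
Qed.

End Covariants.

(** The weights 0, 18 and 40 are pairwise orthogonal. The sets T1, T2 and T3 are
    the 27, 16 and 8 coordinates cleared by the pivots 0, 18 and 40, and SS holds
    the five that remain. *)
Definition T1 : seq nat := Eval vm_compute in [seq k <- iota 0 56 | vform (w 0) (w k) == 1].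
Definition T2 : seq nat := Eval vm_compute in
  [seq k <- iota 0 56 | (vform (w 0) (w k) == 0) && (vform (w 18) (w k) == 1)].
Definition T3 : seq nat := Eval vm_compute in
  [seq k <- iota 0 56 | [&& vform (w 0) (w k) == 0, vform (w 18) (w k) == 0 & vform (w 40) (w k) == 1]].
Definition SS := [:: 0; 18; 40; 54; 55]%N.

Lemma targets_cover k : (k < 56)%N -> k \notin SS -> (k \in T1 ++ T2) || (k \in T3).
Proof.
move=> hk; have : k \in SS ++ (T1 ++ T2) ++ T3.
  have /allP : all (mem (SS ++ (T1 ++ T2) ++ T3)) (iota 0 56) by vm_compute.
  by apply; rewrite mem_iota.
by rewrite mem_cat [k \in (T1 ++ T2) ++ T3]mem_cat => /orP[->|].
Qed.

Lemma clear_x1 : clear_check 0 T1 [::].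
Proof. by vm_compute. Qed.
Lemma clear_zeta1 : clear_check 18 T2 T1.
Proof. by vm_compute. Qed.
Lemma clear_sigma : clear_check 40 T3 (T1 ++ T2).
Proof. by vm_compute. Qed.

Lemma zeta_v : pvalid zetaP. Proof. by vm_compute. Qed.
Lemma theta_v : pvalid thetaP. Proof. by vm_compute. Qed.
Lemma sigma_v : pvalid sigmaP. Proof. by vm_compute. Qed.
Lemma eta_v : pvalid etaP. Proof. by vm_compute. Qed.

Section Generators.
Variables (K : numClosedFieldType) (beta : 'I_56 -> E8root).
Hypothesis hbeta : is_basis_enum beta.
Implicit Types (f g : {mpoly K[56]}) (x z t s e : K).

Local Notation sg := (sg beta).
Local Notation pt := (pt beta).
Definition x1 : {mpoly K[56]} := 'X_ord0.
Definition zeta1 := ev K beta zetaP.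
Definition theta := ev K beta thetaP.
Definition sigma := ev K beta sigmaP.
Definition eta := ev K beta etaP.
Definition gens := [tuple x1; zeta1; theta; sigma; eta].

Definition vals x z t s e (i : 'I_5) : K := [:: x; z; t; s; e]`_i.

(** The coordinates c on the weights S, and 0 elsewhere. *)
Definition along_supp (S : seq nat) (c : seq K) (k : nat) : K := c`_(index k S).

Lemma along_supp_out S c k : (size c <= size S)%N -> k \notin S -> along_supp S c k = 0.
Proof. by move=> h kS; rewrite /along_supp memNindex // nth_default. Qed.

Lemma x1_ev : x1 = ev K beta [:: (1, [:: 0%N])].
Proof. by rewrite ev_cons ev_nil mev_cons mev_nil mulr1 scale1r addr0 sg0. Qed.

Lemma x1_upkilled : upkilled beta x1.
Proof. by rewrite x1_ev; apply: upkilled_ev => //; vm_compute. Qed.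

(** Reduces the values of the generators at a point supported on S to those of
    the few terms that involve only S. *)
Lemma gens_cover S c x z t s e :
  all (fun k => k < 56)%N S -> (size c <= size S)%N ->
  along_supp S c 0 = x ->
  \sum_(u <- [seq u <- zetaP | all (mem S) u.2])
     (u.1)%:~R * \prod_(k <- u.2) along_supp S c k = z ->
  \sum_(u <- [seq u <- thetaP | all (mem S) u.2])
     (u.1)%:~R * \prod_(k <- u.2) along_supp S c k = t ->
  \sum_(u <- [seq u <- sigmaP | all (mem S) u.2])
     (u.1)%:~R * \prod_(k <- u.2) along_supp S c k = s ->
  \sum_(u <- [seq u <- etaP | all (mem S) u.2])
     (u.1)%:~R * \prod_(k <- u.2) along_supp S c k = e ->
  forall i, (tnth gens i).@[pt (along_supp S c)] = vals x z t s e i.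
Proof.
move=> hS hc ex ez et es ee i.
have out k : k \notin S -> along_supp S c k = 0 by exact: along_supp_out.
have hE P : pvalid P -> _ := fun vP => meval_ev_pt hbeta vP hS out.
rewrite (tnth_nth 0) /vals; case: i => -[|[|[|[|[|//]]]]] /= _.
- by rewrite mevalXU -(sg0 hbeta) ptE.
- by rewrite hE ?zeta_v.
- by rewrite hE ?theta_v.
- by rewrite hE ?sigma_v.
- by rewrite hE ?eta_v.
Qed.

(** On points supported on SS the generators are p_0, - p_0 p_18, 12 p_0^2 p_55,
    2 p_0^2 p_18 p_40 and 6 p_0^2 p_55^2 + 24 p_0 p_18 p_40 p_54. These are the
    coordinates for which they take the values x, z, t, s, e. *)
Definition nf x z t s e : seq K :=
  [:: x; - z / x; - s / (2 * x * z); (24 * x ^+ 2 * e - t ^+ 2) / (288 * x * s);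
      t / (12 * x ^+ 2)].

Lemma nf_cover x z t s e : x != 0 -> z != 0 -> s != 0 ->
  forall i, (tnth gens i).@[pt (along_supp SS (nf x z t s e))] = vals x z t s e i.
Proof.
move=> x0 z0 s0; apply: gens_cover => //.
- rewrite (_ : [seq _ <- _ | _] = [:: (-1, [:: 0; 18]%N)]); last by vm_compute.
  by rewrite !big_cons !big_nil /along_supp /=; field; rewrite ?x0 ?z0 ?s0.
- rewrite (_ : [seq _ <- _ | _] = [:: (12, [:: 0; 0; 55]%N)]); last by vm_compute.
  by rewrite !big_cons !big_nil /along_supp /=; field; rewrite ?x0 ?z0 ?s0.
- rewrite (_ : [seq _ <- _ | _] = [:: (2, [:: 0; 0; 18; 40]%N)]); last by vm_compute.
  by rewrite !big_cons !big_nil /along_supp /=; field; rewrite ?x0 ?z0 ?s0.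
- rewrite (_ : [seq _ <- _ | _] = [:: (6, [:: 0; 0; 55; 55]%N); (24, [:: 0; 18; 40; 54]%N)]);
    last by vm_compute.
  by rewrite !big_cons !big_nil /along_supp /=; field; rewrite ?x0 ?z0 ?s0.
Qed.

(** For a point supported on 1, 15, 37, 55 the values z, t, s, e are monomials in
    the coordinates, and they are solved for successively. *)
Lemma x1_cover z t s e : z != 0 -> t != 0 -> s != 0 -> e != 0 ->
  exists c, forall i, (tnth gens i).@[pt c] = vals 0 z t s e i.
Proof.
move=> z0 t0 s0 e0; pose a := 12 * s / t.
exists (along_supp [:: 1; 15; 37; 55]%N [:: a; - z / a; - t / (24 * z); e / t]).
have a0 : a != 0 by rewrite /a !mulf_neq0 ?invr_eq0 ?pnatr_eq0.
apply: gens_cover => //.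
- rewrite (_ : [seq _ <- _ | _] = [:: (-1, [:: 1; 15]%N)]); last by vm_compute.
  by rewrite !big_cons !big_nil /along_supp /=; field; rewrite ?a0 ?z0 ?t0 ?s0.
- rewrite (_ : [seq _ <- _ | _] = [:: (24, [:: 1; 15; 37]%N)]); last by vm_compute.
  by rewrite !big_cons !big_nil /along_supp /=; field; rewrite ?a0 ?z0 ?t0 ?s0.
- rewrite (_ : [seq _ <- _ | _] = [:: (2, [:: 1; 1; 15; 37]%N)]); last by vm_compute.
  by rewrite !big_cons !big_nil /along_supp /= /a; field; rewrite ?a0 ?z0 ?t0 ?s0.
- rewrite (_ : [seq _ <- _ | _] = [:: (24, [:: 1; 15; 37; 55]%N)]); last by vm_compute.
  by rewrite !big_cons !big_nil /along_supp /=; field; rewrite ?a0 ?z0 ?t0 ?s0.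
Qed.

(** The normal form with the weights 18 and 40 replaced by 21 and 38, which makes
    the only term of zeta1 vanish. *)
Lemma zeta1_cover x t s e : x != 0 -> s != 0 ->
  exists c, forall i, (tnth gens i).@[pt c] = vals x 0 t s e i.
Proof.
move=> x0 s0; exists (along_supp [:: 0; 21; 38; 54; 55]%N
   [:: x; 1; s / (2 * x ^+ 2); (24 * x ^+ 2 * e - t ^+ 2) / (288 * x * s); t / (12 * x ^+ 2)]).
apply: gens_cover => //.
- rewrite (_ : [seq _ <- _ | _] = [::]); last by vm_compute.
  by rewrite big_nil.
- rewrite (_ : [seq _ <- _ | _] = [:: (12, [:: 0; 0; 55]%N)]); last by vm_compute.
  by rewrite !big_cons !big_nil /along_supp /=; field; rewrite ?x0 ?s0.
- rewrite (_ : [seq _ <- _ | _] = [:: (2, [:: 0; 0; 21; 38]%N)]); last by vm_compute.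
  by rewrite !big_cons !big_nil /along_supp /=; field; rewrite ?x0 ?s0.
- rewrite (_ : [seq _ <- _ | _] = [:: (6, [:: 0; 0; 55; 55]%N); (24, [:: 0; 21; 38; 54]%N)]);
    last by vm_compute.
  by rewrite !big_cons !big_nil /along_supp /=; field; rewrite ?x0 ?s0.
Qed.

(** The normal form with the weights 40 and 54 replaced by 47 and 51, which makes
    the only term of sigma vanish. *)
Lemma sigma_cover x z t e : x != 0 -> z != 0 ->
  exists c, forall i, (tnth gens i).@[pt c] = vals x z t 0 e i.
Proof.
move=> x0 z0; exists (along_supp [:: 0; 18; 47; 51; 55]%N
   [:: x; - z / x; 1; (t ^+ 2 - 24 * x ^+ 2 * e) / (576 * x ^+ 2 * z); t / (12 * x ^+ 2)]).
apply: gens_cover => //.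
- rewrite (_ : [seq _ <- _ | _] = [:: (-1, [:: 0; 18]%N)]); last by vm_compute.
  by rewrite !big_cons !big_nil /along_supp /=; field; rewrite ?x0 ?z0.
- rewrite (_ : [seq _ <- _ | _] = [:: (12, [:: 0; 0; 55]%N)]); last by vm_compute.
  by rewrite !big_cons !big_nil /along_supp /=; field; rewrite ?x0 ?z0.
- rewrite (_ : [seq _ <- _ | _] = [::]); last by vm_compute.
  by rewrite big_nil.
- rewrite (_ : [seq _ <- _ | _] = [:: (6, [:: 0; 0; 55; 55]%N); (24, [:: 0; 18; 47; 51]%N)]);
    last by vm_compute.
  by rewrite !big_cons !big_nil /along_supp /=; field; rewrite ?x0 ?z0.
Qed.

Lemma gen_neq0 i : tnth gens i != 0.
Proof.
apply/eqP => h; have := nf_cover 1 1 (oner_neq0 K) (oner_neq0 K) (oner_neq0 K) i.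
rewrite h meval0; apply/eqP; rewrite eq_sym.
by case: i {h} => -[|[|[|[|[|//]]]]] ?; exact: oner_neq0.
Qed.

Lemma valsE (v : 'I_5 -> K) :
  v =1 vals (v ord0) (v (inord 1)) (v (inord 2)) (v (inord 3)) (v (inord 4)).
Proof.
by case=> -[|[|[|[|[|//]]]]] hi; rewrite /vals /=; congr (v _); apply: val_inj; rewrite /= ?inordK.
Qed.

Lemma gens_meval (Q : {mpoly K[5]}) p (v : 'I_5 -> K) :
  (forall i, (tnth gens i).@[p] = v i) -> (Q \mPo gens).@[p] = Q.@[v].
Proof. by move=> h; rewrite comp_mpoly_meval; apply: meval_eq. Qed.

(** On the normal forms the generators take all values with x z s nonzero. *)
Lemma gens_indep (Q : {mpoly K[5]}) : Q \mPo gens = 0 -> Q = 0.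
Proof.
move=> h; apply: (mpoly_vanish_open (d := 'X_ord0 * 'X_(inord 1) * 'X_(inord 3))).
  by rewrite !mulf_neq0 // -msize_poly_eq0 msizeX.
move=> v; rewrite !mevalM !mevalXU !mulf_eq0 !negb_or => /andP[/andP[h0 h1] h3].
have := gens_meval Q (nf_cover (v (inord 2)) (v (inord 4)) h0 h1 h3).
by rewrite h meval0 => ->; apply: meval_eq => i; rewrite -valsE.
Qed.

Lemma mevalXn n (v : 'I_n -> K) (f : {mpoly K[n]}) k : (f ^+ k).@[v] = f.@[v] ^+ k.
Proof. exact: rmorphXn. Qed.

(** The coordinates of the normal form have denominators dividing x z s, and the
    uniform exponent 2 serves all five. *)
Lemma clear_denominators f : exists N (Q : {mpoly K[5]}), forall x z t s e,
  x != 0 -> z != 0 -> s != 0 ->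
  f.@[pt (along_supp SS (nf x z t s e))] * (x * z * s) ^+ N = Q.@[vals x z t s e].
Proof.
pose X : {mpoly K[5]} := 'X_ord0; pose Z : {mpoly K[5]} := 'X_(inord 1).
pose T : {mpoly K[5]} := 'X_(inord 2); pose S : {mpoly K[5]} := 'X_(inord 3).
pose E : {mpoly K[5]} := 'X_(inord 4).
have XE x z t s e : X.@[vals x z t s e] = x by rewrite mevalXU.
have ZE x z t s e : Z.@[vals x z t s e] = z by rewrite mevalXU /vals inordK.
have TE x z t s e : T.@[vals x z t s e] = t by rewrite mevalXU /vals inordK.
have SE x z t s e : S.@[vals x z t s e] = s by rewrite mevalXU /vals inordK.
have EE x z t s e : E.@[vals x z t s e] = e by rewrite mevalXU /vals inordK.
elim/mpoly_alg_ind: f => [|k f g [N [P hP]] [M [Q hQ]]|f g [N [P hP]] [M [Q hQ]]|i].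
- by exists 0%N, 1 => *; rewrite !meval1 expr0 mulr1.
- exists (N + M)%N, (k *: (P * (X * Z * S) ^+ M) + Q * (X * Z * S) ^+ N) => x z t s e x0 z0 s0.
  rewrite !(mevalD, mevalB, mevalN, mevalZ, mevalXn, mevalM) XE ZE SE -hP // -hQ // exprD; ring.
- exists (N + M)%N, (P * Q) => x z t s e x0 z0 s0.
  by rewrite !mevalM -hP // -hQ // exprD; ring.
have [k hk <-] := sg_surj hbeta i; case: (boolP (k \in SS)) => [|kS]; last first.
  exists 0%N, 0 => x z t s e _ _ _; rewrite mevalXU ptE // along_supp_out //.
  by rewrite mul0r meval0.
rewrite !inE => kS; exists 2%N.
case/or4P: kS => [||| /orP[]] /eqP ->.
- exists (X * (X * Z * S) ^+ 2) => x z t s e x0 z0 s0.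
  by rewrite mevalXU ptE // !(mevalD, mevalB, mevalN, mevalZ, mevalXn, mevalM) XE ZE SE.
- exists (- (X * Z ^+ 3 * S ^+ 2)) => x z t s e x0 z0 s0.
  rewrite mevalXU ptE // !(mevalD, mevalB, mevalN, mevalZ, mevalXn, mevalM) XE ZE SE /along_supp /=; field.
  by rewrite ?x0 ?z0 ?s0.
- exists (- 2^-1 *: (X * Z * S ^+ 3)) => x z t s e x0 z0 s0.
  rewrite mevalXU ptE // !(mevalD, mevalB, mevalN, mevalZ, mevalXn, mevalM) XE ZE SE /along_supp /=; field.
  by rewrite ?x0 ?z0 ?s0.
- exists (288^-1 *: ((24 *: (X ^+ 2 * E) - T ^+ 2) * X * Z ^+ 2 * S)) => x z t s e x0 z0 s0.
  rewrite mevalXU ptE // !(mevalD, mevalB, mevalN, mevalZ, mevalXn, mevalM) XE ZE SE TE EE.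
  by rewrite /along_supp /=; field; rewrite ?x0 ?z0 ?s0.
- exists (12^-1 *: (T * Z ^+ 2 * S ^+ 2)) => x z t s e x0 z0 s0.
  rewrite mevalXU ptE // !(mevalD, mevalB, mevalN, mevalZ, mevalXn, mevalM) TE ZE SE /along_supp /=; field.
  by rewrite ?x0 ?z0 ?s0.
Qed.

(** Where x1, zeta1 and sigma do not vanish, the unipotent group moves every
    point to a normal form: the pivots x1, then zeta1 / x1, then
    sigma / (x1 zeta1) clear 27, 16 and 8 coordinates. *)
Lemma reach_nf (p : 'I_56 -> K) :
  x1.@[p] != 0 -> zeta1.@[p] != 0 -> sigma.@[p] != 0 ->
  exists2 q, reachable beta p q &
    forall k, (k < 56)%N -> k \notin SS -> q (sg k) = 0.
Proof.
move=> px pz ps.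
have p0 : p (sg 0) != 0 by move: px; rewrite /x1 mevalXU sg0.
have pZ k : k \in ([::] : seq nat) -> p (sg k) = 0 by [].
have [q1 r1 h1'] := reach_clear hbeta (isT : (0 < 56)%N) clear_x1 p0 pZ.
have h1 k : k \in T1 -> q1 (sg k) = 0 by move=> kT; apply: h1'; rewrite kT orbT.
have z1 : zeta1.@[q1] = zeta1.@[p] by apply/r1/(upkilled_ev K hbeta zeta_check).
have q1b : q1 (sg 18) != 0.
  apply: contra pz => /eqP e; rewrite -z1 (meval_ev_supp (S := [seq k <- iota 0 56 | k \notin T1])).
  - rewrite (_ : [seq _ <- _ | _] = [:: (-1, [:: 0; 18]%N)]); last by vm_compute.
    by rewrite !big_cons !big_nil /= e !(mulr0, mul0r) addr0.
  - exact: zeta_v.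
  - move=> k hk; have hi : k \in iota 0 56 by rewrite mem_iota.
    by rewrite mem_filter hi andbT negbK; exact: h1.
have [q2 r2 h2] := reach_clear hbeta (isT : (18 < 56)%N) clear_zeta1 q1b h1.
have z2 : sigma.@[q2] = sigma.@[p].
  have us := upkilled_ev K hbeta sigma_check.
  by rewrite (r2 _ us) (r1 _ us).
have q2b : q2 (sg 40) != 0.
  apply: contra ps => /eqP e.
  rewrite -z2 (meval_ev_supp (S := [seq k <- iota 0 56 | k \notin T1 ++ T2])).
  - rewrite (_ : [seq _ <- _ | _] = [:: (2, [:: 0; 0; 18; 40]%N)]); last by vm_compute.
    by rewrite !big_cons !big_nil /= e !(mulr0, mul0r) addr0.
  - exact: sigma_v.
  - move=> k hk; have hi : k \in iota 0 56 by rewrite mem_iota.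
    by rewrite mem_filter hi andbT negbK mem_cat; exact: h2.
have q2Z k : k \in T1 ++ T2 -> q2 (sg k) = 0 by rewrite mem_cat; exact: h2.
have [q3 r3 h3] := reach_clear hbeta (isT : (40 < 56)%N) clear_sigma q2b q2Z.
exists q3 => [f hf|k hk kS]; first by rewrite (r3 f hf) (r2 f hf) (r1 f hf).
by apply: h3; exact: targets_cover.
Qed.

(** The points where x1 zeta1 sigma does not vanish are dense, and there f and the
    generators may be evaluated at the normal form. *)
Lemma upkilled_rational f : upkilled beta f ->
  exists N (Q : {mpoly K[5]}), f * (x1 * zeta1 * sigma) ^+ N = Q \mPo gens.
Proof.
move=> hf; have [N [Q hQ]] := clear_denominators f; exists N, Q.
apply/eqP; rewrite -subr_eq0; apply/eqP.
apply: (mpoly_vanish_open (d := x1 * zeta1 * sigma)).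
  have g0 := gen_neq0 ord0; have g1 := gen_neq0 (inord 1); have g3 := gen_neq0 (inord 3).
  move: g1 g3 g0; rewrite !(tnth_nth 0) !inordK //= => g1 g3 g0.
  by rewrite !mulf_neq0.
move=> p; rewrite !mevalM !mulf_eq0 !negb_or => /andP[/andP[px pz] ps].
have [q rq hq] := reach_nf px pz ps.
pose v i := (tnth gens i).@[p].
have nzx : q (sg 0) = x1.@[p] by rewrite -(rq x1 x1_upkilled) mevalXU sg0.
have qE P : pvalid P -> highest_check P -> (ev K beta P).@[p] =
  \sum_(t <- [seq t <- P | all (mem SS) t.2]) (t.1)%:~R * \prod_(k <- t.2) q (sg k).
  by move=> vP hP; rewrite -(rq _ (upkilled_ev K hbeta hP)); exact: meval_ev_supp.
have zE : zeta1.@[p] = - (q (sg 0) * q (sg 18)).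
  rewrite qE ?zeta_check ?zeta_v //.
  rewrite (_ : [seq _ <- _ | _] = [:: (-1, [:: 0; 18]%N)]); last by vm_compute.
  by rewrite !big_cons !big_nil /=; ring.
have tE : theta.@[p] = 12 * (q (sg 0) ^+ 2 * q (sg 55)).
  rewrite qE ?theta_check ?theta_v //.
  rewrite (_ : [seq _ <- _ | _] = [:: (12, [:: 0; 0; 55]%N)]); last by vm_compute.
  by rewrite !big_cons !big_nil /=; ring.
have sE : sigma.@[p] = 2 * (q (sg 0) ^+ 2 * q (sg 18) * q (sg 40)).
  rewrite qE ?sigma_check ?sigma_v //.
  rewrite (_ : [seq _ <- _ | _] = [:: (2, [:: 0; 0; 18; 40]%N)]); last by vm_compute.
  by rewrite !big_cons !big_nil /=; ring.
have eE : eta.@[p] = 6 * (q (sg 0) ^+ 2 * q (sg 55) ^+ 2)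
   + 24 * (q (sg 0) * q (sg 18) * q (sg 40) * q (sg 54)).
  rewrite qE ?eta_check ?eta_v //.
  rewrite (_ : [seq _ <- _ | _] = [:: (6, [:: 0; 0; 55; 55]%N); (24, [:: 0; 18; 40; 54]%N)]);
    last by vm_compute.
  by rewrite !big_cons !big_nil /=; ring.
rewrite mevalB !rmorphM rmorphXn /= !rmorphM /=.
have eq_nf : f.@[p] =
  f.@[pt (along_supp SS (nf x1.@[p] zeta1.@[p] theta.@[p] sigma.@[p] eta.@[p]))].
  rewrite -(rq f hf); apply: meval_eq => i; have [k hk <-] := sg_surj hbeta i.
  rewrite ptE //; case: (boolP (k \in SS)) => kS; last by rewrite hq // along_supp_out.
  have x0 : q (sg 0) != 0 by rewrite nzx.
  have q18 : q (sg 18) != 0 by apply: contra pz => /eqP h; rewrite zE h mulr0 oppr0.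
  have q40 : q (sg 40) != 0 by apply: contra ps => /eqP h; rewrite sE h !mulr0.
  rewrite -nzx zE tE sE eE; move: kS; rewrite !inE.
  case/or4P => [||| /orP[]] /eqP ->; rewrite /along_supp //=; field;
    by rewrite ?x0 ?q18 ?q40.
rewrite {1}eq_nf hQ // (gens_meval Q (v := vals x1.@[p] zeta1.@[p] theta.@[p] sigma.@[p] eta.@[p])).
  by rewrite subrr.
by move=> i; rewrite (tnth_nth 0); case: i => -[|[|[|[|[|//]]]]].
Qed.

(** If a generator g divides a polynomial in the generators then it divides it
    inside the algebra of the generators, because the other four can still take
    arbitrary nonzero values where g vanishes. *)
Lemma gens_divide (i : 'I_5) f (Q : {mpoly K[5]}) :
  (forall v : 'I_5 -> K, v i = 0 -> (forall j, j != i -> v j != 0) ->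
     exists c, forall j, (tnth gens j).@[pt c] = v j) ->
  tnth gens i * f = Q \mPo gens -> exists Q', f = Q' \mPo gens.
Proof.
move=> cov e; have [v vi vj|Q' eQ] := mpolyX_dvd (i := i) (Q := Q).
  have [c hc] := cov v vi vj.
  by rewrite -(gens_meval Q hc) -e mevalM hc vi mul0r.
exists Q'; apply: (mulfI (gen_neq0 i)); rewrite e eQ rmorphM /= comp_mpolyXU.
by rewrite -tnth_nth.
Qed.

Lemma gens_divide_x1 f (Q : {mpoly K[5]}) :
  x1 * f = Q \mPo gens -> exists Q', f = Q' \mPo gens.
Proof.
apply: (gens_divide (i := ord0)) => v v0 vj.
have [||||c hc] := x1_cover (z := v (inord 1)) (t := v (inord 2)) (s := v (inord 3)) (e := v (inord 4));
  try by apply: vj; rewrite -val_eqE /= inordK.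
by exists c => j; rewrite hc [RHS]valsE v0.
Qed.

Lemma gens_divide_zeta1 f (Q : {mpoly K[5]}) :
  zeta1 * f = Q \mPo gens -> exists Q', f = Q' \mPo gens.
Proof.
rewrite (_ : zeta1 = tnth gens (inord 1)); last by rewrite (tnth_nth 0) inordK.
apply: gens_divide => v v0 vj.
have [||c hc] := zeta1_cover (v (inord 2)) (v (inord 4)) (x := v ord0) (s := v (inord 3)).
- by apply: vj; rewrite -val_eqE /= inordK.
- by apply: vj; rewrite -val_eqE /= !inordK.
by exists c => j; rewrite hc [RHS]valsE v0.
Qed.

Lemma gens_divide_sigma f (Q : {mpoly K[5]}) :
  sigma * f = Q \mPo gens -> exists Q', f = Q' \mPo gens.
Proof.
rewrite (_ : sigma = tnth gens (inord 3)); last by rewrite (tnth_nth 0) inordK.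
apply: gens_divide => v v0 vj.
have [||c hc] := sigma_cover (v (inord 2)) (v (inord 4)) (x := v ord0) (z := v (inord 1)).
- by apply: vj; rewrite -val_eqE /= inordK.
- by apply: vj; rewrite -val_eqE /= !inordK.
by exists c => j; rewrite hc [RHS]valsE v0.
Qed.

Theorem upkilled_gens f : upkilled beta f -> exists Q : {mpoly K[5]}, f = Q \mPo gens.
Proof.
move=> /upkilled_rational[N [Q]]; elim: N Q => [|N IH] Q.
  by rewrite expr0 mulr1 => ->; exists Q.
rewrite exprS => e; pose F := f * (x1 * zeta1 * sigma) ^+ N.
have [|Q1] := gens_divide_x1 (f := zeta1 * (sigma * F)) (Q := Q).
  by rewrite -e /F; ring.
by case/gens_divide_zeta1 => Q2 /gens_divide_sigma[Q3 /IH].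
Qed.

End Generators.

(** * Highest weight modules *)

Definition negroot (r : E8root) : E8root.
Proof.
exists (- val r); by rewrite formNl formNr opprK root_form.
Defined.

Lemma negroot_val r : val (negroot r) = - val r. Proof. by []. Qed.

Lemma inQ7_neg r : inQ7 r -> inQ7 (negroot r).
Proof. by rewrite /inQ7 negroot_val mxE oppr_eq0. Qed.

Lemma root_sign r : positive r \/ positive (negroot r).
Proof.
case: (root_pos_or_neg (root_form r)) => h; [left|right]; apply/forallP => i //.
by rewrite negroot_val mxE oppr_ge0.
Qed.

Section Module.
Variables (K : fieldType) (M : lmodType K) (rho : E8alg K -> M -> M).
Hypothesis mod_rho : is_E7module rho.
Implicit Types (h : 'rV[K]_8) (x y z : E8alg K) (r s : E8root) (u v : M).

Lemma rhoP x k u v : inE7 x -> rho x (k *: u + v) = k *: rho x u + rho x v.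
Proof. by case: mod_rho => H _ _ hx; exact: H. Qed.

Lemma rhoPl x y k v : inE7 x -> inE7 y -> rho (k *: x + y) v = k *: rho x v + rho y v.
Proof. by case: mod_rho => _ H _ hx hy; exact: H. Qed.

Lemma rho_bracket x y v : inE7 x -> inE7 y ->
  rho (bracket x y) v = rho x (rho y v) - rho y (rho x v).
Proof. by case: mod_rho => _ _ H hx hy; exact: H. Qed.

Lemma rho0 x : inE7 x -> rho x 0 = 0.
Proof. by move=> hx; have := rhoP (-1) 0 0 hx; rewrite scaler0 addr0 scaleN1r addNr. Qed.

Lemma rhoZ x k u : inE7 x -> rho x (k *: u) = k *: rho x u.
Proof. by move=> hx; rewrite -[_ *: u]addr0 rhoP // rho0 // addr0. Qed.

Lemma rhoD x u v : inE7 x -> rho x (u + v) = rho x u + rho x v.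
Proof. by move=> hx; rewrite -[u]scale1r rhoP // !scale1r. Qed.

Lemma rho0l v : rho 0 v = 0.
Proof.
by have := rhoPl (-1) v (inE7_0 K) (inE7_0 K); rewrite scaler0 addr0 scaleN1r addNr.
Qed.

Lemma rhoZl x k v : inE7 x -> rho (k *: x) v = k *: rho x v.
Proof. by move=> hx; rewrite -[_ *: x]addr0 rhoPl ?inE7_0 // rho0l addr0. Qed.

Lemma rho_sum x (I : Type) (s : seq I) (P : pred I) (F : I -> M) : inE7 x ->
  rho x (\sum_(i <- s | P i) F i) = \sum_(i <- s | P i) rho x (F i).
Proof. by move=> hx; apply: (big_morph (rho x)) => [u v|]; rewrite ?rhoD ?rho0. Qed.

(** The span of the nonempty words in the negative root vectors applied to v. *)
Inductive below (v : M) : M -> Prop :=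
| below0 : below v 0
| belowP k u w : below v u -> below v w -> below v (k *: u + w)
| below1 r : inQ7 r -> positive (negroot r) -> below v (rho (Eel K r) v)
| belowS r u : inQ7 r -> positive (negroot r) -> below v u ->
    below v (rho (Eel K r) u).

Definition spanned v u := exists2 k, exists2 w, below v w & u = k *: v + w & True.

Lemma below_spanned v w : below v w -> spanned v w.
Proof. by move=> h; exists 0 => //; exists w => //; rewrite scale0r add0r. Qed.

Lemma spanned_refl v : spanned v v.
Proof. by exists 1 => //; exists 0; [exact: below0 | rewrite scale1r addr0]. Qed.

Lemma spannedP v k u w : spanned v u -> spanned v w -> spanned v (k *: u + w).
Proof.
case=> [a [u' hu ->] _] [b [w' hw ->] _]; exists (k * a + b) => //.
exists (k *: u' + w'); first exact: belowP.
by rewrite scalerDl !scalerDr scalerA addrACA.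
Qed.

Lemma generated_submod v : submodule rho (generated rho v).
Proof.
split=> [W [W0 _ _] _ //|k u w hu hw W hW Wv|x w hx hw W hW Wv].
  by case: (hW) => _ WP _; apply: WP; [exact: hu | exact: hw].
by case: (hW) => _ _ WE; apply: WE => //; exact: hw.
Qed.

Lemma generated_self v : generated rho v v. Proof. by move=> W. Qed.

Lemma below_neg v u r : inQ7 r -> positive (negroot r) -> spanned v u ->
  below v (rho (Eel K r) u).
Proof.
move=> hr nr [k [w hw ->] _]; rewrite rhoP ?inE7_E //; apply: belowP.
  exact: below1.
exact: belowS.
Qed.

Section Singular.
Variables (l : 'rV[K]_8) (v : M).
Hypothesis hv : singular_of_weight rho l v.

Lemma below_H h w : inH7 h -> below v w -> below v (rho (Hel h) w).
Proof.
case: hv => _ wv _ hh; have hH := inE7_H hh.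
have comm r u : inQ7 r -> rho (Hel h) (rho (Eel K r) u) =
    rho (Eel K r) (rho (Hel h) u) + form h (toH K (val r)) *: rho (Eel K r) u.
  move=> hr; have hE := inE7_E K hr.
  have := rho_bracket u hH hE; rewrite bracket_HE rhoZl // => ->.
  by rewrite addrC subrK.
elim=> [|k a b _ ha _ hb|r hr nr|r a hr nr ba ha].
- by rewrite rho0 //; exact: below0.
- by rewrite rhoP //; exact: belowP.
- rewrite comm // wv // rhoZ ?inE7_E // -scalerDl -[_ *: _]addr0.
  by apply: belowP; [exact: below1 | exact: below0].
- rewrite comm // addrC; apply: belowP; first exact: belowS.
  exact: belowS.
Qed.

Lemma spanned_H h w : inH7 h -> spanned v w -> spanned v (rho (Hel h) w).
Proof.
move=> hh [k [u hu ->] _]; rewrite rhoP ?inE7_H //; apply: spannedP.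
  case: hv => _ wv _; rewrite wv // -[_ *: _]addr0; apply: spannedP.
    exact: spanned_refl.
  exact/below_spanned/below0.
exact/below_spanned/below_H.
Qed.

(** Moving a positive root vector to the right through a word of negative ones
    produces shorter words, to which Cartan elements and root vectors of either
    sign are applied; at the end it annihilates v. *)
Lemma spanned_E_pos r w : inQ7 r -> positive r -> below v w ->
  spanned v (rho (Eel K r) w).
Proof.
move=> hr pr bw; elim: bw r hr pr => [|k a b _ ha _ hb|s hs ns|s a hs ns ba ha] r hr pr.
- rewrite rho0 ?inE7_E //; exact/below_spanned/below0.
- by rewrite rhoP ?inE7_E //; apply: spannedP; [exact: ha | exact: hb].
- have -> : rho (Eel K r) (rho (Eel K s) v) = rho (bracketE K r s) v.
    rewrite -bracket_EE rho_bracket ?inE7_E //.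
    by case: hv => _ _ kv; rewrite (kv r hr pr) rho0 ?subr0 ?inE7_E.
  have s0 := spanned_refl v.
  rewrite /bracketE; case: ifP => [_|_].
    by apply: spanned_H => //; rewrite /inH7 !mxE (eqP hr) oppr0.
  case: insubP => [c _ ec|_]; last by rewrite rho0l; exact/below_spanned/below0.
  have hc : inQ7 c by rewrite /inQ7 ec mxE (eqP hr) (eqP hs) addr0.
  rewrite rhoZl ?inE7_E // -[_ *: _]addr0; apply: spannedP; last exact/below_spanned/below0.
  case: (root_sign c) => pc; last exact/below_spanned/below1.
  by case: hv => _ _ ->; rewrite //; exact/below_spanned/below0.
- have -> : rho (Eel K r) (rho (Eel K s) a) =
      rho (Eel K s) (rho (Eel K r) a) + rho (bracketE K r s) a.
    by rewrite -bracket_EE rho_bracket ?inE7_E // addrC subrK.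
  rewrite -[rho (Eel K s) _]scale1r; apply: spannedP.
    by apply/below_spanned/below_neg => //; exact: ha.
  rewrite /bracketE; case: ifP => [_|_].
    by apply/below_spanned/below_H; rewrite // /inH7 !mxE (eqP hr) oppr0.
  case: insubP => [c _ ec|_]; last by rewrite rho0l; exact/below_spanned/below0.
  have hc : inQ7 c by rewrite /inQ7 ec mxE (eqP hr) (eqP hs) addr0.
  rewrite rhoZl ?inE7_E // -[_ *: _]addr0; apply: spannedP; last exact/below_spanned/below0.
  by case: (root_sign c) => pc; [exact: ha | exact/below_spanned/belowS].
Qed.

Lemma spanned_submod : submodule rho (spanned v).
Proof.
split=> [|k u w|]; first exact/below_spanned/below0.
  exact: spannedP.
move=> x w hx; move: x hx w; apply: E7_ind.
- by move=> w _; rewrite rho0l; exact/below_spanned/below0.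
- move=> k x y hx hy IHx IHy w sw; rewrite rhoPl //.
  by apply: spannedP; [exact: IHx | exact: IHy].
- by move=> h hh w; exact: spanned_H.
- move=> r hr w sw; case: (root_sign r) => pr; last exact/below_spanned/below_neg.
  case: sw => k [u hu ->] _; rewrite rhoP ?inE7_E //; apply: spannedP.
    by case: hv => _ _ ->; rewrite //; exact/below_spanned/below0.
  exact: spanned_E_pos.
Qed.

Lemma generated_spanned w : generated rho v w -> spanned v w.
Proof. by apply; [exact: spanned_submod | exact: spanned_refl]. Qed.

End Singular.
End Module.

(** * The action on polynomials *)

Section Action.
Variables (K : numClosedFieldType) (beta : 'I_56 -> E8root).
Hypothesis hbeta : is_basis_enum beta.
Implicit Types (f g : {mpoly K[56]}) (r s : E8root) (x y : E8alg K) (h : 'rV[K]_8).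

Local Notation act := (@actA K beta).

Lemma actA_module : is_E7module act.
Proof.
split=> [x _ k u v|x y _ _ k v|x y hx hy v].
- exact: (act_deriv beta x).1.
- exact: actA_P.
- exact: actA_bracket.
Qed.

Lemma Fsign_conj (a b : 'rV[int]_8) : (Fsign K a b)^* = Fsign K a b.
Proof.
rewrite FsignE; case: (Fexp a b) => n; first by rewrite -exprnP rmorphXn rmorphN1.
by rewrite NegzE signzN -exprnP rmorphXn rmorphN1.
Qed.

Lemma adV_E_adjoint r :
  (map_mx Num.conj (adV beta (Eel K r)))^T = - adV beta (Eel K (negroot r)).
Proof.
apply/matrixP => i j; rewrite mxE [LHS]mxE [RHS]mxE !adV_E // negroot_val.
have -> : (val (beta i) == - val r + val (beta j)) = (val (beta j) == val r + val (beta i)).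
  by rewrite -[in RHS](inj_eq (addrI (- val r))) addKr eq_sym.
case: eqP => [e|]; last by rewrite conjC0 oppr0.
by rewrite e FsignNl FsignDr Fsign_diag ?root_form // mulN1r opprK Fsign_conj.
Qed.

Lemma herm_E r f g : herm (act (Eel K r) f) g = - herm f (act (Eel K (negroot r)) g).
Proof.
rewrite -[LHS]/(herm (linfield _ _) _) herm_linfield adV_E_adjoint.
have := linfield_P (-1) (adV beta (Eel K (negroot r))) 0 g.
rewrite scaleN1r addr0 => ->.
have := linfield_P (-1) (0 : 'M[K]_56) 0 g; rewrite scaler0 addr0 scaleN1r addNr => ->.
by rewrite addr0 scaleN1r -scaleN1r hermZr rmorphN1 mulN1r.
Qed.

(** The complex conjugation that fixes the simple roots. *)
Definition conjH h : 'rV[K]_8 := map_mx Num.conj h.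

Lemma form_conjH h (a : 'rV[int]_8) : form (conjH h) (toH K a) = (form h (toH K a))^*.
Proof.
rewrite /form rmorph_sum; apply: eq_bigr => i _; rewrite rmorph_sum; apply: eq_bigr => j _.
by rewrite !mxE !rmorphM /= !rmorph_int.
Qed.

Lemma herm_H h f g : herm (act (Hel h) f) g = herm f (act (Hel (conjH h)) g).
Proof.
rewrite -[LHS]/(herm (linfield _ _) _) herm_linfield; congr (herm _ (linfield _ _)).
rewrite !adV_Hdiag // map_diag_mx tr_diag_mx; congr diag_mx.
by apply/rowP => j; rewrite !mxE form_conjH.
Qed.

Lemma E7_adjoint x : inE7 x ->
  exists2 y, inE7 y & forall f g, herm (act x f) g = herm f (act y g).
Proof.
move: x; apply: E7_ind.
- exists 0 => [|f g]; first exact: inE7_0.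
  by rewrite !actA_0 herm0l herm0r.
- move=> k x y _ _ [x' hx ex] [y' hy ey]; exists (k^* *: x' + y'); first exact: inE7_P.
  by move=> f g; rewrite !actA_P hermPl hermDr hermZr conjCK ex ey.
- move=> h hh; exists (Hel (conjH h)); last exact: herm_H.
  by apply: inE7_H; rewrite /inH7 mxE (eqP hh) conjC0.
- move=> r hr; exists (-1 *: Eel K (negroot r)).
    by rewrite -[_ *: _]addr0; apply: inE7_P; [exact/inE7_E/inQ7_neg | exact: inE7_0].
  by move=> f g; rewrite herm_E actA_Z hermZr rmorphN1 mulN1r.
Qed.

Lemma herm_below v w g : below act v w -> upkilled beta g -> herm w g = 0.
Proof.
move=> hw hg; elim: hw => [|k a b _ ha _ hb|r hr nr|r a hr nr _ ha].
- exact: herm0l.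
- by rewrite hermPl ha hb mulr0 addr0.
- by rewrite herm_E hg ?herm0r ?oppr0 //; exact: inQ7_neg.
- by rewrite herm_E hg ?herm0r ?oppr0 //; exact: inQ7_neg.
Qed.

(** The words of positive length are orthogonal to everything the positive root
    vectors annihilate. *)
Lemma generated_upkilled l v u : singular_of_weight act l v ->
  generated act v u -> upkilled beta u -> exists k, u = k *: v.
Proof.
move=> hv /(generated_spanned actA_module hv)[k [w hw e] _] hu; exists k.
suff w0 : w = 0 by rewrite e w0 addr0.
apply: herm_eq0; apply: (herm_below hw) => r hr pr.
have -> : w = -k *: v + u by rewrite e scaleNr addKr.
rewrite (act_deriv beta _).1 hu // addr0.
by case: hv => _ _ ->; rewrite // scaler0.
Qed.

(** Root vectors of positive roots raise the height, which is bounded in each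
    degree, so they act nilpotently. *)
Definition ht (i : 'I_56) : nat := absz (\sum_k val (beta i) 0 k)%R.
Definition htm (m : 'X_{1..56}) : nat := \sum_i m i * ht i.
Definition higher k f := {in msupp f, forall m, (k <= htm m)%N}.

Lemma beta_pos i k : 0 <= val (beta i) 0 k.
Proof.
by case: hbeta => _ H _; have [/forallP + _] := (H (beta i)).1 (ex_intro _ i erefl); exact.
Qed.

Lemma ht_lt r i j : positive r -> val (beta i) = val r + val (beta j) -> (ht j < ht i)%N.
Proof.
move=> /forallP pr e; rewrite /ht.
have -> : (\sum_k val (beta i) 0 k)%R = (\sum_k val r 0 k)%R + (\sum_k val (beta j) 0 k)%R.
  by rewrite e -big_split; apply: eq_bigr => k _; rewrite mxE.
have hj : 0 <= (\sum_k val (beta j) 0 k)%R by apply: sumr_ge0 => k _; exact: beta_pos.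
have hr : 0 < (\sum_k val r 0 k)%R.
  rewrite lt_def sumr_ge0 ?andbT => [|k _]; last exact: pr.
  rewrite psumr_eq0 => [|k _]; last exact: pr.
  apply/negP => /allP h0; have := root_form r.
  suff -> : val r = 0 by rewrite form0l.
  by apply/rowP => k; rewrite mxE; apply/eqP; apply: h0; rewrite mem_index_enum.
by move: hj hr; move: (\sum_k val r 0 k)%R (\sum_k val (beta j) 0 k)%R => a b; lia.
Qed.

Lemma htmD m n : htm (m + n) = (htm m + htm n)%N.
Proof. by rewrite /htm -big_split; apply: eq_bigr => i _; rewrite mnmDE mulnDl. Qed.

Lemma htmU i : htm U_(i) = ht i.
Proof.
rewrite /htm (bigD1 i) //= big1 => [|j nj]; first by rewrite mnm1E eqxx mul1n addn0.
by rewrite mnm1E eq_sym (negbTE nj).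
Qed.

Lemma higherP k c f g : higher k f -> higher k g -> higher k (c *: f + g).
Proof.
move=> hf hg m /msuppD_le; rewrite mem_cat => /orP[/msuppZ_le/hf //|/hg //].
Qed.

Lemma higher_sum k (I : Type) (s : seq I) (P : pred I) (F : I -> {mpoly K[56]}) :
  (forall i, P i -> higher k (F i)) -> higher k (\sum_(i <- s | P i) F i).
Proof.
move=> h; apply: big_ind => [m|f g hf hg|i /h //]; first by rewrite msupp0.
by rewrite -[f]scale1r; apply: higherP.
Qed.

Lemma higherZ k c f : higher k f -> higher k (c *: f).
Proof. by move=> hf m /msuppZ_le/hf. Qed.

Lemma higher_act k r f : positive r -> higher k f -> higher k.+1 (act (Eel K r) f).
Proof.
move=> pr hf; rewrite [f]mpolyE (derivation_sum _ _ _ (act_deriv beta _)) big_seq.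
apply: higher_sum => m /hf hm; rewrite (derivationZ _ _ (act_deriv beta _)); apply: higherZ.
apply: higher_sum => i _; apply: higher_sum => j _; rewrite adV_E //.
case: eqP => [e|_]; last by rewrite scale0r => n; rewrite msupp0.
rewrite mderivX -scalerAr; apply: higherZ.
case: (eqVneq (m j) 0%N) => [->|mj]; first by rewrite scale0r => n; rewrite msupp0.
apply: higherZ; rewrite -mpolyXD => n; rewrite msuppX inE => /eqP ->.
rewrite htmD htmU; have := ht_lt pr e.
have : htm m = (htm (m - U_(j)) + ht j)%N by rewrite -htmU -htmD submK // lep1mP.
by move: hm; lia.
Qed.

Lemma linfield_homog (M : 'M[K]_56) d f : f \is d.-homog -> linfield M f \is d.-homog.
Proof.
move=> hf; rewrite [f]mpolyE (derivation_sum _ _ _ (linfield_deriv M)) big_seq.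
apply: rpred_sum => m hm; rewrite (derivationZ _ _ (linfield_deriv M)) rpredZ //.
apply: rpred_sum => i _; apply: rpred_sum => j _; rewrite rpredZ // mderivX -scalerAr.
case: (eqVneq (m j) 0%N) => [->|mj]; first by rewrite scale0r rpred0.
have hX : 'X_[K, U_(i) + (m - U_(j))] \is d.-homog.
  have e : mdeg m = d := dhomog_mf hf hm.
  have := mdegD (m - U_(j)) U_(j); rewrite submK ?lep1mP // mdeg1 addn1 => em.
  by rewrite dhomogX /= mdegD mdeg1 add1n -em e.
by rewrite -mpolyXD; exact: dhomogZ.
Qed.

Definition htmax : nat := \max_i ht i.

Lemma higher_homog d k f : f \is d.-homog -> higher k f -> (d * htmax < k)%N -> f = 0.
Proof.
move=> hf hk dk; apply: msuppnil0; case E: (msupp f) => [//|m s].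
have hm : m \in msupp f by rewrite E inE eqxx.
have e : mdeg m = d := dhomog_mf hf hm.
have := leq_trans dk (hk m hm); rewrite -e mdegE big_distrl /= ltnNge.
by rewrite leq_sum // => i _; rewrite leq_mul2l leq_bigmax orbT.
Qed.

(** Apply positive root vectors to a nonzero member of the class as long as the
    result is nonzero; this ends because the height is bounded. Families indexed
    by s are needed to raise linear relations, a single polynomial is [raise1]. *)
Lemma raise (I : eqType) (s : seq I) (d : I -> nat) (Q : (I -> {mpoly K[56]}) -> Prop) :
  (forall (g : I -> _) r, Q g -> inQ7 r -> positive r -> Q (fun i => act (Eel K r) (g i))) ->
  (forall (g : I -> _) i, Q g -> i \in s -> g i \is (d i).-homog) ->
  forall g : I -> _, Q g -> (exists2 i, i \in s & g i != 0) ->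
  exists2 g' : I -> _, Q g' & (exists2 i, i \in s & g' i != 0) /\
    forall i, i \in s -> upkilled beta (g' i).
Proof.
move=> Qa Qd; pose B := (\max_(i <- s) d i * htmax).+1.
suff gen n : forall g : I -> _, Q g -> (exists2 i, i \in s & g i != 0) ->
    (forall i, i \in s -> higher (B - n) (g i)) ->
    exists2 g' : I -> _, Q g' & (exists2 i, i \in s & g' i != 0) /\
      forall i, i \in s -> upkilled beta (g' i).
  by move=> g Qg gn; apply: (gen B g Qg gn) => i _ m _; rewrite subnn.
elim: n => [|n IH] g Qg [i0 i0s gi0] hg.
  case/eqP: gi0; apply: (higher_homog (Qd g i0 Qg i0s) (hg i0 i0s)).
  rewrite subn0 /B ltnS; apply: (leq_trans (leqnn _)).
  by rewrite (big_rem i0) //= leq_maxl.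
case: (Classical_Prop.classic (exists2 i, i \in s & exists2 r, inQ7 r &
    positive r /\ act (Eel K r) (g i) != 0)) => [[i is_ [r hr [pr nr]]]|no].
  apply: (IH (fun i => act (Eel K r) (g i))); [exact: Qa | by exists i|].
  move=> j js m /(higher_act pr (hg j js)); apply: leq_trans; lia.
exists g => //; split; first by exists i0.
move=> i is_ r hr pr; apply/eqP/negPn/negP => nr; apply: no.
by exists i => //; exists r.
Qed.

Lemma raise1 d (W : {mpoly K[56]} -> Prop) :
  (forall f r, W f -> inQ7 r -> positive r -> W (act (Eel K r) f)) ->
  (forall f, W f -> f \is d.-homog) ->
  forall f, W f -> f != 0 -> exists2 g, W g & g != 0 /\ upkilled beta g.
Proof.
move=> Wa Wd f Wf fn.
have [||||g Wg [[[] _ gn] gu]] :=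
  @raise unit [:: tt] (fun _ => d) (fun g : unit -> _ => W (g tt)) _ _ (fun _ => f).
- by move=> g r Wg; exact: Wa.
- by move=> g [] /Wd.
- exact: Wf.
- by exists tt.
by exists (g tt) => //; split => //; apply: gu.
Qed.

Lemma generated_homog d v u : v \is d.-homog -> generated act v u -> u \is d.-homog.
Proof.
move=> hv hu; apply: (hu (fun p : {mpoly K[56]} => p \is d.-homog)) => //.
split=> [|k f g hf hg|x f _ hf]; first exact: rpred0.
  by rewrite rpredD // rpredZ.
exact: linfield_homog.
Qed.

(** A nonzero submodule contains a nonzero covariant, which is a multiple of the
    generator v. *)
Lemma generated_irreducible d l v : v \is d.-homog -> singular_of_weight act l v ->
  irreducible act (generated act v).
Proof.
move=> dv hv; split; first exact: generated_submod.
  by exists v; [exact: generated_self | case: hv].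
move=> W [W0 WP WE] sub.
case: (Classical_Prop.classic (exists2 w, W w & w != 0)) => [[w Ww wn]|no]; last first.
  left=> w Ww; apply/eqP/negPn/negP => wn; apply: no; by exists w.
right; have [f r Wf hr _|f Wf|g Wg [gn gu]] := @raise1 d W _ _ w Ww wn.
- by apply: WE => //; exact: inE7_E.
- exact: generated_homog dv (sub f Wf).
have [k ek] := generated_upkilled hv (sub g Wg) gu.
have kn : k != 0 by apply: contra gn => /eqP k0; rewrite ek k0 scale0r.
have Wv : W v.
  have -> : v = k^-1 *: g + 0 by rewrite addr0 ek scalerA mulVf // scale1r.
  exact: WP.
by move=> u hu; apply: hu.
Qed.

Lemma has_weight_mul l m f g : has_weight act l f -> has_weight act m g ->
  has_weight act (l + m) (f * g).
Proof.
move=> hf hg h hh; rewrite (act_deriv beta _).2 hf // hg //.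
by rewrite -scalerAl -scalerAr -scalerDl -formDr.
Qed.

Lemma has_weight1 : has_weight act 0 1.
Proof.
by move=> h _; rewrite (derivation1 (act_deriv beta _)) form0r scale0r.
Qed.

Lemma has_weight_exp l f n : has_weight act l f -> has_weight act (l *+ n) (f ^+ n).
Proof.
move=> hf; elim: n => [|n IH]; first exact: has_weight1.
by rewrite mulrS exprS; exact: has_weight_mul.
Qed.

Lemma upkilled_mul f g : upkilled beta f -> upkilled beta g -> upkilled beta (f * g).
Proof.
by move=> hf hg r hr pr; rewrite (act_deriv beta _).2 hf // hg // mul0r mulr0 addr0.
Qed.

Lemma upkilled_exp f n : upkilled beta f -> upkilled beta (f ^+ n).
Proof.
move=> hf; elim: n => [|n IH].
  by move=> r _ _; exact: derivation1 (act_deriv beta _).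
by rewrite exprS; exact: upkilled_mul.
Qed.

(** The Cartan elements with real coordinates are self-adjoint, so their
    eigenvectors for different real eigenvalues are orthogonal. *)
Lemma herm_weight l m f g (i : 'I_8) : (i < 7)%N ->
  has_weight act l f -> has_weight act m g ->
  (form (delta_mx 0 i) m)^* = form (delta_mx 0 i) m ->
  form (delta_mx 0 i) l != form (delta_mx 0 i) m -> herm f g = 0.
Proof.
move=> i7 hf hg hm lm; have hi : inH7 (delta_mx 0 i : 'rV[K]_8).
  rewrite /inH7 mxE eqxx /= (_ : (ord_max == i) = false) //.
  by apply/eqP => e; rewrite -e in i7.
have := herm_H (delta_mx 0 i) f g.
have -> : conjH (delta_mx 0 i) = delta_mx 0 i.
  by apply/rowP => j; rewrite !mxE rmorph_nat.
rewrite hf // hg // hermZl hermZr hm => /eqP; rewrite -subr_eq0 -mulrBl mulf_eq0.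
by rewrite subr_eq0 (negbTE lm) => /eqP.
Qed.

End Action.

(** * The decomposition of the polynomial algebra *)

(** The weight of a monomial. *)
Definition vsumw (m : mono) : vec := foldr (fun k s => vadd (w k) s) nul m.

(** The weights are compared through their products with the simple roots, and
    index 0 stands for weight 0. *)
Definition weight_check (i : nat) (p : pol) : bool :=
  all (fun t => all (fun j => vform (simple j) (vsumw t.2) == (j.+1 == i)%:R) (iota 0 7)) p.

Definition homog_check (d : nat) (p : pol) : bool := all (fun t => size t.2 == d) p.

Lemma zeta_wt : weight_check 1 zetaP && homog_check 2 zetaP. Proof. by vm_compute. Qed.
Lemma theta_wt : weight_check 7 thetaP && homog_check 3 thetaP. Proof. by vm_compute. Qed.
Lemma sigma_wt : weight_check 6 sigmaP && homog_check 4 sigmaP. Proof. by vm_compute. Qed.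
Lemma eta_wt : weight_check 0 etaP && homog_check 4 etaP. Proof. by vm_compute. Qed.

Section SumSubspaces.
Variables (K : fieldType) (M : lmodType K) (I : eqType) (W : I -> M -> Prop).
Hypothesis W0 : forall i, W i 0.
Hypothesis WP : forall i k u v, W i u -> W i v -> W i (k *: u + v).

Lemma sum_subspaces0 : sum_subspaces W 0.
Proof. by exists [::], (fun=> 0); split => //; rewrite big_nil. Qed.

Lemma sum_subspaces1 i v : W i v -> sum_subspaces W v.
Proof.
by move=> h; exists [:: i], (fun=> v); split => [//|j|]; rewrite ?big_seq1 // inE => /eqP ->.
Qed.

Lemma sum_subspacesP k u v : sum_subspaces W u -> sum_subspaces W v ->
  sum_subspaces W (k *: u + v).
Proof.
case=> [s [g [us hg ->]]] [t [f [ut hf ->]]].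
pose r := undup (s ++ t); pose z (x : seq I) (h : I -> M) i := if i \in x then h i else 0.
have ext (x : seq I) (h : I -> M) : uniq x -> {subset x <= r} ->
    \sum_(i <- x) h i = \sum_(i <- r) z x h i.
  move=> ux sub; rewrite /z -big_mkcond /= -[RHS]big_filter; apply: perm_big.
  apply: uniq_perm => //; first exact/filter_uniq/undup_uniq.
  by move=> i; rewrite mem_filter; case: (boolP (i \in x)) => //= /sub ->.
exists r, (fun i => k *: z s g i + z t f i); split; first exact: undup_uniq.
  move=> i _; apply: WP; rewrite /z; case: ifP => //; [exact: hg | exact: hf].
rewrite (ext s g us) ?(ext t f ut) => [|i hi|i hi].
- by rewrite scaler_sumr -big_split.
- by rewrite mem_undup mem_cat hi orbT.
- by rewrite mem_undup mem_cat hi.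
Qed.

End SumSubspaces.

Section VspaceOfPred.
Variables (K : fieldType) (V : vectType K) (S : V -> Prop).
Hypothesis S0 : S 0.
Hypothesis SP : forall k u v, S u -> S v -> S (k *: u + v).

(** Add vectors of S to a subspace contained in S until none is left. *)
Lemma vspace_of_pred : exists U : {vspace V}, forall v, v \in U <-> S v.
Proof.
suff gen n : forall U : {vspace V}, (forall v, v \in U -> S v) ->
    (\dim {: V} <= \dim U + n)%N -> exists U' : {vspace V}, forall v, v \in U' <-> S v.
  apply: (gen (\dim {: V}) 0%VS); last by rewrite leq_addl.
  by move=> v; rewrite memv0 => /eqP ->.
elim: n => [|n IH] U hU hd.
  exists U => v; split => [/hU //|_].
  have /eqP -> : (U == fullv) by rewrite eqEdim subvf -[\dim U]addn0.
  exact: memvf.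
case: (Classical_Prop.classic (exists2 v, S v & v \notin U)) => [[v Sv vU]|no].
  apply: (IH (U + <[v]>)%VS).
    move=> u /memv_addP[a /hU Sa [b /vlineP[k ->] ->]].
    by rewrite addrC; apply: SP.
  have : (\dim U < \dim (U + <[v]>))%N.
    rewrite ltnNge; apply: contra vU => hle.
    have /eqP -> : U == (U + <[v]>)%VS by rewrite eqEdim addvSl.
    by rewrite (subvP (addvSr _ _)) // memv_line.
  by move: hd; lia.
by exists U => v; split => [/hU //|Sv]; apply/negPn/negP => vU; apply: no; exists v.
Qed.

End VspaceOfPred.

#[local] Opaque zeta1 theta sigma eta.

Section Decomposition.
Variables (K : numClosedFieldType) (beta : 'I_56 -> E8root).
Hypothesis hbeta : is_basis_enum beta.
Variable lam : nat -> 'rV[K]_8.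
Hypothesis hlam : forall i : nat, (1 <= i <= 7)%N -> is_fundamental_weight i (lam i).
Implicit Types (f g : {mpoly K[56]}) (r s : E8root) (x y : E8alg K) (h : 'rV[K]_8).

Local Notation act := (@actA K beta).
Local Notation sg := (sg beta).
Local Notation x1 := (x1 K).
Local Notation zeta1 := (zeta1 K beta).
Local Notation theta := (theta K beta).
Local Notation sigma := (sigma K beta).
Local Notation eta := (eta K beta).
Local Notation gens := (gens K beta).

Lemma form_H7 h (u v : 'rV[K]_8) : inH7 h ->
  (forall j : 'I_8, (j < 7)%N -> form u (delta_mx 0 j) = form v (delta_mx 0 j)) ->
  form h u = form h v.
Proof.
move=> /eqP hh uv; rewrite formC (formC h) {1 2}[h]row_sum_delta !form_sumr.
apply: eq_bigr => j _; rewrite !formZr; case: (ltnP j 7) => hj; first by rewrite uv.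
have -> : j = ord_max by apply/val_inj/eqP; rewrite eqn_leq hj -ltnS ltn_ord.
by rewrite hh !mul0r.
Qed.

Lemma act_H_X h j : act (Hel h) 'X_j = form h (toH K (val (beta j))) *: 'X_j.
Proof.
rewrite -[LHS]/(linfield _ _) linfield_X (bigD1 j) //= big1 => [|i ni].
  by rewrite addr0 adV_H // eqxx.
by rewrite adV_H // (negbTE ni) scale0r.
Qed.

Lemma act_H_mev h m : all (fun k => k < 56)%N m ->
  act (Hel h) (mev K beta m) = form h (toH K (rowv (vsumw m))) *: mev K beta m.
Proof.
elim: m => [|k m IH] /=.
  rewrite mev_nil (derivation1 (act_deriv _ _)) (_ : toH K _ = 0) ?form0r ?scale0r //.
  by apply/rowP => i; rewrite !mxE nth_nseq if_same.
case/andP=> hk hm; rewrite mev_cons (act_deriv _ _).2 IH // act_H_X sgE //.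
by rewrite rowvD toHD formDr scalerDl scalerAl scalerAr.
Qed.

Lemma toH_simple (j : 'I_8) : toH K (rowv (simple j)) = delta_mx 0 j.
Proof. by rewrite rowv_simple_delta; apply/rowP => i; rewrite !mxE rmorph_nat. Qed.

Lemma ev_weight i p (l : 'rV[K]_8) : pvalid p -> weight_check i p ->
  (forall j : 'I_8, (j < 7)%N -> form l (delta_mx 0 j) = (j.+1 == i)%:R) ->
  has_weight act l (ev K beta p).
Proof.
move=> /allP vp /allP wp hl h hh.
rewrite /ev (derivation_sum _ _ _ (act_deriv _ _)) scaler_sumr big_seq [RHS]big_seq.
apply: eq_bigr => t ht; rewrite (derivationZ _ _ (act_deriv _ _)) act_H_mev; last exact: vp.
rewrite scalerA mulrC -scalerA; congr (_ *: _); apply: form_H7 => // j hj.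
rewrite hl // -toH_simple formC form_toH vformE.
have /allP /(_ (nat_of_ord j)) := wp t ht; rewrite mem_iota => /(_ hj) /eqP ->.
by rewrite rmorph_nat.
Qed.

Lemma lamE i (j : 'I_8) : (1 <= i <= 7)%N -> (j < 7)%N ->
  form (lam i) (delta_mx 0 j) = (j.+1 == i)%:R.
Proof. by move=> hi hj; have [_ ->] := hlam hi. Qed.

Lemma ev_homog d p : homog_check d p -> ev K beta p \is d.-homog.
Proof.
move=> /allP hd; rewrite /ev big_seq; apply: rpred_sum => t /hd /eqP <-.
apply: dhomogZ; rewrite /mev; elim: t.2 => [|k m IH]; first by rewrite big_nil dhomog1.
have hX : ('X_(sg k) : {mpoly K[56]}) \is 1.-homog by rewrite dhomogX /= mdeg1.
by rewrite big_cons; exact: (dhomogM hX IH).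
Qed.

Lemma x1_weight : has_weight act (lam 7) x1.
Proof.
rewrite (x1_ev K hbeta); apply: (ev_weight (i := 7)) => // j hj; exact: lamE.
Qed.
Lemma zeta1_weight : has_weight act (lam 1) zeta1.
Proof.
case/andP: zeta_wt => hw _.
apply: (ev_weight (i := 1) zeta_v hw) => j hj; exact: lamE.
Qed.
Lemma theta_weight : has_weight act (lam 7) theta.
Proof.
case/andP: theta_wt => hw _.
apply: (ev_weight (i := 7) theta_v hw) => j hj; exact: lamE.
Qed.
Lemma sigma_weight : has_weight act (lam 6) sigma.
Proof.
case/andP: sigma_wt => hw _.
apply: (ev_weight (i := 6) sigma_v hw) => j hj; exact: lamE.
Qed.
Lemma eta_weight : has_weight act 0 eta.
Proof.
case/andP: eta_wt => hw _.
apply: (ev_weight (i := 0) eta_v hw) => j hj; exact: form0l.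
Qed.

Lemma x1_homog : x1 \is 1.-homog. Proof. by rewrite dhomogX /= mdeg1. Qed.
Lemma zeta1_homog : zeta1 \is 2.-homog.
Proof. by case/andP: zeta_wt => _; exact: ev_homog. Qed.
Lemma theta_homog : theta \is 3.-homog.
Proof. by case/andP: theta_wt => _; exact: ev_homog. Qed.
Lemma sigma_homog : sigma \is 4.-homog.
Proof. by case/andP: sigma_wt => _; exact: ev_homog. Qed.
Lemma eta_homog : eta \is 4.-homog.
Proof. by case/andP: eta_wt => _; exact: ev_homog. Qed.

Lemma zeta1_upkilled : upkilled beta zeta1. Proof. exact: upkilled_ev zeta_check. Qed.
Lemma theta_upkilled : upkilled beta theta. Proof. exact: upkilled_ev theta_check. Qed.
Lemma sigma_upkilled : upkilled beta sigma. Proof. exact: upkilled_ev sigma_check. Qed.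
Lemma eta_upkilled : upkilled beta eta. Proof. exact: upkilled_ev eta_check. Qed.
Lemma x1_upk : upkilled beta x1. Proof. exact: x1_upkilled. Qed.

Lemma x1_neq0 : x1 != 0.
Proof. by have := gen_neq0 K hbeta ord0; rewrite (tnth_nth 0). Qed.
Lemma zeta1_neq0 : zeta1 != 0.
Proof. by have := gen_neq0 K hbeta (inord 1); rewrite (tnth_nth 0) inordK. Qed.
Lemma theta_neq0 : theta != 0.
Proof. by have := gen_neq0 K hbeta (inord 2); rewrite (tnth_nth 0) inordK. Qed.
Lemma sigma_neq0 : sigma != 0.
Proof. by have := gen_neq0 K hbeta (inord 3); rewrite (tnth_nth 0) inordK. Qed.
Lemma eta_neq0 : eta != 0.
Proof. by have := gen_neq0 K hbeta (inord 4); rewrite (tnth_nth 0) inordK. Qed.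

(** A singular vector v of weight 0 is invariant, for the square norm of
    E_{-a} v is the product of v with E_a E_{-a} v = [E_a, E_{-a}] v = 0. *)
Lemma eta_invariant : is_invariant act eta.
Proof.
have ke := eta_upkilled; have we := eta_weight.
move=> x; move: x; apply: E7_ind.
- exact: actA_0.
- by move=> k x y _ _ hx hy; rewrite actA_P hx hy scaler0 addr0.
- by move=> h hh; rewrite we // form0r scale0r.
- move=> r hr; case: (root_sign r) => pr; first exact: ke.
  apply: herm_eq0; rewrite herm_E //.
  have hn := inQ7_neg hr.
  have := actA_bracket hbeta eta (inE7_E K hn) (inE7_E K hr).
  rewrite (ke _ hn pr) (derivation0 (act_deriv _ _)) subr0 => <-.
  rewrite bracket_EE /bracketE negroot_val opprK eqxx we ?form0r ?scale0r ?herm0r ?oppr0 //.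
  by rewrite /inH7 !mxE (eqP hr) !oppr0.
Qed.

Local Notation idx := (nat * nat * nat * nat * nat)%type.

Definition mon (n : idx) : {mpoly K[56]} :=
  let: (n1, n2, n3, n4, n5) := n in
  zeta1 ^+ n1 * sigma ^+ n2 * x1 ^+ n3 * theta ^+ n4 * eta ^+ n5.
Definition wt (n : idx) : 'rV[K]_8 :=
  let: (n1, n2, n3, n4, n5) := n in
  lam 1%N *+ n1 + lam 6%N *+ n2 + lam 7%N *+ (n3 + n4).
Definition dg (n : idx) : nat :=
  let: (n1, n2, n3, n4, n5) := n in (2 * n1 + 4 * n2 + n3 + 3 * n4 + 4 * n5)%N.
(** The generators are ordered x1, zeta1, theta, sigma, eta in [gens], and
    zeta1, sigma, x1, theta, eta in [mon]. *)
Definition expo (n : idx) : 'X_{1..5} :=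
  let: (n1, n2, n3, n4, n5) := n in [multinom nth 0%N [:: n3; n1; n4; n2; n5] i | i < 5].
Definition index_of (m : 'X_{1..5}) : idx :=
  (m (inord 1), m (inord 3), m (inord 0), m (inord 2), m (inord 4)).
#[global] Arguments mon : simpl never.
#[global] Arguments wt : simpl never.
#[global] Arguments dg : simpl never.
#[global] Arguments index_of : simpl never.
Definition Lm (n : idx) := generated act (mon n).

Lemma index_ofK : cancel index_of expo.
Proof.
move=> m; apply/mnmP => i; rewrite mnmE /=.
by case: i => -[|[|[|[|[|//]]]]] hi /=; congr (m _); apply: val_inj; rewrite /= inordK.
Qed.

Lemma expoK : cancel expo index_of.
Proof. by move=> [[[[n1 n2] n3] n4] n5]; rewrite /index_of !mnmE !inordK. Qed.

Lemma mon_comp n : mon n = 'X_[expo n] \mPo gens.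
Proof.
case: n => [[[[n1 n2] n3] n4] n5]; rewrite comp_mpolyX !big_ord_recl big_ord0 mulr1.
rewrite /expo !mnmE !(tnth_nth 0) /= /mon; ring.
Qed.

Lemma comp_gensE (Q : {mpoly K[5]}) :
  Q \mPo gens = \sum_(m <- msupp Q) Q@_m *: mon (index_of m).
Proof.
rewrite [Q in LHS]mpolyE raddf_sum; apply: eq_bigr => m _.
by rewrite [LHS]comp_mpolyZ mon_comp index_ofK.
Qed.

Lemma mon_weight n : has_weight act (wt n) (mon n).
Proof.
case: n => [[[[n1 n2] n3] n4] n5]; rewrite /wt mulrnDr.
have -> : lam 1 *+ n1 + lam 6 *+ n2 + (lam 7 *+ n3 + lam 7 *+ n4) =
  lam 1 *+ n1 + lam 6 *+ n2 + lam 7 *+ n3 + lam 7 *+ n4 + 0 *+ n5.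
  by rewrite mul0rn addr0 !addrA.
have h1 := has_weight_exp n1 zeta1_weight; have h2 := has_weight_exp n2 sigma_weight.
have h3 := has_weight_exp n3 x1_weight; have h4 := has_weight_exp n4 theta_weight.
have h5 := has_weight_exp n5 eta_weight.
exact: (has_weight_mul (has_weight_mul (has_weight_mul (has_weight_mul h1 h2) h3) h4) h5).
Qed.

Lemma mon_upkilled n : upkilled beta (mon n).
Proof.
case: n => [[[[n1 n2] n3] n4] n5].
have h1 := upkilled_exp n1 zeta1_upkilled; have h2 := upkilled_exp n2 sigma_upkilled.
have h3 := upkilled_exp n3 x1_upk; have h4 := upkilled_exp n4 theta_upkilled.
have h5 := upkilled_exp n5 eta_upkilled.
exact: (upkilled_mul (upkilled_mul (upkilled_mul (upkilled_mul h1 h2) h3) h4) h5).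
Qed.

Lemma mon_neq0 n : mon n != 0.
Proof.
case: n => [[[[n1 n2] n3] n4] n5]; rewrite /mon !mulf_neq0 ?expf_neq0 //.
- exact: zeta1_neq0.
- exact: sigma_neq0.
- exact: x1_neq0.
- exact: theta_neq0.
- exact: eta_neq0.
Qed.

Lemma mon_homog n : mon n \is (dg n).-homog.
Proof.
case: n => [[[[n1 n2] n3] n4] n5]; rewrite /mon /dg.
have h1 := dhomogMn n1 zeta1_homog; have h2 := dhomogMn n2 sigma_homog.
have h3 := dhomogMn n3 x1_homog; have h4 := dhomogMn n4 theta_homog.
have h5 := dhomogMn n5 eta_homog; rewrite mul1n in h3.
exact: (dhomogM (dhomogM (dhomogM (dhomogM h1 h2) h3) h4) h5).
Qed.

Lemma mon_singular n : singular_of_weight act (wt n) (mon n).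
Proof. split; [exact: mon_neq0 | exact: mon_weight | exact: mon_upkilled]. Qed.

Lemma Lm_irreducible n : irreducible act (Lm n).
Proof. exact: generated_irreducible (mon_homog n) (mon_singular n). Qed.

Lemma Lm_submod n : submodule act (Lm n). Proof. exact: generated_submod. Qed.
Lemma Lm0 n : Lm n 0. Proof. by case: (Lm_submod n). Qed.
Lemma LmP n k f g : Lm n f -> Lm n g -> Lm n (k *: f + g).
Proof. by case: (Lm_submod n) => _ H _; exact: H. Qed.
Lemma Lm_act n x f : inE7 x -> Lm n f -> Lm n (act x f).
Proof. by case: (Lm_submod n) => _ _ H; exact: H. Qed.
Lemma Lm_homog n f : Lm n f -> f \is (dg n).-homog.
Proof. exact: generated_homog (mon_homog n). Qed.

Lemma mon_free (s : seq idx) (c : idx -> K) : uniq s ->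
  \sum_(i <- s) c i *: mon i = 0 -> forall i, i \in s -> c i = 0.
Proof.
move=> us e i is_; pose P : {mpoly K[5]} := \sum_(i <- s) c i *: 'X_[expo i].
have /(gens_indep hbeta) P0 : P \mPo gens = 0.
  rewrite -e /P raddf_sum; apply: eq_bigr => j _.
  by rewrite [LHS]comp_mpolyZ -mon_comp.
have := congr1 (mcoeff (expo i)) P0; rewrite mcoeff0 raddf_sum /= (bigD1_seq i) //= big1.
  by rewrite mcoeffZ mcoeffX eqxx mulr1 addr0.
move=> j ji; rewrite mcoeffZ mcoeffX (inj_eq (can_inj expoK)) (negbTE ji).
by rewrite mulr0.
Qed.

(** A nontrivial relation could be raised to one between singular vectors,
    that is between the products of the generators. *)
Lemma Lm_direct (s : seq idx) (g : idx -> {mpoly K[56]}) : uniq s ->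
  (forall i, i \in s -> Lm i (g i)) -> \sum_(i <- s) g i = 0 ->
  forall i, i \in s -> g i = 0.
Proof.
move=> us hg e i is_; apply/eqP/negPn/negP => gi.
pose Q (g : idx -> {mpoly K[56]}) := (forall i, i \in s -> Lm i (g i)) /\ \sum_(i <- s) g i = 0.
have Qa (f : idx -> _) r : Q f -> inQ7 r -> positive r -> Q (fun i => act (Eel K r) (f i)).
  case=> hf ef hr _; split=> [j js|]; first by apply: Lm_act; [exact: inE7_E | exact: hf].
  by rewrite -(derivation_sum _ _ _ (act_deriv _ _)) ef (derivation0 (act_deriv _ _)).
have Qd (f : idx -> _) j : Q f -> j \in s -> f j \is (dg j).-homog.
  by case=> hf _ js; exact: Lm_homog (hf j js).
have gn : exists2 i, i \in s & g i != 0 by exists i.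
have [f [hf ef] [[j js fj] kf]] := raise hbeta Qa Qd (conj hg e) gn.
pose c i := herm (f i) (mon i) / herm (mon i) (mon i).
have hc k : k \in s -> f k = c k *: mon k.
  move=> ks; have [a ea] := generated_upkilled hbeta (mon_singular k) (hf k ks) (kf k ks).
  rewrite /c ea hermZl mulfK //; apply/eqP => h0.
  by have := mon_neq0 k; rewrite (herm_eq0 h0) eqxx.
have cj : c j = 0.
  apply: (mon_free us _ js); rewrite -[RHS]ef big_seq [RHS]big_seq.
  by apply: eq_bigr => k ks; rewrite hc.
by case/eqP: fj; rewrite hc // cj scale0r.
Qed.

Local Notation S := (sum_subspaces Lm).

Lemma S0 : S 0. Proof. exact: sum_subspaces0 Lm0. Qed.
Lemma SP k f g : S f -> S g -> S (k *: f + g).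
Proof. by apply: sum_subspacesP; [exact: Lm0 | exact: LmP]. Qed.
Lemma S_sum (I : eqType) (r : seq I) (F : I -> {mpoly K[56]}) :
  (forall i, i \in r -> S (F i)) -> S (\sum_(i <- r) F i).
Proof.
move=> h; rewrite big_seq; apply: big_ind => //; first exact: S0.
by move=> f g hf hg; rewrite -[f]scale1r; exact: SP.
Qed.
Lemma SZ k f : S f -> S (k *: f).
Proof. by move=> h; rewrite -[_ *: f]addr0; apply: SP => //; exact: S0. Qed.
Lemma S_mon n : S (mon n).
Proof. by apply: (sum_subspaces1 (i := n)); exact: generated_self. Qed.
Lemma S_act x f : inE7 x -> S f -> S (act x f).
Proof.
move=> hx [s [g [us hg ->]]]; rewrite (derivation_sum _ _ _ (act_deriv _ _)).
by exists s, (fun i => act x (g i)); split => // i is_; apply: Lm_act => //; exact: hg.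
Qed.

Lemma upkilled_S d f : f \is d.-homog -> upkilled beta f -> S f.
Proof.
move=> hf /(upkilled_gens hbeta)[Q e]; rewrite -(pihomog_dE hf) e comp_gensE raddf_sum /=.
apply: S_sum => m _; rewrite linearZ /=; apply: SZ.
case: (eqVneq d (dg (index_of m))) => [->|ne].
  by rewrite pihomog_dE ?mon_homog //; exact: S_mon.
by rewrite (pihomog_ne0 _ (mon_homog _)) //; [exact: S0 | rewrite eq_sym].
Qed.

(** The orthogonal complement of the sum of the modules generated by the
    products of the generators contains no singular vector, so it is zero. *)
Lemma homog_S d f : f \is d.-homog -> S f.
Proof.
move=> hf; pose V := dhomog 56 K d.
have [||U hU] := @vspace_of_pred K V (fun v => S (val v)).
- exact: S0.
- by move=> k u v; exact: SP.
have [allU|lt] := leqP (\dim {: V}) (\dim U).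
  have /eqP eU : U == fullv by rewrite eqEdim subvf.
  by apply/(hU (DHomog hf)); rewrite eU memvf.
(* By dimension count some nonzero y is orthogonal to U. *)
pose b := vbasis U; pose e := vbasis {: V}.
pose A : 'M[K]_(\dim {: V}, \dim U) := \matrix_(j, i) herm (val e`_j) (val b`_i).
have /rowV0Pn[u /sub_kermxP uA un] : kermx A != 0.
  rewrite kermx_eq0 /row_free neq_ltn (leq_ltn_trans (rank_leq_col A)) //.
pose y : V := \sum_j u 0 j *: e`_j.
have yE : val y = \sum_j u 0 j *: val e`_j by rewrite /y raddf_sum.
have yn : val y != 0.
  apply: contra un => /eqP y0; apply/eqP/rowP => j; rewrite mxE.
  have /freeP/(_ (fun j => u 0 j)) : free e by apply: basis_free (vbasisP _).
  by apply; apply: val_inj; rewrite -/y y0.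
have yb i : herm (val y) (val b`_(i : 'I_(\dim U))) = 0.
  have := congr1 (fun B : 'rV_(\dim U) => B 0 i) uA; rewrite !mxE yE herm_suml => e0.
  rewrite -[RHS]e0.
  by apply: eq_bigr => j _; rewrite mxE hermZl.
pose W g := g \is d.-homog /\ forall v, S v -> v \is d.-homog -> herm g v = 0.
have Wy : W (val y).
  split=> [|v Sv hv]; first exact: dhomog_is_dhomog.
  have /hU : S (val (DHomog hv)) by [].
  move/coord_vbasis => ev; have -> : v = \sum_i coord b i (DHomog hv) *: val b`_i.
    by rewrite -[v]/(val (DHomog hv)) {1}ev raddf_sum.
  by rewrite herm_sumr big1 // => i _; rewrite hermZr yb mulr0.
have [g r [hg og] hr pr|g []//|g [hg og] [gn gu]] :=
    @raise1 K beta hbeta d W _ _ (val y) Wy yn.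
  split=> [|v Sv hv]; first exact: linfield_homog.
  rewrite herm_E // og ?oppr0 //; first by apply/S_act/Sv/inE7_E/inQ7_neg.
  exact: linfield_homog.
by case/eqP: gn; apply: herm_eq0; apply: og => //; exact: upkilled_S hg gu.
Qed.

Lemma all_S f : S f.
Proof.
rewrite (pihomog_partitionE (mf := @mdeg 56) (leqnn (mmeasure _ f))).
apply: S_sum => i _; apply: (homog_S (d := i)); exact: pihomogP.
Qed.

Lemma singular_upkilled f : singular act f -> upkilled beta f.
Proof. by case=> l _ []. Qed.

Lemma wt_form n (j : 'I_8) : (j < 7)%N ->
  form (delta_mx 0 j) (wt n) =
  (let: (n1, n2, n3, n4, n5) := n in
   (j == 0%N :> nat) * n1 + (j == 5%N :> nat) * n2 + (j == 6%N :> nat) * (n3 + n4))%N%:R.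
Proof.
case: n => [[[[n1 n2] n3] n4] n5] hj; rewrite /wt !formDr !formMnr !(formC (delta_mx 0 j)).
by rewrite !lamE // !eqSS natrD natrD !natrM !mulr_natr.
Qed.

Local Notation D := (diff_op eta).

Lemma eta_real m : (eta@_m)^* = eta@_m.
Proof.
rewrite -[eta]/(ev K beta etaP) /ev raddf_sum rmorph_sum; apply: eq_bigr => t _ /=.
rewrite mcoeffZ rmorphM rmorph_int /=; congr (_ * _); rewrite /mev.
have -> : \prod_(k <- t.2) 'X_(sg k) = 'X_[\sum_(k <- t.2) U_(sg k)] :> {mpoly K[56]}.
  by rewrite mprodXE.
by rewrite mcoeffX rmorph_nat.
Qed.

Lemma herm_D f g : herm (D f) g = herm f (eta * g).
Proof. exact: herm_diff_op eta_real. Qed.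

Lemma herm_inj f : (forall g, herm f g = 0) -> f = 0.
Proof. by move=> h; exact: herm_eq0. Qed.

Lemma D_P k f g : D (k *: f + g) = k *: D f + D g.
Proof.
apply/eqP; rewrite -subr_eq0; apply/eqP/herm_inj => u.
by rewrite -scaleN1r addrC !hermPl !herm_D !hermPl; ring.
Qed.

(** D is adjoint to the multiplication by the invariant eta, which commutes with
    the action. *)
Lemma D_act x f : inE7 x -> D (act x f) = act x (D f).
Proof.
move=> hx; have [y hy adj] := E7_adjoint hbeta hx.
apply/eqP; rewrite -subr_eq0; apply/eqP/herm_inj => u.
rewrite -scaleN1r addrC hermPl adj !herm_D adj (act_deriv _ _).2 eta_invariant //.
by rewrite mul0r add0r mulN1r addNr.
Qed.

(** The image is a covariant, so it suffices that it be orthogonal to all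
    monomials k in the generators. By adjunction this product is that of n with
    eta k, and equality of weights and degrees would give
    n3 + n4 = k3 + k4 and n3 + 3 n4 = k3 + 3 k4 + 4 (k5 + 1), hence n4 >= 2. *)
Lemma D_mon n1 n2 n3 n4 : (n4 <= 1)%N -> D (mon (n1, n2, n3, n4, 0%N)) = 0.
Proof.
move=> h4; set n := (n1, n2, n3, n4, 0%N); apply: herm_eq0.
have kD : upkilled beta (D (mon n)).
  move=> r hr pr; rewrite -D_act ?inE7_E // (mon_upkilled n hr pr).
  by rewrite -[0](scaler0 _ (0 : K)) scale0r; apply: herm_inj => g; rewrite herm_D herm0l.
have [Q eQ] := upkilled_gens hbeta kD.
rewrite {2}eQ comp_gensE herm_sumr big1 // => m _; rewrite hermZr herm_D.
suff -> : herm (mon n) (eta * mon (index_of m)) = 0 by rewrite mulr0.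
have -> : eta * mon (index_of m) =
    mon (m (inord 1), m (inord 3), m (inord 0), m (inord 2), (m (inord 4)).+1).
  by rewrite /index_of /mon exprS; ring.
set k := (m (inord 1), _, _, _, _).
have w_ortho (j : 'I_8) : (j < 7)%N ->
  form (delta_mx 0 j) (wt n) != form (delta_mx 0 j) (wt k) -> herm (mon n) (mon k) = 0.
  move=> hj ne; apply: (herm_weight hbeta hj (mon_weight n) (mon_weight k) _ ne).
  by rewrite wt_form // rmorph_nat.
case: (eqVneq (dg n) (dg k)) => [ed|]; last exact: herm_homog (mon_homog n) (mon_homog k).
case: (eqVneq n1 (m (inord 1))) => [e1|ne]; last first.
  by apply: (w_ortho ord0) => //; rewrite !wt_form // /n /k /= !mul1n !mul0n !addn0 eqr_nat.
case: (eqVneq n2 (m (inord 3))) => [e2|ne]; last first.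
  by apply: (w_ortho (inord 5)); rewrite ?wt_form !inordK // /n /k /= !mul1n !mul0n !add0n !addn0 eqr_nat.
case: (eqVneq (n3 + n4)%N (m (inord 0) + m (inord 2))%N) => [e3|ne]; last first.
  by apply: (w_ortho (inord 6)); rewrite ?wt_form !inordK // /n /k /= !mul1n !mul0n !add0n eqr_nat.
by move: ed; rewrite /dg /n /k; lia.
Qed.

Lemma D_Lm n1 n2 n3 n4 f : (n4 <= 1)%N -> Lm (n1, n2, n3, n4, 0%N) f -> D f = 0.
Proof.
move=> h4 hf; apply: (hf (fun f => D f = 0)); last exact: D_mon.
have D0 : D 0 = 0 by apply: herm_inj => g; rewrite herm_D herm0l.
split=> [//|k f1 f2 e1 e2|x f1 hx e1]; first by rewrite D_P e1 e2 scaler0 addr0.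
by rewrite D_act // e1 (derivation0 (act_deriv _ _)).
Qed.

End Decomposition.

(** * Uniqueness of the irreducible modules *)

Section Below.
Variables (K : numFieldType) (M : lmodType K) (rho : E8alg K -> M -> M).
Hypothesis mod_rho : is_E7module rho.
Variable lam : nat -> 'rV[K]_8.
Hypothesis hlam : forall i : nat, (1 <= i <= 7)%N -> is_fundamental_weight i (lam i).

(** Its product with a root is the height of the root. *)
Definition h0 : 'rV[K]_8 := \sum_(i < 7) lam i.+1.

Lemma h0_H7 : inH7 h0.
Proof.
rewrite /inH7 /h0 summxE big1 // => i _.
by apply/eqP; case: (hlam (i := i.+1) (ltn_ord i)).
Qed.

Lemma form_h0 r : inQ7 r -> form h0 (toH K (val r)) = (\sum_k val r 0 k)%:~R.
Proof.
move=> /eqP hr; rewrite [toH K _]row_sum_delta form_sumr rmorph_sum; apply: eq_bigr => j _.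
rewrite formZr mxE /=; case: (ltnP j 7) => hj; last first.
  have -> : j = ord_max by apply/val_inj/eqP; rewrite eqn_leq hj -ltnS ltn_ord.
  by rewrite hr mul0r.
rewrite (_ : form h0 _ = 1) ?mulr1 // formC /h0 form_sumr (bigD1 (Ordinal hj)) //= big1.
  by rewrite addr0 formC; case: (hlam (i := j.+1) hj) => _ -> //; rewrite eqxx.
move=> i ij; rewrite formC; case: (hlam (i := i.+1) (ltn_ord i)) => _ -> //.
by rewrite eqSS; case: eqP => // e; case/eqP: ij; exact: val_inj.
Qed.

Lemma neg_height r : inQ7 r -> positive (negroot r) ->
  exists2 m : nat, (0 < m)%N & form h0 (toH K (val r)) = - m%:R.
Proof.
move=> hr /forallP pr; rewrite form_h0 //; pose S : int := \sum_k val (negroot r) 0 k.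
have eS : \sum_k val r 0 k = - S.
  by rewrite /S -sumrN; apply: eq_bigr => k _; rewrite negroot_val mxE opprK.
have S0 : 0 < S.
  rewrite lt_def sumr_ge0 ?andbT => [|k _]; last exact: pr.
  rewrite psumr_eq0 => [|k _]; last exact: pr.
  apply/negP => /allP z; have := root_form (negroot r).
  suff -> : val (negroot r) = 0 by rewrite form0l.
  by apply/rowP => k; rewrite [RHS]mxE; apply/eqP; apply: z; rewrite mem_index_enum.
exists (absz S); first by rewrite absz_gt0 gt_eqF.
by rewrite eS rmorphN /= -[in LHS](gtz0_abs S0).
Qed.

Variables (l : 'rV[K]_8) (v : M).
Hypothesis hv : singular_of_weight rho l v.

Local Notation T := (rho (Hel h0)).
Local Notation c := (form h0 l).

Lemma hH : inE7 (Hel h0). Proof. exact/inE7_H/h0_H7. Qed.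

Lemma T_E r m u : inQ7 r -> form h0 (toH K (val r)) = - m%:R ->
  T (rho (Eel K r) u) = rho (Eel K r) (T u) - m%:R *: rho (Eel K r) u.
Proof.
move=> hr e; have := rho_bracket mod_rho u hH (inE7_E K hr).
rewrite bracket_HE rhoZl ?inE7_E // e => /eqP; rewrite eq_sym subr_eq => /eqP ->.
by rewrite addrC scaleNr.
Qed.

(** The sums of eigenvectors of h0 with eigenvalues c - d, c - d - 1, and so on. *)
Definition graded_from (d : nat) (u : M) := exists n (F : nat -> M),
  [/\ forall j, T (F j) = (c - (d + j)%:R) *: F j, forall j, (n <= j)%N -> F j = 0
    & u = \sum_(j < n) F j].

Lemma graded_from_pred d u : graded_from d.+1 u -> graded_from d u.
Proof.
case=> n [F [TF F0 ->]]; exists n.+1, (fun j => if j is i.+1 then F i else 0).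
split=> [[|j]|[//|j]|]; first by rewrite rho0 ?hH // scaler0.
- by rewrite TF addSnnS.
- exact: F0.
- by rewrite big_ord_recl add0r.
Qed.

Lemma graded_from_le d e u : (d <= e)%N -> graded_from e u -> graded_from d u.
Proof.
by move/subnKC <-; elim: (e - d)%N => [|k IH]; rewrite ?addn0 ?addnS // => /graded_from_pred.
Qed.

Lemma graded_from0 d : graded_from d 0.
Proof.
by exists 0%N, (fun=> 0); split=> // [j|]; rewrite ?big_ord0 // rho0 ?hH // scaler0.
Qed.

Lemma graded_fromP d k u w : graded_from d u -> graded_from d w ->
  graded_from d (k *: u + w).
Proof.
case=> n [F [TF F0 ->]] [n' [F' [TF' F0' ->]]].
exists (maxn n n'), (fun j => k *: F j + F' j); split=> [j|j|].
- by rewrite rhoP ?hH // TF TF' scalerDr !scalerA mulrC.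
- by rewrite geq_max => /andP[h h']; rewrite F0 // F0' // scaler0 addr0.
have pad m (G : nat -> M) : (m <= maxn n n')%N -> (forall j, (m <= j)%N -> G j = 0) ->
    \sum_(j < m) G j = \sum_(j < maxn n n') G j.
  move=> hm G0; rewrite (big_ord_widen _ _ hm) [RHS](bigID (fun j : 'I__ => j < m)%N) /=.
  by rewrite [X in _ + X]big1 ?addr0 // => j; rewrite -leqNgt => /G0.
by rewrite (pad n F) ?leq_maxl // (pad n' F') ?leq_maxr // scaler_sumr -big_split.
Qed.

Lemma graded_from_neg d r u : inQ7 r -> positive (negroot r) -> graded_from d u ->
  graded_from d.+1 (rho (Eel K r) u).
Proof.
move=> hr pr [n [F [TF F0 ->]]]; have [m m0 em] := neg_height hr pr.
apply: (graded_from_le (e := (d + m)%N)); first by rewrite -addn1 leq_add2l.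
exists n, (fun j => rho (Eel K r) (F j)); split=> [j|j hj|].
- rewrite (T_E _ hr em) TF rhoZ ?inE7_E // -scalerBl; congr (_ *: _).
  by rewrite !natrD; ring.
- by rewrite F0 // rho0 ?inE7_E.
- by rewrite rho_sum ?inE7_E.
Qed.

Lemma below_graded u : below rho v u -> graded_from 1 u.
Proof.
elim=> [|k u1 u2 _ h1 _ h2|r hr pr|r u1 hr pr _ h].
- exact: graded_from0.
- exact: graded_fromP.
- apply: graded_from_neg => //; exists 1%N, (fun j => if j is 0%N then v else 0).
  case: hv => _ wv _; split=> [[|j]|[]//|]; last by rewrite big_ord1.
    by rewrite wv ?h0_H7 // subr0.
  by rewrite rho0 ?hH // scaler0.
- exact/graded_from_pred/graded_from_neg.
Qed.

(** Eigenvectors for distinct eigenvalues are independent: apply T - (c - n - 1)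
    to remove the last term. *)
Lemma eigen_indep n : forall (F : nat -> M) u,
  (forall j, T (F j) = (c - j.+1%:R) *: F j) -> T u = c *: u ->
  u = \sum_(j < n) F j -> u = 0.
Proof.
elim: n => [|n IH] F u hF hu e; first by rewrite e big_ord0.
suff : n.+1%:R *: u = 0 by move/eqP; rewrite scaler_eq0 pnatr_eq0 => /eqP.
apply: (IH (fun j => (n%:R - j%:R) *: F j)).
- by move=> j; rewrite rhoZ ?hH // hF !scalerA mulrC.
- by rewrite rhoZ ?hH // hu !scalerA mulrC.
have := congr1 (fun z => T z - (c - n.+1%:R) *: z) e.
rewrite hu -scalerBl opprB addrC subrK => ->.
rewrite rho_sum ?hH // scaler_sumr -sumrB big_ord_recr /= hF subrr addr0.
apply: eq_bigr => j _; rewrite hF -scalerBl; congr (_ *: _).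
by rewrite -!natr1; ring.
Qed.

(** Nonempty words in the negative root vectors lower the eigenvalue of h0. *)
Lemma not_below : ~ below rho v v.
Proof.
case: hv => vn wv _ /below_graded[n [F [hF _ e]]]; case/eqP: vn.
by apply: (eigen_indep hF _ e); rewrite wv // h0_H7.
Qed.

End Below.

Section Unique.
Variables (K : numFieldType) (lam : nat -> 'rV[K]_8).
Hypothesis hlam : forall i : nat, (1 <= i <= 7)%N -> is_fundamental_weight i (lam i).

Section Pair.
Variables (M1 M2 : lmodType K) (rho1 : E8alg K -> M1 -> M1) (rho2 : E8alg K -> M2 -> M2).
Hypotheses (mod1 : is_E7module rho1) (mod2 : is_E7module rho2).
Variables (l : 'rV[K]_8) (v1 : M1) (v2 : M2).
Hypotheses (hv1 : singular_of_weight rho1 l v1) (hv2 : singular_of_weight rho2 l v2).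

Definition rho12 (x : E8alg K) (p : M1 * M2) : M1 * M2 := (rho1 x p.1, rho2 x p.2).

Lemma mod12 : is_E7module rho12.
Proof.
split=> [x hx k u v|x y hx hy k v|x y hx hy v]; rewrite /rho12.
- by congr (_, _); rewrite /= rhoP.
- by congr (_, _); rewrite /= rhoPl.
- by congr (_, _); rewrite /= rho_bracket.
Qed.

Lemma singular12 : singular_of_weight rho12 l (v1, v2).
Proof.
case: hv1 hv2 => n1 w1 k1 [n2 w2 k2]; split.
- by apply: contra n1 => /eqP [-> _].
- by move=> h hh; rewrite /rho12 /= w1 // w2.
- by move=> r hr pr; rewrite /rho12 /= k1 // k2.
Qed.

Lemma below12 p : below rho12 (v1, v2) p -> below rho1 v1 p.1 /\ below rho2 v2 p.2.
Proof.
elim=> [|k u w _ [a1 a2] _ [b1 b2]|r hr nr|r u hr nr _ [a1 a2]] /=.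
- by split; exact: below0.
- by split; exact: belowP.
- by split; exact: below1.
- by split; exact: belowS.
Qed.

Local Notation G := (generated rho12 (v1, v2)).

(** An element of the module generated by (v1, v2) is k (v1, v2) plus words; here
    k = 0 since v2 is not a combination of words, and then v1 would be one. *)
Lemma G_left : ~ G (v1, 0).
Proof.
move/(generated_spanned mod12 singular12) => [k [[b1 b2] /below12[/= h1 h2] [e1 e2]] _].
have k0 : k = 0.
  apply/eqP/negPn/negP => kn; apply: (not_below mod2 hlam hv2).
  have e : v2 = (- k^-1) *: b2 + 0.
    apply: (scalerI kn); rewrite addr0 scalerA mulrN mulfV // scaleN1r.
    by apply/eqP; rewrite -addr_eq0 -e2.
  by rewrite {2}e; apply: belowP => //; exact: below0.
by apply: (not_below mod1 hlam hv1); rewrite {2}e1 k0 scale0r add0r.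
Qed.

End Pair.

(** The module G generated by (v1, v2) projects onto M1, as its image contains v1,
    and meets M1 x 0 in a proper submodule of M1, hence in 0. So elements of G
    over a basis of M1 have independent second components. *)
Lemma dim_le (M1 M2 : vectType K) rho1 rho2 l (v1 : M1) (v2 : M2) :
  is_E7module rho1 -> is_E7module rho2 ->
  irreducible rho1 (fun _ => True) ->
  singular_of_weight rho1 l v1 -> singular_of_weight rho2 l v2 ->
  (\dim {: M1} <= \dim {: M2})%N.
Proof.
move=> mod1 mod2 [_ _ irr] hv1 hv2.
pose G := generated (rho12 rho1 rho2) (v1, v2).
have [G0 GP GE] : submodule (rho12 rho1 rho2) G by exact: generated_submod.
have inj u : G (u, 0) -> u = 0.
  have [|//|zero|all] := irr (fun u => G (u, 0)).
  - split=> [|k a b ha hb|x a hx ha]; first exact: G0.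
      have -> : (k *: a + b, 0) = k *: (a, 0) + (b, 0) :> M1 * M2.
        by congr (_, _); rewrite /= scaler0 addr0.
      exact: GP.
    have -> : (rho1 x a, 0) = rho12 rho1 rho2 x (a, 0) by rewrite /rho12 /= rho0.
    exact: GE.
  - exact: zero.
  - by case: (G_left mod1 mod2 hv1 hv2 (all v1 I)).
have surj u : exists u2, G (u, u2).
  have [|//|zero|all] := irr (fun u => exists u2, G (u, u2)).
  - split=> [|k a b [a2 ha] [b2 hb]|x a hx [a2 ha]]; first by exists 0.
      by exists (k *: a2 + b2); have := GP k _ _ ha hb.
    by exists (rho2 x a2); have := GE x _ hx ha.
  - case: hv1 => /eqP[]; apply: zero; exists v2; exact: generated_self.
  - exact: all.
pose e := vbasis {: M1}.
have [f hf] : exists f : 'I_(\dim {: M1}) -> M2, forall i : 'I__, G (e`_i, f i).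
  apply: (@fin_all_exists _ (fun=> M2) (fun (i : 'I__) u2 => G (e`_i, u2))) => i; exact: surj.
pose X := [tuple f i | i < \dim {: M1}].
have frX : free X.
  apply/freeP => k; under eq_bigr do rewrite -tnth_nth tnth_mktuple.
  move=> k0; have /freeP fe : free e by apply: basis_free (vbasisP _).
  apply: fe; apply: inj; rewrite -k0.
  elim: (index_enum _) => [|i s IH]; first by rewrite !big_nil; exact: G0.
  by rewrite !big_cons; exact: (GP (k i) (e`_i, f i) _ (hf i) IH).
by move: frX; rewrite /free size_tuple => /eqP <-; rewrite dimvS ?subvf.
Qed.

Lemma is_dimV_unique (l : 'rV[K]_8) d1 d2 : is_dimV l d1 -> is_dimV l d2 -> d1 = d2.
Proof.
move=> [M1 [rho1 [m1 i1 [v1 s1] <-]]] [M2 [rho2 [m2 i2 [v2 s2] <-]]].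
by apply/eqP; rewrite eqn_leq (dim_le m1 m2 i1 s1 s2) (dim_le m2 m1 i2 s2 s1).
Qed.

Lemma dimVE (l : 'rV[K]_8) d : is_dimV l d -> dimV l = d.
Proof.
move=> h; apply: (is_dimV_unique (l := l)) => //.
by apply: ClassicalEpsilon.epsilon_spec; exists d.
Qed.

End Unique.

(** * Power series *)

Section Series.
Variable N : nat.
Implicit Types p q r : {poly int}.

(** Power series are compared modulo degree N + 1, as polynomials. *)
Definition eqm p q := forall i, (i <= N)%N -> p`_i = q`_i.

Lemma eqm_mul r p q : eqm p q -> eqm (r * p) (r * q).
Proof.
move=> h i hi; rewrite !coefM; apply: eq_bigr => j _; rewrite h //.
by apply: leq_trans hi; exact: leq_subr.
Qed.

Lemma eqm_trans p q r : eqm p q -> eqm q r -> eqm p r.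
Proof. by move=> h1 h2 i hi; rewrite h1 // h2. Qed.

(** The truncation of (1 - q)^(-k - 1). *)
Definition binser k : {poly int} := \poly_(i < N.+1) ('C(i + k, k))%:Z.

Lemma coef_1BX p i : ((1 - 'X) * p)`_i = p`_i - (if i is j.+1 then p`_j else 0).
Proof. by rewrite mulrBl mul1r coefB coefXM; case: i. Qed.

Lemma binser_rec k : eqm ((1 - 'X) * binser k.+1) (binser k).
Proof.
move=> i hi; rewrite coef_1BX !coef_poly ltnS hi; case: i hi => [|i] hi.
  by rewrite !add0n !binn subr0.
rewrite coef_poly (ltn_trans (ltnSn i)) // addSnnS !addnS binS PoszD.
by rewrite addSn addrC addKr.
Qed.

Lemma binser0 : eqm ((1 - 'X) * binser 0) 1.
Proof.
move=> i hi; rewrite coef_1BX coef_poly ltnS hi bin0 coef1; case: i hi => [|i] hi.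
  by rewrite subr0.
by rewrite coef_poly (ltn_trans (ltnSn i)) // bin0 subrr.
Qed.

Lemma binserE k : eqm ((1 - 'X) ^+ k.+1 * binser k) 1.
Proof.
elim: k => [|k IH]; first by rewrite expr1; exact: binser0.
rewrite exprSr -mulrA; apply: eqm_trans IH; apply: eqm_mul; exact: binser_rec.
Qed.

End Series.

(** The hypothesis says that S has the generating series (1 - q^4) (1 - q)^(-56),
    and 1 - q^4 = (1 - q) (1 + q + q^2 + q^3). *)
Lemma series_identity (S : nat -> int) :
  (forall N, S N = ('C(N + 55, 55))%:Z - (if (4 <= N)%N then ('C(N - 4 + 55, 55))%:Z else 0)) ->
  forall N, fps_mul (fun i => ((1 - 'X) ^+ 55 : {poly int})`_i) S N
     = (1 + 'X + 'X^2 + 'X^3 : {poly int})`_N.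
Proof.
move=> hS N; pose PS : {poly int} := \poly_(i < N.+1) S i.
have -> : fps_mul (fun i => ((1 - 'X) ^+ 55 : {poly int})`_i) S N = ((1 - 'X) ^+ 55 * PS)`_N.
  rewrite coefM /fps_mul; apply: eq_bigr => i _; rewrite coef_poly ltnS leq_subr //.
have eS : eqm N PS ((1 - 'X^4) * binser N 55).
  move=> i hi; rewrite coef_poly ltnS hi hS mulrBl mul1r coefB coefXnM !coef_poly ltnS hi.
  by case: (ltnP i 4) => h4; rewrite ?ltnS ?(leq_trans (leq_subr _ _) hi).
rewrite (eqm_mul _ eS) // mulrA.
have -> : (1 - 'X : {poly int}) ^+ 55 * (1 - 'X^4) = (1 + 'X + 'X^2 + 'X^3) * (1 - 'X) ^+ 56.
  rewrite [in RHS]exprS mulrA [LHS]mulrC; congr (_ * _); ring.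
by rewrite -mulrA (eqm_mul _ (@binserE N 55)) // mulr1.
Qed.

(** * Dimensions *)

Section Dimensions.
Variables (K : numClosedFieldType) (beta : 'I_56 -> E8root).
Hypothesis hbeta : is_basis_enum beta.
Variable lam : nat -> 'rV[K]_8.
Hypothesis hlam : forall i : nat, (1 <= i <= 7)%N -> is_fundamental_weight i (lam i).

Local Notation act := (@actA K beta).
Local Notation idx := (nat * nat * nat * nat * nat)%type.
Local Notation mon := (@mon K beta).
Local Notation Lm := (@Lm K beta).
Local Notation wt := (wt lam).

Section Component.
Variables (n : idx) (N : nat).
Hypothesis hN : dg n = N.
Variable U : {vspace dhomog 56 K N}.
Hypothesis hU : forall v, v \in U <-> Lm n (val v).

(** Component n, a subspace of the homogeneous polynomials, is made a module on a
    finite-dimensional space through the projection onto U. *)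
Definition emb (u : subvs_of U) : {mpoly K[56]} := val (vsval u).
Definition rhoU (x : E8alg K) (u : subvs_of U) : subvs_of U :=
  vsproj U (indhomog N (act x (emb u))).

Lemma emb_inj : injective emb.
Proof. by move=> u v /val_inj /val_inj. Qed.

Lemma embP k u v : emb (k *: u + v) = k *: emb u + emb v.
Proof. by rewrite /emb linearP. Qed.

Lemma emb0 : emb 0 = 0. Proof. by rewrite /emb linear0. Qed.

Lemma embB u v : emb (u - v) = emb u - emb v.
Proof. by rewrite addrC -scaleN1r embP scaleN1r addrC. Qed.

Lemma emb_Lm u : Lm n (emb u). Proof. exact/hU/subvsP. Qed.

Lemma emb_proj f : Lm n f -> emb (vsproj U (indhomog N f)) = f.
Proof.
move=> hf; have e : val (indhomog N f) = f.
  by rewrite /indhomog insubdK // -hN; exact: (Lm_homog hf).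
by rewrite /emb vsprojK ?e //; apply/hU; rewrite e.
Qed.

Lemma emb_rho x u : inE7 x -> emb (rhoU x u) = act x (emb u).
Proof. by move=> hx; rewrite emb_proj //; apply: Lm_act => //; exact: emb_Lm. Qed.

Lemma is_dimV_Lm : is_dimV (wt n) (\dim U).
Proof.
have [a1 a2 a3] := actA_module K hbeta.
exists (subvs_of U), rhoU; split.
- split=> [x hx k u v|x y hx hy k v|x y hx hy v]; apply: emb_inj.
  + by rewrite embP !emb_rho // embP a1.
  + by rewrite embP !emb_rho ?inE7_P // a2.
  + have eR x' y' : inE7 x' -> inE7 y' -> emb (rhoU x' (rhoU y' v)) = act x' (act y' (emb v)).
      move=> h h'; exact: etrans (emb_rho (rhoU y' v) h) (congr1 (act x') (emb_rho v h')).
    have eL : emb (rhoU (bracket x y) v) = act x (act y (emb v)) - act y (act x (emb v)).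
      rewrite -[RHS](a3 x y hx hy (emb v)); apply: emb_proj; rewrite (a3 x y hx hy (emb v)).
      rewrite addrC -[X in X + _]scaleN1r.
      exact: LmP (Lm_act hy (Lm_act hx (emb_Lm v))) (Lm_act hx (Lm_act hy (emb_Lm v))).
    rewrite [LHS]eL [RHS]embB.
    exact: (congr2 (fun f g => f - g) (esym (eR x y hx hy)) (esym (eR y x hy hx))).
- split=> //.
    exists (vsproj U (indhomog N (mon n))) => //; apply/eqP => e.
    have := @emb_proj (mon n) (@generated_self _ _ act _); rewrite e emb0 => e0.
    by have := mon_neq0 K hbeta n; rewrite -e0 eqxx.
  move=> W [W0 WP WE] _; have [_ _ irr] := Lm_irreducible hbeta hlam n.
  have [|f [u _ <-]|zero|all] := irr (fun f => exists2 u, W u & emb u = f).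
  + split=> [|k f g [u hu <-] [v hv <-]|x f hx [u hu <-]].
    * by exists 0; rewrite ?emb0.
    * by exists (k *: u + v); [exact: WP | exact: embP].
    * by exists (rhoU x u); [exact: WE | exact: emb_rho].
  + exact: emb_Lm.
  + by left=> u hu; apply: emb_inj; rewrite emb0; apply: zero; exists u.
  + by right=> u _; have [v hv /emb_inj <-] := all _ (emb_Lm u).
- have e := @emb_proj (mon n) (@generated_self _ _ act _).
  set v := vsproj _ _ in e; exists v; have [vn wv kv] := mon_singular hbeta hlam n.
  split.
  + by apply: contra vn => /eqP v0; rewrite -e v0 emb0.
  + move=> h hh; apply: emb_inj; rewrite emb_rho; last exact/inE7_H.
    by rewrite e wv // -[_ *: v]addr0 embP emb0 addr0 e.
  + by move=> r hr pr; apply: emb_inj; rewrite emb_rho ?inE7_E // e emb0 kv.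
- by rewrite dimvf.
Qed.

End Component.

(** The components of degree N decompose the space of polynomials of degree N. *)
Lemma dim_homog_sum (s : seq idx) (N : nat) : uniq s ->
  (forall n, (n \in s) = (dg n == N)) ->
  'C(N + 55, 55) = (\sum_(n <- s) dimV (wt n))%N.
Proof.
move=> us hs; pose V := dhomog 56 K N; pose n0 : idx := (0, 0, 0, 0, 0)%N.
have hd (i : 'I_(size s)) : dg (nth n0 s i) = N.
  by apply/eqP; rewrite -hs mem_nth.
have [|U hU] := @fin_all_exists 'I_(size s) (fun=> {vspace V})
  (fun i U => forall v, v \in U <-> Lm (nth n0 s i) (val v)).
  move=> i; apply: vspace_of_pred; first exact: Lm0.
  by move=> k u v; exact: LmP.
have -> : 'C(N + 55, 55) = \dim {: V}.
  by rewrite dimvf /dim /= -[in RHS](bin_sub (leq_addr _ _)) addKn.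
have full : (\sum_i U i)%VS = fullv.
  apply/eqP; rewrite eqEsubv subvf; apply/subvP => v _.
  have [t [g [ut hg ev]]] := all_S hbeta (val v).
  have vP (f : {mpoly K[56]}) : val (indhomog N (pihomog (@mdeg 56) N f)) = pihomog (@mdeg 56) N f.
    by rewrite /indhomog insubdK //; exact: pihomogP.
  have -> : v = \sum_(i <- t) indhomog N (pihomog (@mdeg 56) N (g i)).
    apply: val_inj; rewrite raddf_sum -[LHS](pihomog_dE (dhomog_is_dhomog v)) ev raddf_sum.
    by apply: eq_bigr => i _; rewrite /= vP.
  rewrite big_seq; apply: rpred_sum => n nt.
  case: (eqVneq N (dg n)) => [e|ne]; last first.
    have -> : indhomog N (pihomog (@mdeg 56) N (g n)) = 0.
      by apply: val_inj; rewrite vP (pihomog_ne0 _ (Lm_homog (hg n nt))) // eq_sym.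
    exact: mem0v.
  have hi : (index n s < size s)%N by rewrite index_mem hs e.
  apply: (subvP (sumv_sup (Ordinal hi) _ (subvv _))) => //; apply/hU.
  by rewrite vP /= nth_index ?hs ?e // pihomog_dE; [exact: hg | exact: Lm_homog (hg n nt)].
have dir : directv (\sum_i U i).
  apply/directv_sum_independent => us' hus e i _; apply: val_inj.
  pose g n := \sum_(i < size s | nth n0 s i == n) val (us' i).
  have gi (j : 'I_(size s)) : g (nth n0 s j) = val (us' j).
    by rewrite /g (big_pred1 j) // => k /=; rewrite nth_uniq.
  rewrite -gi /=; apply: (Lm_direct hbeta hlam us) => [n /(nthP n0)[k hk <-]||].
  - by rewrite (gi (Ordinal hk)); exact/(hU (Ordinal hk))/hus.
  - rewrite (big_nth n0) big_mkord -[RHS](congr1 val e) raddf_sum.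
    by apply: eq_bigr => k _; rewrite gi.
  - exact: mem_nth.
rewrite -full (directvP dir) /= (big_nth n0) big_mkord; apply: eq_bigr => i _.
exact/esym/(dimVE hlam)/(is_dimV_Lm (hd i) (hU i)).
Qed.

Definition of_bounded N (t : 'I_N.+1 * 'I_N.+1 * 'I_N.+1 * 'I_N.+1) : idx :=
  let: (n1, n2, n3, n4) := t in (n1 : nat, n2 : nat, n3 : nat, n4 : nat, 0%N).

(** The indices of degree N with n5 = 0. *)
Definition indices0 (N : nat) : seq idx :=
  [seq of_bounded t | t <- index_enum ('I_N.+1 * 'I_N.+1 * 'I_N.+1 * 'I_N.+1)%type
     & dg (of_bounded t) == N].

Definition raise5 (n : idx) : idx :=
  let: (n1, n2, n3, n4, n5) := n in (n1, n2, n3, n4, n5.+1).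

Definition indices_of_degree (N : nat) (s : seq idx) : Prop :=
  uniq s /\ forall n, (n \in s) = (dg n == N).

Lemma mem_indices0 N n : (n \in indices0 N) = (n.2 == 0%N) && (dg n == N).
Proof.
apply/mapP/andP => [[t]|[]].
  by rewrite mem_filter => /andP[ht _] ->; rewrite ht; case: t {ht} => -[[a b] c] d.
case: n => [[[[n1 n2] n3] n4] n5] /= /eqP -> hd; move: (hd); rewrite /dg muln0 addn0 => hN.
have [l1 l2 l3 l4] : [/\ (n1 < N.+1)%N, (n2 < N.+1)%N, (n3 < N.+1)%N & (n4 < N.+1)%N].
  by move/eqP: hN => hN; split; lia.
by exists (Ordinal l1, Ordinal l2, Ordinal l3, Ordinal l4); rewrite // mem_filter mem_index_enum andbT /of_bounded.
Qed.

Lemma uniq_indices0 N : uniq (indices0 N).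
Proof.
rewrite map_inj_uniq ?filter_uniq ?index_enum_uniq // => -[[[a b] c] d] [[[a' b'] c'] d'] [].
by do 4!move/val_inj->.
Qed.

(** An index of degree N has n5 = 0 or is raised from degree N - 4. *)
Lemma indices_step N s : ((4 <= N)%N -> indices_of_degree (N - 4) s) ->
  indices_of_degree N (indices0 N ++ if (4 <= N)%N then map raise5 s else [::]).
Proof.
have inj : injective raise5.
  by move=> [[[[a b] c] d] e] [[[[a' b'] c'] d'] e'] [-> -> -> -> ->].
have low n : n.2 = 0%N -> n \notin map raise5 s.
  by move=> n0; apply/mapP => -[[[[[a b] c] d] e] _ en]; rewrite en in n0.
have split5 n : n.2 = 0%N \/ exists k, n = raise5 k.
  by case: n => [[[[a b] c] d] [|e]]; [left | right; exists (a, b, c, d, e)].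
have dg5 n : dg (raise5 n) = (dg n + 4)%N.
  by case: n => [[[[a b] c] d] e]; rewrite /dg /raise5; lia.
case: (leqP 4 N) => h4 hs.
  have [us ms] := hs isT; split.
    rewrite cat_uniq uniq_indices0 map_inj_uniq // us andbT /=.
    apply/hasPn => n; apply: contraL; rewrite mem_indices0 => /andP[/eqP n0 _].
    exact: low.
  move=> n; rewrite mem_cat mem_indices0; case: (split5 n) => [n0|[k ->]].
    by rewrite (negbTE (low n n0)) n0 orbF.
  have -> : ((raise5 k).2 == 0%N) = false by case: k => [[[[a b] c] d] e].
  by rewrite mem_map // ms dg5 /= -[in RHS](subnK h4) eqn_add2r.
rewrite cats0; split; first exact: uniq_indices0.
move=> n; rewrite mem_indices0; case: (split5 n) => [-> //|[k ->]].
have -> : ((raise5 k).2 == 0%N) = false by case: k => [[[[a b] c] d] e].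
by apply/esym/negbTE; rewrite dg5 neq_ltn (leq_trans h4) ?leq_addl ?orbT.
Qed.

Lemma indices_exist N : exists s, indices_of_degree N s.
Proof.
elim/ltn_ind: N => N IH; case: (leqP 4 N) => h4.
  have [|s hs] := IH (N - 4)%N; first lia.
  by eexists; apply: indices_step (fun _ => hs).
by eexists; apply: (@indices_step N [::]) => h; move: h4; rewrite ltnNge h.
Qed.

(** The left-hand side runs over the indices with n5 = 0; the others of degree N
    have the same weights as all those of degree N - 4. *)
Lemma graded_series_dim N :
  graded_series (fun n1 n2 n3 n4 => dimV (lam 1%N *+ n1 + lam 6%N *+ n2 + lam 7%N *+ (n3 + n4))) N
  = ('C(N + 55, 55))%:Z - (if (4 <= N)%N then ('C(N - 4 + 55, 55))%:Z else 0).
Proof.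
have -> : graded_series (fun n1 n2 n3 n4 =>
      dimV (lam 1%N *+ n1 + lam 6%N *+ n2 + lam 7%N *+ (n3 + n4))) N
    = (\sum_(n <- indices0 N) dimV (wt n))%:Z.
  rewrite /graded_series big_map big_filter (big_morph Posz PoszD erefl) !pair_big pair_big_dep /=.
  by apply: eq_big => [[[[a b] c] d]|[[[a b] c] d] _] //=; rewrite /dg addn0.
have [s hs] := indices_exist (N - 4).
have [ut mt] := indices_step (N := N) (fun _ => hs).
rewrite (dim_homog_sum ut mt) big_cat /= PoszD; case: hs => us ms.
case: (leqP 4 N) => h4; last by rewrite big_nil addr0 subr0.
rewrite (dim_homog_sum us ms) big_map.
by under [X in _ + Posz X - _]eq_bigr => n _ do [rewrite (_ : wt (raise5 n) = wt n); last by case: n => [[[[a b] c] d] e]]; rewrite addrK.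
Qed.

End Dimensions.

Theorem mainTheorem1 (R : realType) (beta : 'I_56 -> E8root)
    (lam : nat -> 'rV[R[i]]_8) :
  is_basis_enum beta ->
  (forall i : nat, (1 <= i <= 7)%N -> is_fundamental_weight i (lam i)) ->
  let act := @actA R[i] beta in
  let x1 : {mpoly R[i][56]} := 'X_ord0 in
  let wt (n1 n2 m : nat) := lam 1%N *+ n1 + lam 6%N *+ n2 + lam 7%N *+ m in
  exists zeta1 theta sigma eta : {mpoly R[i][56]},
  let mon (n1 n2 n3 n4 n5 : nat) :=
    zeta1 ^+ n1 * sigma ^+ n2 * x1 ^+ n3 * theta ^+ n4 * eta ^+ n5 in
  let L (n1 n2 n3 n4 n5 : nat) := generated act (mon n1 n2 n3 n4 n5) in
  [/\ [/\ singular_of_weight act (lam 7%N) x1 /\ x1 \is 1.-homog,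
          singular_of_weight act (lam 1%N) zeta1 /\ zeta1 \is 2.-homog,
          singular_of_weight act (lam 7%N) theta /\ theta \is 3.-homog,
          singular_of_weight act (lam 6%N) sigma /\ sigma \is 4.-homog
        & [/\ singular_of_weight act 0 eta, eta \is 4.-homog
            & is_invariant act eta]],
      forall f : {mpoly R[i][56]}, singular act f ->
        exists p : {mpoly R[i][5]},
          f = p \mPo [tuple x1; zeta1; theta; sigma; eta],
      (forall n1 n2 n3 n4 n5 : nat,
         irreducible act (L n1 n2 n3 n4 n5) /\
         singular_of_weight act (wt n1 n2 (n3 + n4)%N) (mon n1 n2 n3 n4 n5)) /\
      direct_decomposition
        (fun n : nat * nat * nat * nat * nat =>
           let: (n1, n2, n3, n4, n5) := n in L n1 n2 n3 n4 n5),
      forall N : nat,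
        fps_mul (fun i => ((1 - 'X) ^+ 55 : {poly int})`_i)
          (graded_series (fun n1 n2 n3 n4 => dimV (wt n1 n2 (n3 + n4)%N))) N
        = (1 + 'X + 'X^2 + 'X^3 : {poly int})`_N
    & forall f : {mpoly R[i][56]},
        sum_subspaces
          (fun n : nat * nat * nat =>
             let: (n1, n2, n3) := n in
             add_subspaces (L n1 n2 n3 0%N 0%N) (L n1 n2 n3 1%N 0%N)) f ->
        diff_op eta f = 0].
Proof.
move=> hbeta hlam act X1 W; have hm := mon_singular hbeta hlam.
exists (zeta1 R[i] beta), (theta R[i] beta), (sigma R[i] beta), (eta R[i] beta) => M L.
split.
- split.
  + split; last exact: (x1_homog R[i]).
    split; [exact: (x1_neq0 R[i] hbeta) | exact: (x1_weight hbeta hlam) | exact: (x1_upk R[i] hbeta)].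
  + split; last exact: zeta1_homog.
    split; [exact: zeta1_neq0 | exact: (zeta1_weight hbeta hlam) | exact: zeta1_upkilled].
  + split; last exact: theta_homog.
    split; [exact: theta_neq0 | exact: (theta_weight hbeta hlam) | exact: theta_upkilled].
  + split; last exact: sigma_homog.
    split; [exact: sigma_neq0 | exact: (sigma_weight hbeta hlam) | exact: sigma_upkilled].
  + split; [|exact: eta_homog|exact: eta_invariant].
    split; [exact: eta_neq0 | exact: eta_weight | exact: eta_upkilled].
- by move=> f /(singular_upkilled)/(upkilled_gens hbeta)[p ->]; exists p.
- split.
    move=> n1 n2 n3 n4 n5; split; first exact: (Lm_irreducible hbeta hlam (n1, n2, n3, n4, n5)).
    exact: (hm (n1, n2, n3, n4, n5)).
  split=> [f|s g us hg e].
    have [s [g [us hg e]]] := all_S hbeta f; exists s, g; split=> //.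
    by move=> n /hg; case: n => -[[[n1 n2] n3] n4] n5.
  apply: (Lm_direct hbeta hlam us) => // n /hg; case: n => -[[[n1 n2] n3] n4] n5.
  exact.
- by move=> N; apply: series_identity => k; exact: (graded_series_dim hbeta hlam).
- move=> f [s [g [_ hg ->]]]; rewrite big_seq.
  apply: (big_ind (fun f => diff_op (eta R[i] beta) f = 0)).
  + by rewrite /diff_op big1 // => m _; rewrite raddf0 scaler0.
  + by move=> f1 f2 e1 e2; rewrite -[f1]scale1r (D_P beta) e1 e2 scaler0 addr0.
  + move=> n /hg; case: n => -[n1 n2] n3 [f1 [f2 [h1 h2 ->]]].
    rewrite -[f1]scale1r (D_P beta) (D_Lm hbeta hlam (n4 := 0) _ h1) //.
    by rewrite (D_Lm hbeta hlam (n4 := 1) _ h2) // scaler0 addr0.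
Qed.
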